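(* Let $\alpha\in(0,1)$ be irrational with modified continued fraction expansion $\alpha=\cfrac{1}{e_1-\cfrac{1}{e_2-\cfrac{1}{e_3-\cdots}}}$, and suppose that there is $N$ such that the integers $e_j$ satisfy $3\leq e_j\leq N$ for all $j\geq 1$. Let $f$, $w$, $g_\alpha$, $D_+$ and $M_\alpha$ be as defined in the context. Then the metric $g_\alpha$ is defined on $D_+\times T^2$ (that is, $f$ and $w$ are nowhere zero on $D_+$, so that the formula for $g_\alpha$ gives a smooth Riemannian metric there), and $g_\alpha$ extends smoothly to $M_\alpha$, i.e. there is a smooth Riemannian metric on $M_\alpha$ whose restriction to $\pi^{-1}(D_+)=D_+\times T^2$ is $g_\alpha$.
   Context: Continued fraction data. Define integer pairs by $(m_0,n_0)=(0,-1)$, $(m_1,n_1)=(1,0)$ and, for $j\geq 2$, $(m_j,n_j)$ coprime with $m_j>0$ and $\frac{n_j}{m_j}=\cfrac{1}{e_1-\cfrac{1}{e_2-\cdots\cfrac{1}{e_{j-1}}}}$. Set $a_j=\frac{n_{j+1}-n_j}{m_{j+1}-m_j}$ for $j\geq 0$ and $a_{-1}=\infty$. The sequence $(a_j)_{j\ge0}$ is strictly decreasing with $a_0=1$ and limit $\alpha$, and $m_jn_{j+1}-m_{j+1}n_j=1$. The envelope of $\alpha$ is the continuous function $\eta_\alpha:\mathbb{R}\to\mathbb{R}$ with $\eta_\alpha(x)=m_jx-n_j$ for $x\in[a_j,a_{j-1}]$, $j\geq0$ (so $\eta_\alpha(x)=1$ for $x\geq 1$) and $\eta_\alpha(x)=0$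 for $x\leq\alpha$. The metric $g_\alpha$. Put $u(x)=\eta_\alpha(x)-\eta_\alpha(2\alpha-x)$ and, for $y>0$, $$f(x,y)=\int_{\mathbb{R}}\frac{y^2}{2((x-x_1)^2+y^2)^{3/2}}\,u(x_1)\,dx_1 ,$$ $$w=f_x^2+f_y^2-y^{-1}ff_y,\qquad v_1=(f_y,\ xf_y-yf_x),\qquad v_2=(f_x,\ xf_x+yf_y-f).$$ Let $\varepsilon(z',z'')=z_1'z_2''-z_2'z_1''$ on $\mathbb{R}^2$. Let $T^2=\mathbb{R}^2/(2\pi\mathbb{Z})^2$ with linear coordinates $z=(z_1,z_2)$, $dz=(dz_1,dz_2)$, and $$g_\alpha=\frac{|w|}{f^2}\left(dx^2+dy^2+\frac{\varepsilon(v_1,dz)^2+\varepsilon(v_2,dz)^2}{w^2}\right).$$ The manifold $M_\alpha$. $S^1_{(m,n)}$ denotes the circle subgroup of $T^2$ generated by $m\partial_{z_1}+n\partial_{z_2}$. Let $D_+=\{(x,y):x>\alpha,\ y>0\}$ and $\overline{D}_+=D_+\cup\{(x,0):x>\alpha\}$. The boundary $\{(x,0):x>\alpha\}$ is the union of the edges $[a_j,a_{j-1}]$, $j\geq 0$ (for $j=0$, the edge is $[1,\infty)$); the points $a_j$, $j\geq0$, are the corners. $M_\alpha$ is obtained from $\overline{D}_+\times T^2$ by collapsing the circle $S^1_{(m_j,n_j)}$ over each interior point of the edge $[a_j,a_{j-1}]$ and collapsing all of $T^2$ over each corner. It has a $T^2$-action and a projection $\pi:M_\alpha\to\overline{D}_+$,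 with $\pi^{-1}(D_+)=D_+\times T^2$. Its smooth structure is the product one over $D_+$. Near an interior point of the edge labelled $(m,n)=(m_j,n_j)$, choose $(p,q)$ so that $(m,n),(p,q)$ is a $\mathbb{Z}$-basis of $\mathbb{Z}^2$ and write $z=s(m,n)+t(p,q)$; then $(x,\,t \bmod 2\pi,\,ye^{is})$ are smooth coordinates. Near the corner $a_j$, write $x-a_j+iy=(r_2+ir_1)^2$ with $r_1,r_2\geq 0$ and $z=s_1(m_j,n_j)+s_2(m_{j+1},n_{j+1})$; then $(r_1e^{is_1},r_2e^{is_2})\in\mathbb{C}^2=\mathbb{R}^4$ are smooth coordinates. *)

(* Defs.v *)
From mathcomp Require Import all_boot all_order all_algebra.
From mathcomp Require Import all_classical all_reals all_analysis.

Set Implicit Arguments.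
Unset Strict Implicit.
Unset Printing Implicit Defensive.

Import Order.TTheory GRing.Theory Num.Theory.
Import numFieldNormedType.Exports.

Local Open Scope classical_set_scope.
Local Open Scope ring_scope.

(* Atlases are families of honest (injective) local coordinates into R^n, recorded
   as relations: [chart c P q] means that the point P lies in the domain of the
   chart c and has coordinates q there.  Tensors are given by their components
   in all the charts, subject to the transformation law. *)
Section Manifold.
Context {R : realType} {n : nat}.

Fixpoint is_Ck (k : nat) (U : set 'rV[R]_n) (h : 'rV[R]_n -> R) : Prop :=
  {in U, continuous h} /\
  (if k is k'.+1 then forall i : 'I_n,
     {in U, forall q, derivable h q (delta_mx 0 i)} /\
     is_Ck k' U (fun q => 'D_(delta_mx 0 i) h q)
   else True).

Definition smooth_on (U : set 'rV[R]_n) (h : 'rV[R]_n -> R) : Prop :=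
  forall k, is_Ck k U h.

Record atlas (M : Type) := Atlas {
  chart_index : Type;
  chart : chart_index -> M -> 'rV[R]_n -> Prop }.

Context {M : Type} (A : atlas M).

Definition chart_image (c : chart_index A) : set 'rV[R]_n :=
  [set q | exists P, chart c P q].

Definition overlap (c d : chart_index A) : set 'rV[R]_n :=
  [set q | exists P, chart c P q /\ exists q', chart d P q'].

(* The coordinate change, meaningful on [overlap c d]; it is 0 elsewhere. *)
Definition transition (c d : chart_index A) (q : 'rV[R]_n) : 'rV[R]_n :=
  xget 0 [set q' | exists P, chart c P q /\ chart d P q'].

(* [jacobian] acts on row vectors, v |-> v *m 'J f q, which fixes the side on
   which the transpose appears in the transformation law. *)
Definition riemannian_metric (G : chart_index A -> 'rV[R]_n -> 'M[R]_n) : Prop :=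
  [/\ forall c i j, smooth_on (chart_image c) (fun q => G c q i j),
      forall c, {in chart_image c, forall q, (G c q)^T = G c q},
      forall c, {in chart_image c, forall q (v : 'rV[R]_n), v != 0 ->
        0 < (v *m G c q *m v^T) 0 0} &
      forall c d, {in overlap c d, forall q,
        G c q = jacobian (transition c d) q
                  *m G d (transition c d q)
                  *m (jacobian (transition c d) q)^T}].

End Manifold.
Arguments atlas R n M : clear implicits.
Arguments Atlas {R n M chart_index}.

Section ContinuedFraction.

(* 1/(e_1 - 1/(e_2 - ... 1/e_k)); the value e 0 is never used. *)
Definition cfrac (e : nat -> int) (k : nat) : rat :=
  foldr (fun d r => (d%:~R - r)^-1) 0 [seq e i | i <- iota 1 k].

(* The pair (m_j, n_j). *)
Definition mn (e : nat -> int) (j : nat) : int * int :=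
  match j with
  | 0 => (0, -1)
  | 1 => (1, 0)
  | _ => (denq (cfrac e j.-1), numq (cfrac e j.-1))
  end.

Definition zbasis (v w : int * int) : Prop :=
  forall u : int * int, exists! c : int * int,
    u = (c.1 * v.1 + c.2 * w.1, c.1 * v.2 + c.2 * w.2).

End ContinuedFraction.

Section Metric.
Context {R : realType}.
Variables (e : nat -> int) (alpha : R).

Definition corner (j : nat) : R :=
  ((mn e j.+1).2 - (mn e j).2)%:~R / ((mn e j.+1).1 - (mn e j).1)%:~R.

(* a_(j-1), with a_(-1) = +oo. *)
Definition corner_pred (j : nat) : \bar R :=
  if j is j'.+1 then (corner j')%:E else +oo%E.

Definition edge (j : nat) : set R :=
  [set x | corner j <= x /\ (x%:E <= corner_pred j)%E].

Definition open_edge (j : nat) : set R :=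
  [set x | corner j < x /\ (x%:E < corner_pred j)%E].

(* The edges cover ]alpha, +oo[, and the affine pieces agree where two
   edges meet, so that for x > alpha the set below is a singleton. *)
Definition envelope (x : R) : R :=
  if x <= alpha then 0
  else xget 0 [set v | exists j,
    edge j x /\ v = (mn e j).1%:~R * x - (mn e j).2%:~R].

Definition u_alpha (x : R) : R := envelope x - envelope (2 * alpha - x).

Definition f_alpha (x y : R) : R :=
  \int[lebesgue_measure]_x1
    (y ^+ 2 / (2 * ((x - x1) ^+ 2 + y ^+ 2) `^ (3 / 2)) * u_alpha x1).

Definition fx_alpha (x y : R) : R := derive1 (fun t : R => f_alpha t y) x.
Definition fy_alpha (x y : R) : R := derive1 (fun t : R => f_alpha x t) y.

Definition w_alpha (x y : R) : R :=
  fx_alpha x y ^+ 2 + fy_alpha x y ^+ 2 - y^-1 * f_alpha x y * fy_alpha x y.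

Definition v1_alpha (x y : R) : R * R := (fy_alpha x y, x * fy_alpha x y - y * fx_alpha x y).
Definition v2_alpha (x y : R) : R * R := (fx_alpha x y, x * fx_alpha x y + y * fy_alpha x y - f_alpha x y).

Definition row4 (a b c d : R) : 'rV[R]_4 := \row_i [:: a; b; c; d]`_i.

(* Covectors in the coordinates (x, y, z_1, z_2). *)
Definition form_dx : 'rV[R]_4 := row4 1 0 0 0.
Definition form_dy : 'rV[R]_4 := row4 0 1 0 0.
Definition eps_dz (v : R * R) : 'rV[R]_4 := row4 0 0 (- v.2) v.1.

Definition sq_form (a : 'rV[R]_4) : 'M[R]_4 := a^T *m a.

(* The matrix of g_alpha in the coordinates (x, y, z_1, z_2). *)
Definition g_alpha (q : 'rV[R]_4) : 'M[R]_4 :=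
  let x := q 0 0 in let y := q 0 1 in
  (`|w_alpha x y| / f_alpha x y ^+ 2) *:
    (sq_form form_dx + sq_form form_dy +
     (w_alpha x y ^+ 2)^-1 *:
       (sq_form (eps_dz (v1_alpha x y)) + sq_form (eps_dz (v2_alpha x y)))).

Definition Dplus (x y : R) : Prop := alpha < x /\ 0 < y.
Definition Dplus_closed (x y : R) : Prop := alpha < x /\ 0 <= y.

(* s times the vector v of Z^2, seen in R^2. *)
Definition lat (v : int * int) (s : R) : R * R := (s * v.1%:~R, s * v.2%:~R).

(* The lift to R^2 of the subtorus collapsed over (x, y). *)
Definition collapsed (x y : R) : set (R * R) :=
  [set c | c = (0, 0)
        \/ (y = 0 /\ exists j, open_edge j x /\ exists s, c = lat (mn e j) s)
        \/ (y = 0 /\ exists j, x = corner j)].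

(* The point of M_alpha represented by (x, y, z), as an equivalence class. *)
Definition mclass (x y : R) (z : R * R) : set (R * R * (R * R)) :=
  [set p | p.1 = (x, y) /\
    exists (k : int * int) (c : R * R),
      collapsed x y c /\ p.2 = z + lat k (2 * pi) + c].

Definition M_alpha : Type :=
  {P : set (R * R * (R * R)) |
     exists x y z, Dplus_closed x y /\ P = mclass x y z}.

(* The angular coordinates are only defined modulo 2 pi; they become charts once
   restricted to a window of length 2 pi around an arbitrary centre. *)
Definition window (t0 t : R) : Prop := `|t - t0| < pi.

Definition interior_chart (z0 : R * R) (P : M_alpha) (q : 'rV[R]_4) : Prop :=
  exists x y z1 z2,
    [/\ Dplus x y, window z0.1 z1, window z0.2 z2,
        sval P = mclass x y (z1, z2) & q = row4 x y z1 z2].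

(* Coordinates (x, t, y e^{is}) with z = s(m_j, n_j) + t(p, q). *)
Definition edge_chart (j : nat) (pq : int * int) (t0 : R)
    (P : M_alpha) (q : 'rV[R]_4) : Prop :=
  zbasis (mn e j) pq /\
  exists x y s t,
    [/\ Dplus_closed x y /\ (y = 0 -> open_edge j x), window t0 t,
        sval P = mclass x y (lat (mn e j) s + lat pq t) &
        q = row4 x t (y * cos s) (y * sin s)].

(* Coordinates (r_1 e^{is_1}, r_2 e^{is_2}), where
   x - a_j + iy = (r_2 + i r_1)^2. *)
Definition corner_chart (j : nat) (P : M_alpha) (q : 'rV[R]_4) : Prop :=
  exists x y r1 r2 s1 s2,
    [/\ Dplus_closed x y /\
          (y = 0 -> [\/ open_edge j x, open_edge j.+1 x | x = corner j]),
        0 <= r1 /\ 0 <= r2,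
        x - corner j = r2 ^+ 2 - r1 ^+ 2 /\ y = 2 * r1 * r2,
        sval P = mclass x y (lat (mn e j) s1 + lat (mn e j.+1) s2) &
        q = row4 (r1 * cos s1) (r1 * sin s1) (r2 * cos s2) (r2 * sin s2)].

Inductive M_chart :=
  | Interior of R * R
  | Edge of nat & int * int & R
  | Corner of nat.

Definition M_alpha_atlas : atlas R 4 M_alpha :=
  Atlas (fun c : M_chart => match c with
    | Interior z0 => interior_chart z0
    | Edge j pq t0 => edge_chart j pq t0
    | Corner j => corner_chart j
    end).

(* The open submanifold D_+ x T^2 of M_alpha. *)
Definition Dplus_torus : Type :=
  {P : M_alpha | exists x y z, Dplus x y /\ sval P = mclass x y z}.

Definition Dplus_torus_atlas : atlas R 4 Dplus_torus :=
  Atlas (fun z0 (P : Dplus_torus) => interior_chart z0 (sval P)).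

End Metric.

(* Main.v *)
(** With xi = x - alpha, s = y^2, b_j = a_j - alpha and k_j = m_(j+1) - m_j, the function u is the
    sum of k_j times the clamp of xi to [- b_j, b_j], whence f = sum_j k_j (p_j - r_j) / 2 with
    p_j, r_j = sqrt ((xi +- b_j)^2 + s); written as sum_j k_j b_j 2 xi / (p_j + r_j), the series and
    all its derivatives are dominated by the weights k_j b_j, whose sum is 1.  Hence f > 0, and f
    strictly decreases in s, so that w = f_x^2 + f_y^2 - f f_y / y > 0.

    Near the corner i, f is an affine function of xi plus s H_i - k_i r_i / 2 with H_i smooth up to
    s = 0.  The apparent poles of the components of g_alpha in the edge and corner charts cancel, since
    v_2 = (m_i, n_i) + O(s) along the edge i, eps(v_1, v_2) = y w and m_i n_(i+1) - m_(i+1) n_i = 1;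
    this leaves explicit components that are smooth on the whole chart.  Positivity on the boundary
    holds because the metric is diagonal there, and the transformation law follows by relating
    every chart at a point other than a corner to an edge chart. *)
From HB Require Import structures.
Require Import Defs.
From mathcomp Require Import all_boot all_order all_algebra.
From mathcomp Require Import all_classical all_reals all_analysis.
From mathcomp Require Import measurable_realfun.
From mathcomp Require Import ring lra zify.

Set Implicit Arguments.
Unset Strict Implicit.
Unset Printing Implicit Defensive.

Import Order.TTheory GRing.Theory Num.Theory.
Import numFieldNormedType.Exports.

Local Open Scope classical_set_scope.
Local Open Scope ring_scope.

(** * Differentiability and uniformly bounded families *)

(** The variable s is not restricted to s >= 0: the smooth parts of f, f_x and f_y / y are functions
    of (xi, s) on open sets that cross s = 0. Boundary smoothness then reduces to pulling back, by s
    = X^2 + Y^2 in an edge chart and by xi - b_j = R2 - R1, s = 4 R1 R2 in a corner chart, where R1,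
    R2 are the squared moduli of the two complex coordinates; there the singular radius r_j becomes
    R1 + R2.

    The obstacle is that the frames of the charts force divisions by s, R1 and R2. They are carried
    out once and for all in closed form: with C = eps(v_1 / y, (m_j, n_j)) the difference C - w is
    divisible by s, hence so is C^2 - w^2, and the corner has two analogues.

    Infinite sums are handled through families of functions with derivative bounds independent of
    the index; a single smooth function is a constant family, so one calculus serves both.

    The transformation law is reduced to a relation between two charts at one point, symmetric and
    transitive, that compares two quadratic forms at that point only. On the axis it thus suffices
    to compare diagonal forms. *)

Section Differentials.
Context {R : realType}.
Implicit Types V W : normedModType R.

(** The eps form of differentiability is the one that termwise estimates of a series deliver. *)
Lemma differentiable_littleo V W (f : V -> W) (df : {linear V -> W}) x :
    continuous df ->
    (forall eps, 0 < eps -> \forall h \near (0 : V),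
       `|f (h + x) - f x - df h| <= eps * `|h|) ->
  differentiable f x /\ 'd f x = df :> (V -> W).
Proof.
move=> dfc H.
have E : f \o shift x = cst (f x) + df +o_ 0 id.
  apply/eqaddoP => eps e0; near=> h.
  rewrite (_ : _ h = f (h + x) - f x - df h); last first.
    by rewrite /= !fctE/= opprD addrA.
  by near: h; exact: H.
have D := diff_unique dfc E.
by split=> //; apply/diff_locallyP; rewrite D.
Unshelve. all: by end_near. Qed.

Lemma differentiable_near_eq V W (f g : V -> W) x :
  (\forall y \near x, f y = g y) -> differentiable f x ->
  differentiable g x /\ 'd g x = 'd f x :> (V -> W).
Proof.
move=> fg df; apply: (@differentiable_littleo _ _ g ('d f x)).
  exact: diff_continuous.
move=> eps e0.
have [_ /eqaddoP /(_ _ e0) H] : continuous ('d f x) /\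
    f \o shift x = cst (f x) + 'd f x +o_ 0 id by apply/diff_locallyP.
have fg0 : \forall h \near 0, f (h + x) = g (h + x).
  have cx : h + x @[h --> (0 : V)] --> x.
    by rewrite -[X in _ --> X]add0r; apply: cvgD; [exact: cvg_id|exact: cvg_cst].
  exact: (cx _ fg).
near=> h; rewrite -(near fg0 h)// -(nbhs_singleton fg).
have : `|(f \o shift x - (cst (f x) + 'd f x)) h| <= eps * `|h| by near: h.
by rewrite !fctE/= opprD addrA.
Unshelve. all: by end_near. Qed.

End Differentials.

Section RowVectors.
Context {R : realType}.

Lemma differentiable_rV (V : normedModType R) m (G : V -> 'rV[R]_m) x :
  (forall a, differentiable (fun q => G q 0 a) x) -> differentiable G x.
Proof.
move=> dG.
have -> : G = \sum_(a < m) (fun q => G q 0 a *: delta_mx 0 a).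
  apply/funext => q; rewrite fct_sumE /=.
  by rewrite [LHS]row_sum_delta.
by apply: differentiable_sum => a; exact: differentiableZl.
Qed.

Lemma diff_coord (V : normedModType R) m (G : V -> 'rV[R]_m) x a v :
  differentiable G x -> 'd (fun q => G q 0 a) x v = ('d G x v) 0 a.
Proof.
move=> dG.
pose f : 'rV[R]_m -> R := fun N => N 0 a.
have fl : linear f by move=> k u w; rewrite /f !mxE.
pose fM := GRing.isLinear.Build _ _ _ _ f fl.
pose fL : {linear _ -> _} := HB.pack f fM.
have fc : continuous fL by exact: coord_continuous.
have := diff_comp dG (@linear_differentiable _ _ _ fL (G x) fc).
rewrite (diff_lin _ fc) => /(congr1 (fun h => h v)); exact.
Qed.

Lemma differentiable_coordc (V : normedModType R) m (G : V -> 'rV[R]_m) x a :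
  differentiable G x -> differentiable (fun q => G q 0 a) x.
Proof.
by move=> dG; apply: (@differentiable_comp _ _ _ _ G (fun N : 'rV_m => N 0 a)) => //;
  exact: differentiable_coord.
Qed.

Lemma diff_sum_delta n (W : normedModType R) (f : 'rV[R]_n -> W) x v :
  'd f x v = \sum_i v 0 i *: 'd f x (delta_mx 0 i).
Proof.
rewrite [in LHS](row_sum_delta v) linear_sum.
by apply: eq_bigr => i _; rewrite linearZ.
Qed.

Lemma normr_coord_le n (v : 'rV[R]_n) i : `|v 0 i| <= `|v|.
Proof.
rewrite [leRHS]/Num.Def.normr /= mx_normrE.
exact: (le_bigmax _ (fun ij : 'I_1 * 'I_n => `|v ij.1 ij.2|) (0, i)).
Qed.

(** Mean value theorem on the segment from q to q + h; each of the n coordinates of h is at most its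
    sup norm, whence the factor n. *)
Lemma lipschitz_ball n (f : 'rV[R]_n -> R) q r C h :
  (forall z, ball q r z -> differentiable f z) ->
  (forall z i, ball q r z -> `|'d f z (delta_mx 0 i)| <= C) ->
  `|h| < r -> `|f (h + q) - f q| <= n%:R * C * `|h|.
Proof.
move=> df dC hr.
have inb t : 0 <= t <= 1 -> ball q r (t *: h + q).
  move=> /andP[t0 t1]; rewrite -ball_normE /= opprD addrCA subrr addr0 normrN.
  by rewrite normrZ ger0_norm//; apply: le_lt_trans hr; rewrite ler_piMl.
pose phi (t : R) := f (t *: h + q).
have dphi (t : R) : 0 <= t <= 1 -> is_derive (t : R) (1 : R) phi ('d f (t *: h + q) h).
  move=> t01; have D := df _ (inb _ t01).
  have dl : is_diff t (fun t : R => t *: h + q) (fun t => t *: h).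
    have -> : (fun t : R => t *: h + q) = ( *:%R ^~ h) + cst q by [].
    by apply: is_diff_eq; rewrite addr0.
  have df' : is_diff (t *: h + q) f ('d f (t *: h + q)) by exact: DiffDef.
  have dd : is_diff t phi ('d f (t *: h + q) \o (fun t => t *: h)).
    exact: (@is_diff_comp _ _ _ _ (fun t : R => t *: h + q)).
  have dphit : differentiable phi t by case: dd.
  apply: DeriveDef; first exact: diff_derivable.
  by rewrite deriveE// diff_val /= scale1r.
have [||c c01 E] := @MVT_segment _ phi (fun t => 'd f (t *: h + q) h) 0 1 ler01.
- by move=> x; rewrite in_itv /= => /andP[x0 x1]; apply: dphi; rewrite !ltW.
- apply: derivable_within_continuous => t; rewrite in_itv /= => t01.
  by have [] := dphi _ t01.
move: E; rewrite /phi scale1r scale0r add0r subr0 mulr1 => ->.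
rewrite diff_sum_delta; apply: le_trans (ler_norm_sum _ _ _) _.
have -> : n%:R * C * `|h| = \sum_(i < n) C * `|h|.
  by rewrite sumr_const card_ord -mulrA mulr_natl.
apply: ler_sum => i _.
rewrite normrM mulrC; apply: ler_pM => //; last exact: normr_coord_le.
by apply: dC; apply: inb; move: c01; rewrite in_itv.
Qed.

End RowVectors.

(** * Series with summable weights and bounded coefficients *)

Section WeightedSums.
Context {R : realType}.
Implicit Types c a b : nat -> R.

Definition absolutely_summable c := cvgn (series (fun j => `|c j|)).

(** Meaningful when c is absolutely summable and a is bounded, since C |c j| then dominates the
    terms. *)
Definition wsum c a : R := limn (series (fun j => c j * a j)).

Lemma wsum_is_cvg c a C : absolutely_summable c -> (forall j, `|a j| <= C) ->
  cvgn (series (fun j => c j * a j)).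
Proof.
move=> sc aC; apply: normed_cvg.
apply: (@series_le_cvg _ _ (C *: (fun j => `|c j|))).
- by move=> n; exact: normr_ge0.
- by move=> n; apply: mulr_ge0 => //; apply: le_trans (aC 0).
- by move=> n; rewrite /= normrM mulrC ler_wpM2r.
- exact: is_cvg_seriesZ.
Qed.

Lemma wsum_norm_le c a C B : absolutely_summable c -> (forall j, `|a j| <= C) ->
  (forall M, `|series (fun j => c j * a j) M| <= B) -> `|wsum c a| <= B.
Proof.
move=> sc aC sB; have cc := wsum_is_cvg sc aC.
have /cvg_norm cn : series (fun j => c j * a j) @ \oo --> wsum c a := cc.
rewrite -(cvg_lim _ cn)//; apply: limr_le; first by apply/cvg_ex; eexists; exact: cn.
exact: nearW.
Qed.

Lemma wsum_bound c a C : absolutely_summable c -> (forall j, `|a j| <= C) ->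
  `|wsum c a| <= limn (series (fun j => `|c j|)) * C.
Proof.
move=> sc aC; apply: (wsum_norm_le sc aC) => M.
have C0 : 0 <= C by apply: le_trans (aC 0).
apply: (@le_trans _ _ (series (fun j => `|c j|) M * C)).
  rewrite /series /=; apply: le_trans (ler_norm_sum _ _ _) _.
  by rewrite mulr_suml; apply: ler_sum => j _; rewrite normrM ler_wpM2l.
apply: ler_wpM2r => //; apply: nondecreasing_cvgn_le sc M.
by apply/nondecreasing_seqP => n; rewrite seriesSr lerDl.
Qed.

Lemma wsumD c a b C D : absolutely_summable c ->
  (forall j, `|a j| <= C) -> (forall j, `|b j| <= D) ->
  wsum c (fun j => a j + b j) = wsum c a + wsum c b.
Proof.
move=> sc aC bD; rewrite /wsum -lim_seriesD.
- congr (limn (series _)); apply/funext => j; by rewrite fctE mulrDr.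
- exact: wsum_is_cvg aC.
- exact: wsum_is_cvg bD.
Qed.

Lemma wsumZ c a C k : absolutely_summable c -> (forall j, `|a j| <= C) ->
  wsum c (fun j => k * a j) = k * wsum c a.
Proof.
move=> sc aC; rewrite /wsum -[RHS]/(k *: _) -lim_seriesZ.
- congr (limn (series _)); apply/funext => j; by rewrite fctE mulrCA.
- exact: wsum_is_cvg aC.
Qed.

Lemma wsum_linear (I : Type) (r : seq I) c (k : I -> R) (a : I -> nat -> R) D :
  absolutely_summable c -> (forall i j, `|a i j| <= D) ->
  wsum c (fun j => \sum_(i <- r) k i * a i j) = \sum_(i <- r) k i * wsum c (a i).
Proof.
move=> sc aD; elim: r => [|i r IHr].
  rewrite big_nil -[RHS](mul0r (wsum c (fun=> 0))) -(@wsumZ _ _ 0) ?normr0//.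
  by congr wsum; apply/funext => j; rewrite big_nil mul0r.
rewrite big_cons -IHr -(wsumZ _ sc (aD i)) -(@wsumD _ _ _ (`|k i| * D)
  (\sum_(i <- r) `|k i| * D)) //.
- by congr wsum; apply/funext => j; rewrite big_cons.
- by move=> j; rewrite normrM ler_wpM2l.
- move=> j; apply: le_trans (ler_norm_sum _ _ _) _.
  by apply: ler_sum => i' _; rewrite normrM ler_wpM2l.
Qed.

Lemma wsum_lt0 c a C j0 : absolutely_summable c -> (forall j, `|a j| <= C) ->
  (forall j, c j * a j <= 0) -> c j0 * a j0 < 0 -> wsum c a < 0.
Proof.
move=> sc aC ca0 caj; apply: le_lt_trans caj.
have cc := wsum_is_cvg sc aC.
apply: limr_le => //; near=> M.
have jM : (j0 < M)%N by near: M; exact: nbhs_infty_gt.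
rewrite /series /= big_mkord (bigD1 (Ordinal jM))//= gerDl.
by apply: sumr_le0.
Unshelve. all: by end_near. Qed.

(** Differentiation under the sum by domination: the remainders of the terms are O(h) uniformly in j
    and o(h) for each j, so finitely many of them are made small by shrinking h and the others by
    the tail of the weights. *)
Lemma wsum_differentiable n c (phi : nat -> 'rV[R]_n -> R) q C D :
    absolutely_summable c ->
    (\forall z \near q, forall j, `|phi j z| <= C) ->
    (\forall z \near q, forall j, differentiable (phi j) z) ->
    (\forall z \near q, forall j i, `|'d (phi j) z (delta_mx 0 i)| <= D) ->
  differentiable (fun z => wsum c (phi ^~ z)) q /\
  forall i, 'd (fun z => wsum c (phi ^~ z)) q (delta_mx 0 i) =
    wsum c (fun j => 'd (phi j) q (delta_mx 0 i)).
Proof.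
move=> sc bC df bD.
have [r /= r0 Hr] : exists2 r, 0 < r & forall z, ball q r z ->
   [/\ forall j, `|phi j z| <= C, forall j, differentiable (phi j) z &
       forall j i, `|'d (phi j) z (delta_mx 0 i)| <= D].
  have : \forall z \near q, [/\ forall j, `|phi j z| <= C,
       forall j, differentiable (phi j) z &
       forall j i, `|'d (phi j) z (delta_mx 0 i)| <= D].
    by near=> z; split; near: z.
  by move=> /nbhs_ballP[r r0 H]; exists r.
have qr : ball q r q by exact: ballxx.
have [qC qdf qD] := Hr _ qr.
pose ell i := wsum c (fun j => 'd (phi j) q (delta_mx 0 i)).
pose L (h : 'rV[R]_n) : R := \sum_i h 0 i * ell i.
have Ll : linear L.
  move=> k u v; rewrite /L scaler_sumr -big_split /=; apply: eq_bigr => i _.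
  by rewrite !mxE mulrDl scalerAl.
pose LM := GRing.isLinear.Build _ _ _ _ L Ll.
pose LL : {linear _ -> _} := HB.pack L LM.
have Lc : continuous LL.
  move=> h; apply: differentiable_continuous.
  have -> : (LL : 'rV_n -> R) = \sum_i (fun h : 'rV_n => h 0 i *: ell i).
    by apply/funext => z; rewrite fct_sumE.
  by apply: differentiable_sum => i; apply: differentiableZl; exact: differentiable_coord.
have LE h : L h = wsum c (fun j => 'd (phi j) q h).
  have -> : (fun j => 'd (phi j) q h) =
     (fun j => \sum_i h 0 i * 'd (phi j) q (delta_mx 0 i)).
    by apply/funext => j; rewrite diff_sum_delta.
  by rewrite /L (wsum_linear _ _ sc (D := D))// => i j; exact: qD.
suff [dW W] : differentiable (fun z => wsum c (phi ^~ z)) q /\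
   'd (fun z => wsum c (phi ^~ z)) q = LL :> ('rV_n -> R).
  split=> // i; rewrite W /= LE //.
apply: differentiable_littleo => // eps e0.
pose A := limn (series (fun j => `|c j|)).
have sA M : series (fun j => `|c j|) M <= A.
  apply: nondecreasing_cvgn_le sc M.
  by apply/nondecreasing_seqP => m; rewrite seriesSr lerDl.
have A0 : 0 <= A by apply: le_trans (sA 0%N); rewrite /series /= big_geq.
(* One n D bounds the increment of phi_j, by the mean value theorem, and the other one its
   differential. *)
pose K := n%:R * D + n%:R * D.
have K0 : 0 <= `|K| + 1 by rewrite addr_ge0.
(* Beyond N the weights, times the Lipschitz constant, contribute at most eps / 2; [|K| + 1] is a
   divisor that is certainly positive. *)
have [N NA] : exists N, A - series (fun j => `|c j|) N <= eps / 2 / (`|K| + 1).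
  have e1 : 0 < eps / 2 / (`|K| + 1).
    by rewrite !divr_gt0// ltr_pwDr.
  have /cvgrPdist_le /(_ _ e1) [N _ HN] : series (fun j => `|c j|) @ \oo --> A := sc.
  exists N; apply: le_trans (HN N _) => /=; last exact: leqnn.
  exact: ler_norm.
pose rho j h := phi j (h + q) - phi j q - 'd (phi j) q h.
have rhoK j h : `|h| < r -> `|rho j h| <= K * `|h|.
  move=> hr; apply: le_trans (ler_normB _ _) _; rewrite /K mulrDl; apply: lerD.
    apply: (@lipschitz_ball _ _ (phi j) q r) => //.
    - by move=> z /Hr[_ zd _]; exact: zd.
    - by move=> z i /Hr[_ _ zD]; exact: zD.
  rewrite diff_sum_delta; apply: le_trans (ler_norm_sum _ _ _) _.
  have -> : n%:R * D * `|h| = \sum_(i < n) D * `|h|.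
    by rewrite sumr_const card_ord -mulrA mulr_natl.
  apply: ler_sum => i _; rewrite normrM mulrC; apply: ler_pM => //.
  exact: normr_coord_le.
have rhoe j del : 0 < del -> \forall h \near (0 : 'rV[R]_n), `|rho j h| <= del * `|h|.
  move=> d0; have [_ /eqaddoP /(_ _ d0)] : continuous ('d (phi j) q) /\
    phi j \o shift q = cst (phi j q) + 'd (phi j) q +o_ 0 id by apply/diff_locallyP.
  by apply: filterS => h; rewrite /rho !fctE/= opprD addrA.
(* The first N terms have total weight at most A, so remainders below [del] |h| contribute at most
   eps / 2. *)
pose del := eps / 2 / (A + 1).
have del0 : 0 < del by rewrite !divr_gt0// ltr_wpDl.
have near_small : \forall h \near (0 : 'rV[R]_n), forall j : 'I_N, `|rho j h| <= del * `|h|.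
  exact: (@filter_forall _ _ (fun (j : 'I_N) h => `|rho j h| <= del * `|h|) _ _
    (fun j => rhoe j del del0)).
have near_r : \forall h \near (0 : 'rV[R]_n), `|h| < r by exact: nbhs0_lt.
near=> h.
have hr : `|h| < r by near: h.
have hs : forall j : 'I_N, `|rho j h| <= del * `|h| by near: h.
have hq : ball q r (h + q) by rewrite -ball_normE /= opprD addrCA subrr addr0 normrN.
have [hC _ _] := Hr _ hq.
have dB j : `|'d (phi j) q h| <= n%:R * D * `|h|.
  rewrite diff_sum_delta; apply: le_trans (ler_norm_sum _ _ _) _.
  have -> : n%:R * D * `|h| = \sum_(i < n) D * `|h|.
    by rewrite sumr_const card_ord -mulrA mulr_natl.
  apply: ler_sum => i _; rewrite normrM mulrC; apply: ler_pM => //.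
  exact: normr_coord_le.
have -> : wsum c (phi ^~ (h + q)) - wsum c (phi ^~ q) - LL h = wsum c (rho ^~ h).
  rewrite [LL h]LE.
  rewrite -[X in _ - X - _]mul1r -mulNr -(wsumZ _ sc qC).
  rewrite -[X in _ - X]mul1r -[in LHS]mulNr -(wsumZ _ sc dB).
  have qC' j : `|-1 * phi j q| <= C by rewrite mulN1r normrN.
  have dB' j : `|-1 * 'd (phi j) q h| <= n%:R * D * `|h| by rewrite mulN1r normrN.
  rewrite -(wsumD sc hC qC') -(@wsumD _ _ _ (C + C) _ sc _ dB'); last first.
    by move=> j; apply: le_trans (ler_normD _ _) _; exact: lerD.
  by congr wsum; apply/funext => j; rewrite /rho !mulN1r.
apply: (@wsum_norm_le _ _ (K * `|h|)) => //.
  by move=> j; exact: rhoK.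
move=> M; rewrite /series /=; apply: le_trans (ler_norm_sum _ _ _) _.
apply: (@le_trans _ _ (\sum_(0 <= j < M) (`|c j| * (del * `|h|) +
    (if (N <= j)%N then `|c j| else 0) * ((`|K| + 1) * `|h|)))).
  apply: ler_sum => j _; rewrite normrM; case: leqP => jN.
    apply: ler_wpDl; first by rewrite mulr_ge0// mulr_ge0// ltW.
    apply: ler_wpM2l => //; apply: le_trans (rhoK _ _ hr) _.
    apply: ler_wpM2r => //; apply: le_trans (ler_norm _) _.
    by rewrite lerDl.
  rewrite mul0r addr0; apply: ler_wpM2l => //.
  exact: (hs (Ordinal jN)).
have -> : eps * `|h| = eps / 2 * `|h| + eps / 2 * `|h|.
  by rewrite -mulrDl -splitr.
rewrite big_split /= -!mulr_suml; apply: lerD.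
  rewrite mulrA; apply: ler_wpM2r => //.
  rewrite /del mulrA ler_pdivrMr ?ltr_wpDl// mulrC.
  apply: ler_wpM2l; first by rewrite divr_ge0// ltW.
  by apply: le_trans (sA M) _; rewrite lerDl.
rewrite mulrA; apply: ler_wpM2r => //.
rewrite -ler_pdivlMr; last by rewrite ltr_pwDr.
apply: le_trans NA.
rewrite -big_mkcond /=.
case: (leqP N M) => NM; last first.
  rewrite big_nat_cond big_pred0 ?subr_ge0// => j; apply/negbTE/negP.
  by move=> /andP[/andP[_ jM] Nj]; move: (leq_ltn_trans Nj jM); rewrite ltnNge ltnW.
apply: le_trans (lerB (sA M) (lexx _)).
rewrite sub_series_geq//.
rewrite (big_cat_nat (n := N))//= big_nat_cond big_pred0 ?add0r; last first.
  by move=> j; apply/negbTE/negP => /andP[/andP[_ jN]]; rewrite leqNgt jN.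
rewrite big_nat_cond [leRHS]big_nat_cond.
rewrite (eq_bigl (fun j => (N <= j < M)%N && true))//.
by move=> j; case: (N <= j)%N => //=; rewrite ?andbF ?andbT.
Unshelve. all: by end_near. Qed.
End WeightedSums.

Lemma is_diff_sqrt_comp {R : realType} (V : normedModType R) (f : V -> R) q :
  0 < f q -> differentiable f q ->
  is_diff q (Num.sqrt \o f) ((fun t => (2 * Num.sqrt (f q))^-1 * t) \o 'd f q).
Proof.
move=> f0 df.
have I1 : is_diff q f ('d f q) by apply: DiffDef; [exact: df|].
apply: (@is_diff_comp _ _ _ _ f ('d f q) Num.sqrt
  (fun t => (2 * Num.sqrt (f q))^-1 * t)).
have [dv E] := is_derive1_sqrt f0.
have ds : differentiable (@Num.sqrt R) (f q) by apply/derivable1_diffP.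
apply: DiffDef => //.
by rewrite diff1E// derive1E E; apply/funext => t; exact: mulrC.
Qed.

(** * Families with locally uniform bounds on their derivatives *)

Section UniformSmoothness.
Context {R : realType}.

(* Families all of whose partial derivatives of order at most k are bounded
   near each point of U, with bounds that do not depend on the index. *)
Fixpoint unif_Ck (n : nat) (k : nat) (U : set 'rV[R]_n) (phi : nat -> 'rV[R]_n -> R)
    : Prop :=
  (forall q, U q -> exists C, \forall z \near q, forall j, `|phi j z| <= C) /\
  (if k is k'.+1 then
     (forall j q, U q -> differentiable (phi j) q) /\
     forall i, unif_Ck k' U (fun j q => 'D_(delta_mx 0 i) (phi j) q)
   else True).

Context {n : nat}.
Variable U : set 'rV[R]_n.
Hypothesis oU : open U.
Implicit Types phi psi : nat -> 'rV[R]_n -> R.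

Lemma unif_Ck_bounded k phi q : unif_Ck k U phi -> U q ->
  exists2 C, 0 <= C & \forall z \near q, forall j, `|phi j z| <= C.
Proof.
have H : (forall q, U q -> exists C, \forall z \near q, forall j, `|phi j z| <= C) ->
    U q -> exists2 C, 0 <= C & \forall z \near q, forall j, `|phi j z| <= C.
  move=> H /H[C HC]; exists C => //.
  by apply: le_trans (nbhs_singleton HC 0%N).
by case: k => [|k] [b _]; exact: H.
Qed.

Lemma unif_Ck_diff k phi j q : unif_Ck k.+1 U phi -> U q -> differentiable (phi j) q.
Proof. by move=> [_ [d _]] /d. Qed.

Lemma unif_CkW k phi : unif_Ck k.+1 U phi -> unif_Ck k U phi.
Proof.
elim: k phi => [|k IHk] phi [b [d H]]; first by split.
by split=> //; split=> // i; exact: IHk.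
Qed.

Lemma unif_CkW_le k phi : unif_Ck k.+1 U phi -> unif_Ck 1 U phi.
Proof. by elim: k phi => [//|k IHk] phi /unif_CkW/IHk. Qed.

Lemma unif_Ck_eq k phi psi : (forall j q, U q -> phi j q = psi j q) ->
  unif_Ck k U phi -> unif_Ck k U psi.
Proof.
have nU q : U q -> \forall z \near q, U z by move=> Uq; exact: open_nbhs_nbhs.
elim: k phi psi => [|k IHk] phi psi E [b H].
  split=> // q Uq; have [C HC] := b q Uq; exists C.
  near=> z => j; rewrite -E; last by near: z; exact: nU.
  by move: j; near: z.
have nE j q : U q -> \forall z \near q, phi j z = psi j z.
  by move=> /nU; apply: filterS => z /E.
split.
  move=> q Uq; have [C HC] := b q Uq; exists C.
  near=> z => j; rewrite -E; last by near: z; exact: nU.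
  by move: j; near: z.
case: H => d H; split.
  by move=> j q Uq; have [] := differentiable_near_eq (nE j q Uq) (d j q Uq).
move=> i; apply: IHk (H i) => j q Uq.
by apply: near_eq_derive; exact: nE.
Unshelve. all: by end_near. Qed.

Lemma unif_Ck_cst k (c : nat -> R) C : (forall j, `|c j| <= C) ->
  unif_Ck k U (fun j _ => c j).
Proof.
elim: k c C => [|k IHk] c C cC; split=> //.
- by move=> q _; exists C; near=> z; exact: cC.
- by move=> q _; exists C; near=> z; exact: cC.
- split=> [j q _|i]; first exact: differentiable_cst.
  apply: (@unif_Ck_eq _ (fun _ _ => 0)); last by apply: (IHk _ 0) => j; rewrite normr0.
  by move=> j q _; rewrite derive_cst.
Unshelve. all: by end_near. Qed.

Lemma unif_CkD k phi psi : unif_Ck k U phi -> unif_Ck k U psi ->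
  unif_Ck k U (fun j q => phi j q + psi j q).
Proof.
have B (phi' psi' : nat -> 'rV[R]_n -> R) (q : 'rV[R]_n) : (exists C, \forall z \near q, forall j, `|phi' j z| <= C) ->
   (exists C, \forall z \near q, forall j, `|psi' j z| <= C) ->
   exists C, \forall z \near q, forall j : nat, `|phi' j z + psi' j z : R| <= C.
  move=> [C HC] [D HD]; exists (C + D); apply: filterS2 HC HD => z Cz Dz j.
  by apply: le_trans (ler_normD _ _) _; apply: lerD; [exact: Cz|exact: Dz].
elim: k phi psi => [|k IHk] phi psi [b H] [b' H']; split=> //.
- by move=> q Uq; apply: B; [exact: b|exact: b'].
- by move=> q Uq; apply: B; [exact: b|exact: b'].
case: H H' => d H [d' H']; split.
  by move=> j q Uq; apply: differentiableD; [exact: d|exact: d'].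
move=> i; apply: unif_Ck_eq (IHk _ _ (H i) (H' i)) => j q Uq.
by rewrite /= -deriveD//; apply: diff_derivable; [exact: d|exact: d'].
Unshelve. all: by end_near. Qed.

Lemma unif_CkM k phi psi : unif_Ck k U phi -> unif_Ck k U psi ->
  unif_Ck k U (fun j q => phi j q * psi j q).
Proof.
have B k1 k2 phi' psi' (q : 'rV[R]_n) : unif_Ck k1 U phi' -> unif_Ck k2 U psi' -> U q ->
   exists C, \forall z \near q, forall j : nat, `|phi' j z * psi' j z : R| <= C.
  move=> /unif_Ck_bounded H1 /unif_Ck_bounded H2 Uq.
  have [C _ HC] := H1 _ Uq; have [D _ HD] := H2 _ Uq.
  exists (C * D); apply: filterS2 HC HD => z Cz Dz j.
  by rewrite normrM; apply: ler_pM.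
elim: k phi psi => [|k IHk] phi psi Hphi Hpsi; split=> //.
- by move=> q; exact: (B _ _ _ _ _ Hphi Hpsi).
- by move=> q; exact: (B _ _ _ _ _ Hphi Hpsi).
have [b [d H]] := Hphi; have [b' [d' H']] := Hpsi; split.
  by move=> j q Uq; apply: differentiableM; [exact: d|exact: d'].
move=> i; apply: (unif_Ck_eq _ (unif_CkD (IHk _ _ (unif_CkW Hphi) (H' i))
   (IHk _ _ (unif_CkW Hpsi) (H i)))) => j q Uq.
by rewrite [RHS](@deriveM _ _ (phi j) (psi j))//; apply: diff_derivable;
  [exact: d|exact: d'].
Unshelve. all: by end_near. Qed.

Lemma unif_CkZ k c phi : unif_Ck k U phi -> unif_Ck k U (fun j q => c * phi j q).
Proof. by apply: unif_CkM; apply: (@unif_Ck_cst _ _ `|c|). Qed.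

Lemma unif_CkN k phi : unif_Ck k U phi -> unif_Ck k U (fun j q => - phi j q).
Proof.
move=> /(@unif_CkZ _ (-1)); apply: unif_Ck_eq => j q _; exact: mulN1r.
Qed.

Lemma unif_CkB k phi psi : unif_Ck k U phi -> unif_Ck k U psi ->
  unif_Ck k U (fun j q => phi j q - psi j q).
Proof. by move=> H /unif_CkN; exact: unif_CkD. Qed.

(** Positivity of each member would not do: inverses of a family are bounded only under a local
    lower bound that is independent of j. *)
Definition bounded_away phi := forall q, U q -> exists2 c, 0 < c &
  \forall z \near q, forall j, c <= phi j z.

(** Induction on k: the partial derivatives are - phi' / phi^2, products of families whose bounds up
    to order k are already available. *)
Lemma unif_CkV k phi : bounded_away phi -> unif_Ck k U phi ->
  unif_Ck k U (fun j q => (phi j q)^-1).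
Proof.
move=> ba.
have B (q : 'rV[R]_n) : U q -> exists C, \forall z \near q, forall j, `|(phi j z)^-1| <= C.
  move=> /ba[c c0 H]; exists c^-1; near=> z => j.
  have cj : c <= phi j z by move: j; near: z.
  by rewrite ger0_norm ?invr_ge0 ?(le_trans (ltW c0))// lef_pV2// posrE ?(lt_le_trans c0).
have n0 j q : U q -> phi j q != 0.
  by move=> /ba[c c0 /nbhs_singleton/(_ j) H]; rewrite gt_eqF// (lt_le_trans c0).
elim: k => [|k IHk] H; split=> //.
have [b [d Hd]] := H; split.
  by move=> j q Uq; apply: differentiableV; [exact: d|exact: n0].
move=> i.
have IV := IHk (unif_CkW H).
apply: (unif_Ck_eq _ (unif_CkM (unif_CkN (Hd i)) (unif_CkM IV IV))) => j q Uq.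
rewrite deriveV; [|exact: n0|by apply: diff_derivable; exact: d].
by rewrite -[RHS]/(_ * _) mulNr mulNr -exprVn expr2 mulrC.
Unshelve. all: by end_near. Qed.

Lemma bounded_away_sqrt phi : bounded_away phi ->
  bounded_away (fun j q => Num.sqrt (phi j q)).
Proof.
move=> ba q /ba[c c0 H]; exists (Num.sqrt c); first by rewrite sqrtr_gt0.
near=> z => j; rewrite ler_wsqrtr//; by move: j; near: z.
Unshelve. all: by end_near. Qed.

(** The derivative phi' / (2 sqrt phi) involves the square root only up to order k, so the induction
    closes as for inverses. *)
Lemma unif_Ck_sqrt k phi : bounded_away phi -> unif_Ck k U phi ->
  unif_Ck k U (fun j q => Num.sqrt (phi j q)).
Proof.
move=> ba.
have gt0 j q : U q -> 0 < phi j q.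
  by move=> /ba[c c0 /nbhs_singleton/(_ j) H]; rewrite (lt_le_trans c0).
elim: k => [|k IHk] H.
  split=> // q Uq; have [C C0 HC] := unif_Ck_bounded H Uq.
  exists (Num.sqrt C); near=> z => j; rewrite ger0_norm ?sqrtr_ge0//.
  rewrite ler_wsqrtr//; apply: le_trans (ler_norm _) _; by move: j; near: z.
have [b [d Hd]] := H.
have S := IHk (unif_CkW H).
have D j q : U q -> is_diff q (Num.sqrt \o phi j)
    ((fun t => (2 * Num.sqrt (phi j q))^-1 * t) \o 'd (phi j) q).
  by move=> Uq; apply: is_diff_sqrt_comp; [exact: gt0|exact: d].
split.
  move=> q Uq; have [C C0 HC] := unif_Ck_bounded H Uq.
  exists (Num.sqrt C); near=> z => j; rewrite ger0_norm ?sqrtr_ge0//.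
  rewrite ler_wsqrtr//; apply: le_trans (ler_norm _) _; by move: j; near: z.
split; first by move=> j q /(D j)[].
move=> i.
apply: (unif_Ck_eq _ (unif_CkM (unif_CkZ 2^-1 (Hd i))
   (unif_CkV (bounded_away_sqrt ba) S))) => j q Uq.
have DD := D j q Uq; have [dd _] := DD.
rewrite [RHS](@deriveE _ _ _ (Num.sqrt \o phi j))// diff_val /= deriveE; last exact: d.
by rewrite invfM mulrAC.
Unshelve. all: by end_near. Qed.

Lemma unif_Ck_wsum_diff (c : nat -> R) phi q : absolutely_summable c ->
  unif_Ck 1 U phi -> U q -> differentiable (fun z => wsum c (phi ^~ z)) q /\
  forall i, 'd (fun z => wsum c (phi ^~ z)) q (delta_mx 0 i) =
    wsum c (fun j => 'd (phi j) q (delta_mx 0 i)).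
Proof.
have nU z : U z -> \forall z' \near z, U z' by move=> Uz; exact: open_nbhs_nbhs.
move=> sc H Uq; have [C C0 HC] := unif_Ck_bounded H Uq.
  have [b [d Hd]] := H.
  have dB (i : 'I_n) : exists2 D, 0 <= D & \forall z \near q, forall j,
      `|'D_(delta_mx 0 i) (phi j) z| <= D.
    exact: (@unif_Ck_bounded 0 _ _ (Hd i) Uq).
  have [D' HD'] := choice (fun i => let: ex_intro2 D a b := dB i in
     ex_intro (fun D => 0 <= D /\ _) D (conj a b)).
  apply: (@wsum_differentiable _ _ _ _ _ C (\sum_i D' i) sc HC).
    by move: (nU q Uq); apply: filterS => z /d.
  have : \forall z \near q, forall i j, `|'D_(delta_mx 0 i) (phi j) z| <= D' i.
    exact: (@filter_forall _ _ (fun i z => forall j,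
       `|'D_(delta_mx 0 i) (phi j) z| <= D' i) _ _ (fun i => (HD' i).2)).
  move=> nD; near=> z => j i.
  rewrite -deriveE; last by apply: d; near: z; exact: nU.
  apply: (@le_trans _ _ (D' i)); first by move: i j; near: z.
  rewrite (bigD1 i)//= lerDl; apply: sumr_ge0 => i' _; exact: (HD' i').1.
Unshelve. all: by end_near. Qed.

(** One order is lost because differentiating the sum uses a bound on the derivatives of its terms;
    this is harmless, as all orders are available. The sum is recorded as a constant family. *)
Lemma unif_Ck_wsum k (c : nat -> R) phi : absolutely_summable c ->
  unif_Ck k.+1 U phi -> unif_Ck k U (fun _ q => wsum c (phi ^~ q)).
Proof.
have nU q : U q -> \forall z \near q, U z by move=> Uq; exact: open_nbhs_nbhs.
move=> sc; elim: k phi => [|k IHk] phi H.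
  split=> // q Uq; have [C C0 HC] := unif_Ck_bounded H Uq.
  exists (limn (series (fun j => `|c j|)) * C).
  near=> z => _; apply: wsum_bound => // j; move: j; near: z; exact: HC.
have D q : U q -> differentiable (fun z => wsum c (phi ^~ z)) q /\
  forall i, 'd (fun z => wsum c (phi ^~ z)) q (delta_mx 0 i) =
    wsum c (fun j => 'd (phi j) q (delta_mx 0 i)).
  by move=> Uq; apply: unif_Ck_wsum_diff => //; exact: unif_CkW_le H.
split.
  move=> q Uq; have [C C0 HC] := unif_Ck_bounded H Uq.
  exists (limn (series (fun j => `|c j|)) * C).
  near=> z => _; apply: wsum_bound => // j; move: j; near: z; exact: HC.
split; first by move=> _ q /D[].
move=> i; have [b [d Hd]] := H.
apply: (unif_Ck_eq _ (IHk _ (Hd i))) => _ q Uq.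
have [dd E] := D q Uq; rewrite deriveE// E; congr wsum; apply/funext => j.
by rewrite deriveE//; exact: d.
Unshelve. all: by end_near. Qed.

Lemma unif_Ck_coord k i : unif_Ck k U (fun _ q => q 0 i).
Proof.
have B (q : 'rV[R]_n) : U q -> exists C, \forall z \near q, forall j : nat, `|(z : 'rV[R]_n) 0 i| <= C.
  move=> _; exists (`|q 0 i| + 1).
  have /cvgrPdist_lt /(_ 1 ltr01) : (fun z : 'rV[R]_n => z 0 i) @ q --> q 0 i.
    exact: coord_continuous.
  apply: filterS => z zq _; rewrite -[z 0 i](subrK (q 0 i)) addrC.
  by apply: le_trans (ler_normD _ _) _; rewrite lerD2l distrC ltW.
case: k => [|k]; split=> //; split=> [_ q _|i']; first exact: differentiable_coord.
apply: (unif_Ck_eq _ (@unif_Ck_cst k (fun=> (delta_mx 0 i' : 'rV[R]_n) 0 i)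
   `|(delta_mx 0 i' : 'rV[R]_n) 0 i| _)) => // _ q _ /=.
rewrite deriveE; last exact: differentiable_coord.
have := @diff_coord R 'rV[R]_n n id q i (delta_mx 0 i') (@ex_diff _ _ _ _ _ _ _ (is_diff_id q)).
by move=> ->; rewrite diff_val.
Qed.

End UniformSmoothness.

Section UniformSmoothnessComposition.
Context {R : realType} {n m : nat}.
Variables (U : set 'rV[R]_n) (V : set 'rV[R]_m) (G : 'rV[R]_n -> 'rV[R]_m).
Hypotheses (oU : open U) (oV : open V) (UV : forall q, U q -> V (G q)).

(** Chain rule in coordinates. The inner map G does not depend on the index, so bounds near G q pull
    back by continuity. *)
Lemma unif_Ck_comp k (phi : nat -> 'rV[R]_m -> R) :
  (forall k a, unif_Ck k U (fun _ q => G q 0 a)) ->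
  unif_Ck k V phi -> unif_Ck k U (fun j q => phi j (G q)).
Proof.
move=> HG.
have dG q : U q -> differentiable G q.
  by move=> Uq; apply: differentiable_rV => a; exact: (unif_Ck_diff 0%N (HG 1%N a)).
have B (phi' : nat -> 'rV[R]_m -> R) (q : 'rV[R]_n) : (exists C, \forall z \near G q, forall j : nat, `|phi' j z : R| <= C) ->
   U q -> exists C, \forall z \near q, forall j : nat, `|phi' j (G z)| <= C.
  move=> [C HC] Uq; exists C.
  have cG : {for q, continuous G} by apply: differentiable_continuous; exact: dG.
  exact: (cG _ HC).
elim: k phi => [|k IHk] phi H.
  by split=> // q Uq; apply: B => //; case: H => b _; apply: b; exact: UV.
have [b [d Hd]] := H.
split; first by move=> q Uq; apply: B => //; apply: b; exact: UV.
split.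
  move=> j q Uq; apply: (@differentiable_comp _ _ _ _ G (phi j)); first exact: dG.
  by apply: d; exact: UV.
move=> i.
(* The sum over the coordinates is built along a list, so that closure under binary sums applies. *)
pose psi (s : seq 'I_m) j q := \sum_(a <- s) 'D_(delta_mx 0 a) (phi j) (G q) *
  'D_(delta_mx 0 i) (fun q => G q 0 a) q.
have Hpsi s : unif_Ck k U (psi s).
  elim: s => [|a s IHs].
    have c0 (j : nat) : `|(fun=> 0 : R) j| <= 0 by rewrite normr0.
    apply: (unif_Ck_eq oU _ (unif_Ck_cst oU k c0)) => //.
    by move=> j q _; rewrite /psi big_nil.
  have [_ [_ /(_ i) HGa]] := HG k.+1 a.
  apply: (unif_Ck_eq oU _ (unif_CkD oU (unif_CkM oU (IHk _ (Hd a)) HGa) IHs)).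
  by move=> j q _; rewrite /psi big_cons.
apply: (unif_Ck_eq oU _ (Hpsi (index_enum 'I_m))) => // j q Uq.
have dGq := dG q Uq; have dp := d j _ (UV Uq).
rewrite /psi deriveE; last exact: (@differentiable_comp _ _ _ _ G (phi j)).
rewrite (_ : (fun q => phi j (G q)) = phi j \o G)// diff_comp//=.
rewrite diff_sum_delta; apply: eq_bigr => a _.
rewrite !deriveE ?diff_coord//; last exact: differentiable_coordc.
by rewrite mulrC.
Qed.

End UniformSmoothnessComposition.

Section SmoothFromUniform.
Context {R : realType} {n : nat}.
Variables (U : set 'rV[R]_n).
Hypotheses (oU : open U).

(** Constant families, so that the closure properties need no second proof. Unlike [smooth_on], this
    includes differentiability and not only the existence of partial derivatives, which is what the
    chain rule uses. *)
Definition Cinfty (h : 'rV[R]_n -> R) := forall k, unif_Ck k U (fun _ => h).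

Lemma Cinfty_smooth h : Cinfty h -> smooth_on U h.
Proof.
move=> H k; have := H k.+1 => {H}.
elim: k h => [|k IHk] h [b [d H]].
  by split=> // q; rewrite inE => /(d 0%N)/differentiable_continuous.
split; first by move=> q; rewrite inE => /(d 0%N)/differentiable_continuous.
move=> i; split; last exact: IHk.
by move=> q; rewrite inE => /(d 0%N)/diff_derivable.
Qed.

Lemma Cinfty_diff h q : Cinfty h -> U q -> differentiable h q.
Proof. by move=> H; exact: (unif_Ck_diff 0%N (H 1%N)). Qed.

Lemma Cinfty_deriv h i : Cinfty h -> Cinfty (fun q => 'D_(delta_mx 0 i) h q).
Proof. by move=> H k; have [_ [_ +]] := H k.+1; apply. Qed.

Lemma Cinfty_eq h g : (forall q, U q -> h q = g q) -> Cinfty h -> Cinfty g.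
Proof. by move=> E H k; apply: unif_Ck_eq (H k) => // _; exact: E. Qed.

Lemma Cinfty_cst c : Cinfty (fun _ => c).
Proof. by move=> k; exact: (@unif_Ck_cst _ _ _ _ _ _ `|c|). Qed.

Lemma CinftyD h g : Cinfty h -> Cinfty g -> Cinfty (fun q => h q + g q).
Proof. by move=> H G k; apply: unif_CkD. Qed.

Lemma CinftyB h g : Cinfty h -> Cinfty g -> Cinfty (fun q => h q - g q).
Proof. by move=> H G k; apply: unif_CkB. Qed.

Lemma CinftyN h : Cinfty h -> Cinfty (fun q => - h q).
Proof. by move=> H k; apply: unif_CkN. Qed.

Lemma CinftyM h g : Cinfty h -> Cinfty g -> Cinfty (fun q => h q * g q).
Proof. by move=> H G k; apply: unif_CkM. Qed.

Lemma CinftyX h m : Cinfty h -> Cinfty (fun q => h q ^+ m).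
Proof.
move=> H; elim: m => [|m IHm]; first exact: Cinfty_cst.
by apply: Cinfty_eq (CinftyM H IHm) => q _; rewrite exprS.
Qed.

Lemma pos_bounded_away h : Cinfty h -> (forall q, U q -> 0 < h q) ->
  bounded_away U (fun _ : nat => h).
Proof.
move=> H hp q Uq; exists (h q / 2); first by rewrite divr_gt0// hp.
have /cvgrPdist_lt /(_ (h q / 2)) : h @ q --> h q.
  by apply: differentiable_continuous; exact: Cinfty_diff.
rewrite divr_gt0 ?hp// => /(_ isT); apply: filterS => z zq _.
by move: zq => /(le_lt_trans (ler_norm _)) /= zq; lra.
Qed.

Lemma CinftyV h : (forall q, U q -> 0 < h q) -> Cinfty h -> Cinfty (fun q => (h q)^-1).
Proof. by move=> hp H k; apply: unif_CkV => //; exact: pos_bounded_away. Qed.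

Lemma Cinfty_sqrt h : (forall q, U q -> 0 < h q) -> Cinfty h ->
  Cinfty (fun q => Num.sqrt (h q)).
Proof. by move=> hp H k; apply: unif_Ck_sqrt => //; exact: pos_bounded_away. Qed.

Lemma Cinfty_sum (I : Type) (r : seq I) (h : I -> 'rV[R]_n -> R) :
  (forall i, Cinfty (h i)) -> Cinfty (fun q => \sum_(i <- r) h i q).
Proof.
move=> H; elim: r => [|i r IHr].
  by apply: Cinfty_eq (Cinfty_cst 0) => q _; rewrite big_nil.
by apply: Cinfty_eq (CinftyD (H i) IHr) => q _; rewrite big_cons.
Qed.

Lemma Cinfty_coord i : Cinfty (fun q => q 0 i).
Proof. by move=> k; apply: unif_Ck_coord. Qed.

End SmoothFromUniform.

Lemma Cinfty_comp {R : realType} {n m : nat} (U : set 'rV[R]_n) (V : set 'rV[R]_m)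
    (G : 'rV[R]_n -> 'rV[R]_m) (h : 'rV[R]_m -> R) :
  open U -> open V -> (forall q, U q -> V (G q)) ->
  (forall a, Cinfty U (fun q => G q 0 a)) -> Cinfty V h -> Cinfty U (h \o G).
Proof.
move=> oU oV UV HG Hh k.
exact: (@unif_Ck_comp _ _ _ _ _ _ oU UV k (fun=> h) (fun k' a => HG a k') (Hh k)).
Qed.

(** * The continued fraction *)

Section ContinuedFractionRecurrence.
Variable e : nat -> int.
Hypothesis e_ge3 : forall j, (1 <= j)%N -> 3 <= e j.

(** Both m_j and n_j obey this recurrence, with initial values (0, 1) and (-1, 0). *)
Fixpoint linrec (x0 x1 : int) (j : nat) : int :=
  match j with
  | 0 => x0
  | j'.+1 => match j' with 0 => x1 | j''.+1 => e j' * linrec x0 x1 j' - linrec x0 x1 j'' end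
  end.

Lemma linrecSS x0 x1 j :
  linrec x0 x1 j.+2 = e j.+1 * linrec x0 x1 j.+1 - linrec x0 x1 j.
Proof. by []. Qed.

Let m := linrec 0 1.
Let n := linrec (-1) 0.

(** X_(i+2) - X_(i+1) = (e_(i+1) - 2) X_(i+1) + (X_(i+1) - X_i) with e_(i+1) >= 3, so a nonnegative
    nondecreasing start propagates. The bounds on m_j alpha - n_j below are obtained by choosing X
    well. *)
Lemma linrec_homo (X : nat -> int) j :
  (forall i, (j <= i)%N -> X i.+2 = e i.+1 * X i.+1 - X i) ->
  0 <= X j -> X j <= X j.+1 ->
  forall i, (j <= i)%N -> 0 <= X i /\ X i <= X i.+1.
Proof.
move=> rX X0 X1 i /subnK <-; elim: (i - j)%N => [//|d [Y0 Y1]].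
rewrite !addSn; split; first exact: le_trans Y1.
rewrite rX ?leq_addl//.
have := e_ge3 (ltn0Sn (d + j)); nia.
Qed.

Lemma den_ge0_le j : 0 <= m j /\ m j <= m j.+1.
Proof. by apply: (@linrec_homo m 0). Qed.

Lemma den_double j : 2 * m j <= m j.+1.
Proof.
case: j => [//|j]; rewrite /m linrecSS -/m.
have [] := den_ge0_le j; have [] := den_ge0_le j.+1.
have := e_ge3 (ltn0Sn j); nia.
Qed.

Lemma den_ge j : j%:Z <= m j.
Proof.
elim: j => [//|[//|j] IH]; have := den_double j.+1; move: IH; lia.
Qed.

Lemma den_det j : m j * n j.+1 - m j.+1 * n j = 1.
Proof.
elim: j => [//|j IH]; rewrite /m /n !linrecSS -/m -/n -IH; ring.
Qed.

(** A variable tail r in place of the final 0 makes the induction work: appending e_(k+1) replaces r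
    by 1 / (e_(k+1) - r), which stays in [0, 1) because e_(k+1) >= 3. *)
Lemma foldr_cfrac k (r : rat) : 0 <= r < 1 ->
  foldr (fun d r => (d%:~R - r)^-1) r [seq e i | i <- iota 1 k] =
  ((n k.+1)%:~R - r * (n k)%:~R) / ((m k.+1)%:~R - r * (m k)%:~R).
Proof.
elim: k r => [|k IHk] r /andP[r0 r1].
  by rewrite /= /m /n /=; rewrite mulr0 subr0 mulrN1 opprK add0r divr1.
rewrite -[k.+1]addn1 iotaD map_cat foldr_cat /= add1n.
have e3 : 3 <= (e k.+1)%:~R :> rat by rewrite (_ : 3 = 3%:~R)// ler_int e_ge3.
have d0 : 0 < (e k.+1)%:~R - r by lra.
have d1 : (e k.+1)%:~R - r != 0 by rewrite gt_eqF.
rewrite IHk; last first.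
  by rewrite invr_ge0 ltW//= invf_cp1//; lra.
rewrite addn1 /m /n !linrecSS -/m -/n !intrB !intrM.
have mk : (m k)%:~R <= (m k.+1)%:~R :> rat by rewrite ler_int; case: (den_ge0_le k).
have mk0 : 0 < (m k.+1)%:~R :> rat by rewrite ltr0z; have := den_ge k.+1; lia.
have A : (m k.+1)%:~R * ((e k.+1)%:~R - r) - (m k)%:~R != 0 :> rat.
  by rewrite gt_eqF//; nra.
have B : (e k.+1)%:~R * (m k.+1)%:~R - (m k)%:~R - r * (m k.+1)%:~R != 0 :> rat.
  by move: A; congr (_ != 0); ring.
by field; rewrite d1 B.
Qed.

Lemma cfracE k : cfrac e k = (n k.+1)%:~R / (m k.+1)%:~R.
Proof. by rewrite /cfrac foldr_cfrac// !mul0r !subr0. Qed.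

(** By the determinant identity n_j and m_j are coprime, hence the numerator and the denominator of
    the convergent. *)
Lemma mnE j : mn e j = (m j, n j).
Proof.
case: j => [//|[//|j]]; rewrite /mn [j.+2.-1]/= cfracE.
have mj : 0 < m j.+2 by have := den_ge j.+2; lia.
have cop : coprime `|n j.+2| `|m j.+2|.
  rewrite -[coprime _ _]/(coprimez (n j.+2) (m j.+2)).
  apply/coprimezP; exists (m j.+1, - n j.+1) => /=.
  by rewrite -[RHS](den_det j.+1); ring.
rewrite coprimeq_num// coprimeq_den// gt_eqF// (gtr0_norm mj) (gtr0_sg mj).
by rewrite mul1r.
Qed.

(** * The gaps m_j alpha - n_j *)

Section Limit.
Context {R : realType}.
Variable alpha : R.
Hypothesis alpha_cfrac : (fun k => ratr (cfrac e k) : R) @ \oo --> alpha.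

Let delta j : R := (m j)%:~R * alpha - (n j)%:~R.

Lemma gap_rec j : delta j.+2 = (e j.+1)%:~R * delta j.+1 - delta j.
Proof. by rewrite /delta /m /n !linrecSS -/m -/n !intrB !intrM; ring. Qed.

Lemma gap_cvg j :
  (fun k => (m j * n k.+1 - n j * m k.+1)%:~R / (m k.+1)%:~R : R) @ \oo --> delta j.
Proof.
have -> : (fun k => (m j * n k.+1 - n j * m k.+1)%:~R / (m k.+1)%:~R : R) =
   (fun k => (m j)%:~R * ratr (cfrac e k) - (n j)%:~R).
  apply/funext => k; rewrite cfracE rmorphM /= fmorphV /= !ratr_int.
  have mk0 : (m k.+1)%:~R != 0 :> R.
    by rewrite intr_eq0; have := den_ge k.+1; lia.
  by rewrite intrB !intrM; field.
by apply: cvgB; [apply: cvgM => //; exact: cvg_cst|exact: cvg_cst].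
Qed.

(** For i >= j + 1 the integer (m_j n_i - n_j m_i) m_(j+1) - m_i is nonnegative, by the recurrence
    in i. Divided by m_i m_(j+1) this passes to the limit, as n_i / m_i tends to alpha. *)
Lemma gap_ge j : (m j.+1)%:~R^-1 <= delta j.
Proof.
rewrite -(cvg_lim _ (@gap_cvg j))//; apply: limr_ge.
  by apply/cvg_ex; eexists; exact: gap_cvg.
near=> k.
have kj : (j.+1 <= k.+1)%N by rewrite ltnS; near: k; exact: nbhs_infty_ge.
have mj : 0 < m j.+1 by have := den_ge j.+1; lia.
have mk : 0 < m k.+1 by have := den_ge k.+1; lia.
rewrite ler_pdivlMr ?ltr0z// mulrC ler_pdivrMr ?ltr0z// -intrM ler_int.
rewrite -subr_ge0.
apply: (@linrec_homo (fun i => (m j * n i - n j * m i) * m j.+1 - m i) j.+1 _ _ _ _ kj).1.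
- by move=> i _; rewrite /m /n !linrecSS; ring.
- by rewrite [n j * _]mulrC den_det mul1r subrr.
(* The sequence is 0 at j + 1 and m_j at j + 2. *)
- rewrite [n j * m j.+1]mulrC den_det mul1r subrr.
  have [m0 _] := den_ge0_le j; apply: le_trans m0 _.
  rewrite [leRHS](_ : _ = m j + e j.+1 * m j.+1 * (m j * n j.+1 - m j.+1 * n j - 1)).
    by rewrite den_det subrr mulr0 addr0.
  by rewrite /m /n !linrecSS; ring.
Unshelve. all: by end_near. Qed.

(** The same argument for m_i - (m_j n_i - n_j m_i) m_j, which starts at i = j with the values m_j
    and m_(j+1) - m_j; they are in order because the m_j at least double. *)
Lemma gap_le j : (0 < j)%N -> delta j <= (m j)%:~R^-1.
Proof.
move=> j0; rewrite -(cvg_lim _ (@gap_cvg j))//; apply: limr_le.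
  by apply/cvg_ex; eexists; exact: gap_cvg.
near=> k.
have kj : (j <= k.+1)%N.
  by apply: leqW; near: k; exact: nbhs_infty_ge.
have mj : 0 < m j by have := den_ge j; lia.
have mk : 0 < m k.+1 by have := den_ge k.+1; lia.
rewrite ler_pdivrMr ?ltr0z// [leRHS]mulrC ler_pdivlMr ?ltr0z// -intrM ler_int.
rewrite -subr_ge0.
apply: (@linrec_homo (fun i => m i - (m j * n i - n j * m i) * m j) j _ _ _ _ kj).1.
- by move=> i _; rewrite /m /n !linrecSS; ring.
- by rewrite [n j * _]mulrC subrr mul0r subr0 ltW.
- rewrite [n j * m j.+1]mulrC den_det mul1r [n j * _]mulrC subrr mul0r subr0.
  by have := den_double j; lia.
Unshelve. all: by end_near. Qed.

Lemma gap_gt0 j : 0 < delta j.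
Proof.
apply: lt_le_trans (gap_ge j); rewrite invr_gt0 ltr0z.
by have := den_ge j.+1; lia.
Qed.

Lemma gap_cvg0 : delta @ \oo --> 0.
Proof.
rewrite -cvg_shiftS.
apply: (squeeze_cvgr _ (cvg_cst _) cvg_harmonic); near=> j.
rewrite ltW ?gap_gt0//=; apply: le_trans (gap_le (ltn0Sn j)) _.
rewrite /harmonic /= -[j.+1%:R]/(j.+1%:Z%:~R).
have mj := den_ge j.+1.
by rewrite lef_pV2 ?posrE ?ltr0z ?ler_int//; lia.
Unshelve. all: by end_near. Qed.

Lemma gap_diff_rec j : delta j.+1 - delta j.+2 =
  delta j - delta j.+1 - ((e j.+1)%:~R - 2) * delta j.+1.
Proof. by rewrite gap_rec; ring. Qed.

Lemma gap_diff_lt j : delta j.+1 - delta j.+2 < delta j - delta j.+1.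
Proof.
rewrite gap_diff_rec gtrDl oppr_lt0; apply: mulr_gt0; last exact: gap_gt0.
rewrite subr_gt0 (_ : 2 = 2%:~R)// ltr_int.
by have := e_ge3 (ltn0Sn j); lia.
Qed.

(** The gaps are strictly convex in j, so one step without decrease would be followed by increases
    only, against positivity and the limit 0. *)
Lemma gap_lt j : delta j.+1 < delta j.
Proof.
rewrite ltNge; apply/negP => jj.
have D i : delta (j + i)%N <= delta (j + i).+1.
  elim: i => [|i IH]; first by rewrite addn0.
  by rewrite addnS; have := gap_diff_lt (j + i); lra.
have E i : delta j <= delta (i + j)%N.
  elim: i => [|i IH]; first by rewrite add0n.
  by apply: le_trans IH _; rewrite addSn addnC.
have C : [sequence delta (i + j)%N]_i @ \oo --> 0 by rewrite cvg_shiftn; exact: gap_cvg0.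
have : delta j <= 0.
  rewrite -(cvg_lim _ C)//; apply: limr_ge; first by apply/cvg_ex; exists 0.
  exact: nearW.
by have := gap_gt0 j; lra.
Qed.

Lemma den_lt j : m j < m j.+1.
Proof.
case: j => [//|j]; have := den_double j.+1; have := den_ge j.+1; lia.
Qed.

Lemma den_diff_rec j : m j.+2 - m j.+1 = m j.+1 - m j + (e j.+1 - 2) * m j.+1.
Proof. by rewrite /m linrecSS; ring. Qed.

Lemma den_diff_le j : m j.+1 - m j <= m j.+2 - m j.+1.
Proof.
rewrite den_diff_rec lerDl mulr_ge0//; last by have := den_ge j.+1; lia.
by have := e_ge3 (ltn0Sn j); lia.
Qed.

End Limit.
End ContinuedFractionRecurrence.

(** * The potential as a series *)

Section WsumSplit.
Context {R : realType}.
Implicit Types c a : nat -> R.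

Lemma absolutely_summable_shift c N : absolutely_summable c ->
  absolutely_summable (fun j => c (j + N)%N).
Proof.
rewrite /absolutely_summable => sc.
have : cvgn [sequence \sum_(N <= k < n) `|c k|]_n by rewrite is_cvg_series_restrict.
move=> /cvg_ex[l]; rewrite -(cvg_shiftn N) => Hl; apply/cvg_ex; exists l.
rewrite (_ : series _ = [sequence [sequence \sum_(N <= k < n) `|c k|]_n (n + N)%N]_n)//.
by apply/funext => n; rewrite /series /= -{2}[N]add0n big_addn addnK.
Qed.

Lemma wsum_split c a C N : absolutely_summable c -> (forall j, `|a j| <= C) ->
  wsum c a = \sum_(j < N) c j * a j + wsum (fun j => c (j + N)%N) (fun j => a (j + N)%N).
Proof.
move=> sc aC; apply: cvg_lim => //.
rewrite -(cvg_shiftn N).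
have -> : [sequence series (fun j => c j * a j) (n + N)%N]_n =
  (fun n => \sum_(j < N) c j * a j + series (fun j => c (j + N)%N * a (j + N)%N) n).
  apply/funext => n; rewrite /series /= (@big_cat_nat _ _ _ N)//= ?leq_addl//.
  rewrite big_mkord; congr (_ + _).
  by rewrite -{1}[N]add0n big_addn addnK.
apply: cvgD; first exact: cvg_cst.
by apply: (@wsum_is_cvg _ _ _ C) => //; exact: absolutely_summable_shift.
Qed.

Lemma eq_wsum c a b : a =1 b -> wsum c a = wsum c b.
Proof. by move=> /funext ->. Qed.

End WsumSplit.

(* For the continued fraction of alpha, cm j is m_j and cd j is m_j alpha - n_j. *)
Record cusp_data (R : realType) := CuspData {
  cm : nat -> R;
  cd : nat -> R;
  cm0 : cm 0 = 0;
  cd0 : cd 0 = 1;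
  cm_lt : forall j, cm j < cm j.+1;
  cd_gt0 : forall j, 0 < cd j;
  cd_lt : forall j, cd j.+1 < cd j;
  cd_cvg : cd @ \oo --> 0;
  cm_cd_det : forall j, cm j.+1 * cd j - cm j * cd j.+1 = 1;
  corner_lt : forall j, (cd j.+1 - cd j.+2) / (cm j.+2 - cm j.+1) <
                        (cd j - cd j.+1) / (cm j.+1 - cm j) }.

Section CuspData.
Context {R : realType} (D : cusp_data R).

(** In the notation of the overview [slope], [weight] and [cpos] are k_j, k_j b_j and b_j. *)
Definition slope j := cm D j.+1 - cm D j.
Definition weight j := cd D j - cd D j.+1.
Definition cpos j := weight j / slope j.

Lemma slope_gt0 j : 0 < slope j. Proof. by rewrite subr_gt0 cm_lt. Qed.
Lemma weight_gt0 j : 0 < weight j. Proof. by rewrite subr_gt0 cd_lt. Qed.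
Lemma cpos_gt0 j : 0 < cpos j.
Proof. by rewrite divr_gt0 ?slope_gt0 ?weight_gt0. Qed.

Lemma slope_neq0 j : slope j != 0. Proof. by rewrite gt_eqF ?slope_gt0. Qed.
Lemma cpos_neq0 j : cpos j != 0. Proof. by rewrite gt_eqF ?cpos_gt0. Qed.

Lemma weightE j : weight j = slope j * cpos j.
Proof. by rewrite /cpos mulrC divfK ?slope_neq0. Qed.

Lemma cm_ge0 j : 0 <= cm D j.
Proof. by elim: j => [|j IH]; rewrite ?cm0// (le_trans IH)// ltW// cm_lt. Qed.

Lemma cpos_ltn i j : (i < j)%N -> cpos j < cpos i.
Proof.
elim: j => // j IHj; rewrite ltnS leq_eqVlt => /predU1P[->|/IHj]; first exact: corner_lt.
exact: lt_trans (corner_lt _ _).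
Qed.

Lemma cpos_leq i j : (i <= j)%N -> cpos j <= cpos i.
Proof. by rewrite leq_eqVlt => /predU1P[->//|/cpos_ltn/ltW]. Qed.

Lemma sum_slope n : \sum_(j < n) slope j = cm D n.
Proof.
elim: n => [|n IH]; first by rewrite big_ord0 cm0.
by rewrite big_ord_recr /= IH /slope; ring.
Qed.

Lemma sum_weight_nat N n : \sum_(j < n) weight (j + N)%N = cd D N - cd D (n + N)%N.
Proof.
elim: n => [|n IH]; first by rewrite big_ord0 add0n subrr.
by rewrite big_ord_recr /= IH /weight addSn; ring.
Qed.

Lemma weight_cvg N : series (fun j => weight (j + N)%N) @ \oo --> cd D N.
Proof.
have -> : series (fun j => weight (j + N)%N) = (fun n => cd D N - cd D (n + N)%N).
  by apply/funext => n; rewrite /series /= big_mkord sum_weight_nat.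
rewrite -[X in _ --> X]subr0; apply: cvgB; first exact: cvg_cst.
have := @cd_cvg _ D; rewrite -(cvg_shiftn N); exact.
Qed.

Lemma weight_summable : absolutely_summable weight.
Proof.
rewrite /absolutely_summable; under eq_fun do rewrite gtr0_norm ?weight_gt0//.
by apply/cvg_ex; exists (cd D 0); have := @weight_cvg 0; under eq_fun do rewrite addn0.
Qed.

Lemma weight_tail_summable N : absolutely_summable (fun j => weight (j + N)%N).
Proof. exact: absolutely_summable_shift weight_summable. Qed.

Lemma wsum_weight N : wsum (fun j => weight (j + N)%N) (fun=> 1) = cd D N.
Proof.
rewrite /wsum; under eq_fun do rewrite mulr1.
by apply: cvg_lim => //; exact: weight_cvg.
Qed.

(** As the b_j decrease, b_(n+1) m_(n+1) is at most the sum of k_j b_j over j <= n, hence at most 1;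
    and m_(n+1) [cd D n] >= 1 by the determinant. *)
Lemma cpos_le_cd n : cpos n.+1 <= cd D n.
Proof.
have H : cpos n.+1 * cm D n.+1 <= 1.
  rewrite -(sum_slope n.+1) mulr_sumr.
  apply: (@le_trans _ _ (\sum_(j < n.+1) weight (j + 0)%N)).
    apply: ler_sum => j _; rewrite addn0 weightE mulrC.
    by rewrite ler_pM2l ?slope_gt0// cpos_leq// ltnW.
  by rewrite sum_weight_nat cd0 addn0 lerBlDr lerDl ltW// cd_gt0.
have := cm_cd_det D n; have := cm_ge0 n; have := cm_lt D n.
have := cd_gt0 D n; have := cd_gt0 D n.+1; have := cpos_gt0 n.+1.
move: (cpos n.+1) H => b H b0 d1 d0 mm m0 det.
have : b * (cm D n.+1 * cd D n) <= cd D n by nra.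
have : 1 <= cm D n.+1 * cd D n by nra.
nra.
Qed.

Lemma cpos_cvg0 : cpos @ \oo --> 0.
Proof.
rewrite -cvg_shiftS; apply: (squeeze_cvgr _ (cvg_cst _) (@cd_cvg _ D)).
by near=> n; rewrite ltW ?cpos_gt0//= cpos_le_cd.
Unshelve. all: by end_near. Qed.

End CuspData.

(** The function sqrt (t^2 + S) + t increases with t, so it is at least its value at - T. This
    bounds the denominators r_j + x - b_j from below uniformly in j. *)
Lemma sqrtr_add_ge {R : rcfType} (T s t S : R) : 0 <= T -> 0 <= s -> s <= S -> - T <= t ->
  Num.sqrt (T ^+ 2 + s) - T <= Num.sqrt (t ^+ 2 + S) + t.
Proof.
move=> T0 s0 sS Tt; rewrite -lerBlDr.
set c := Num.sqrt _ - T; have c0 : 0 <= c.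
  by rewrite subr_ge0 -{1}(ger0_norm T0) -sqrtr_sqr ler_wsqrtr// lerDl.
have cE : (c + T) ^+ 2 = T ^+ 2 + s by rewrite subrK sqr_sqrtr// addr_ge0 ?sqr_ge0.
have [ct|ct] := leP (c - t) 0; first exact: le_trans ct (sqrtr_ge0 _).
rewrite -(gtr0_norm ct) -sqrtr_sqr; apply: ler_wsqrtr.
nra.
Qed.

Lemma open_pos {R : realType} {T : topologicalType} (f : T -> R) :
  continuous f -> open [set q | 0 < f q].
Proof.
move=> fc; rewrite (_ : [set q | _] = f @^-1` [set x | 0 < x])//.
by apply: open_comp => //; exact: open_gt.
Qed.

(** * Domains at a corner and at an edge, and the smooth part of the potential *)

Section Regions.
Context {R : realType} (D : cusp_data R).
Local Notation b := (cpos D).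
Local Notation kappa := (weight D).

(** The right end b_(i-1) of the edge i, which is infinite for i = 0. Since s may be slightly
    negative, the second inequality keeps the radicands of the corners j < i positive. *)
Definition below_next (i : nat) (x s : R) : Prop :=
  if i is i'.+1 then x < b i' /\ 0 < s + (b i' - x) ^+ 2 else True.

(* Here x stands for x - alpha and s for y^2; the conditions are open and, on s >= 0,
   hold for s > 0 and for the points s = 0 of the two edges that meet at the corner i. *)
Definition corner_reg i (x s : R) : Prop :=
  0 < x /\ (0 < s \/ [/\ b i.+1 < x, 0 < s + (x - b i.+1) ^+ 2 & below_next i x s]).

Definition edge_reg i (x s : R) : Prop :=
  0 < x /\ (0 < s \/ [/\ b i < x, 0 < s + (x - b i) ^+ 2 & below_next i x s]).

Definition set2 (P : R -> R -> Prop) : set 'rV[R]_2 := [set q | P (q 0 0) (q 0 1)].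

Lemma edge_corner_reg i x s : edge_reg i x s -> corner_reg i x s.
Proof.
move=> [x0 [s0|[xb sb h]]]; first by split=> //; left.
split=> //; right; have bb := cpos_ltn D (ltnSn i).
split=> //; first exact: lt_trans xb.
by apply: lt_le_trans sb _; rewrite lerD2l lerXn2r ?nnegrE; lra.
Qed.

Lemma continuous_coord2 (i : 'I_2) : continuous (fun q : 'rV[R]_2 => q 0 i).
Proof. exact: coord_continuous. Qed.

Lemma continuous_quad c : continuous (fun q : 'rV[R]_2 => q 0 1 + (q 0 0 - c) ^+ 2).
Proof.
move=> q; apply: differentiable_continuous.
have o : open [set: 'rV[R]_2] by exact: openT.
apply: (@Cinfty_diff _ _ setT (fun q => q 0 1 + (q 0 0 - c) ^+ 2)) => //.
apply: CinftyD => //; first exact: Cinfty_coord.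
by apply: CinftyX => //; apply: CinftyB => //; [exact: Cinfty_coord|exact: Cinfty_cst].
Qed.

Lemma continuous_affine c : continuous (fun q : 'rV[R]_2 => q 0 0 - c).
Proof.
move=> q; apply: differentiable_continuous.
by apply: differentiableB => //; exact: differentiable_coord.
Qed.

Lemma open_below_next i : open (set2 (below_next i)).
Proof.
case: i => [|i].
  by rewrite (_ : set2 _ = setT); [exact: openT|apply/seteqP; split].
have -> : set2 (below_next i.+1) = [set q : 'rV[R]_2 | 0 < b i - q 0 0] `&`
   [set q : 'rV[R]_2 | 0 < q 0 1 + (q 0 0 - b i) ^+ 2].
  apply/seteqP; split => q; rewrite /set2 /below_next /= subr_gt0.
    by move=> [? ?]; split=> //; rewrite -sqrrN opprB.
  by move=> [? ?]; split=> //; rewrite -sqrrN opprB.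
apply: openI; last by apply: open_pos; exact: continuous_quad.
apply: open_pos => q; apply: differentiable_continuous.
by apply: differentiableB => //; exact: differentiable_coord.
Qed.

Lemma open_half c i : open (set2 (fun x s => 0 < x /\
  (0 < s \/ [/\ c < x, 0 < s + (x - c) ^+ 2 & below_next i x s]))).
Proof.
have -> : set2 (fun x s => 0 < x /\
  (0 < s \/ [/\ c < x, 0 < s + (x - c) ^+ 2 & below_next i x s])) =
  [set q : 'rV[R]_2 | 0 < q 0 0] `&` ([set q : 'rV[R]_2 | 0 < q 0 1] `|`
   ([set q : 'rV[R]_2 | 0 < q 0 0 - c] `&` [set q : 'rV[R]_2 | 0 < q 0 1 + (q 0 0 - c) ^+ 2]
    `&` set2 (below_next i))).
  apply/seteqP; split => q; rewrite /set2 /= subr_gt0.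
    by move=> [? [?|[? ? ?]]]; split=> //; [left|right].
  by move=> [? [?|[[? ?] ?]]]; split=> //; [left|right].
apply: openI; first by apply: open_pos; exact: continuous_coord2.
apply: openU; first by apply: open_pos; exact: continuous_coord2.
apply: openI; last exact: open_below_next.
by apply: openI; apply: open_pos; [exact: continuous_affine|exact: continuous_quad].
Qed.

Lemma open_corner_reg i : open (set2 (corner_reg i)). Proof. exact: open_half. Qed.
Lemma open_edge_reg i : open (set2 (edge_reg i)). Proof. exact: open_half. Qed.

Definition rp j (x s : R) := Num.sqrt ((x + b j) ^+ 2 + s).
Definition rm j (x s : R) := Num.sqrt ((x - b j) ^+ 2 + s).

(* If F_j = 2 x / (rp j + rm j), then near the corner i one has F_j = 1 + s phi_hi j for i < j,
   F_j = x / b j + s phi_lo j for j < i, and F_i = (x + b i - rm i) / (2 b i) + s phi_eq i,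
   where only rm i is not smooth. *)
Definition phi_hi j x s : R :=
  - ((1 + 2 * x / (rp j x s + rm j x s)) /
     ((rp j x s + x + b j) * (rm j x s + x - b j))).
Definition phi_lo j x s : R :=
  (2 * b j)^-1 * ((rp j x s + x + b j)^-1 - (rm j x s - x + b j)^-1).
Definition phi_eq j x s : R := (2 * b j)^-1 * (rp j x s + x + b j)^-1.

(** The three summands come from the finitely many corners to the right of the corner i, from the
    corner i itself, and from the infinitely many corners between it and alpha. *)
Definition Hfun i x s : R :=
  \sum_(j < i) kappa j * phi_lo j x s + kappa i * phi_eq i x s +
  wsum (fun j => kappa (j + i.+1)%N) (fun j => phi_hi (j + i.+1)%N x s).

Lemma corner_reg_p i j x s : corner_reg i x s -> 0 < (x + b j) ^+ 2 + s.
Proof.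
move=> [x0 [s0|[xb sb _]]]; first by rewrite ltr_wpDl// sqr_ge0.
rewrite addrC; apply: lt_le_trans sb _; rewrite lerD2l lerXn2r ?nnegrE//; first lra.
  by have := cpos_gt0 D j; lra.
by have := cpos_gt0 D j; have := cpos_gt0 D i.+1; lra.
Qed.

Lemma corner_reg_hi i j x s : corner_reg i x s -> (i < j)%N -> 0 < (x - b j) ^+ 2 + s.
Proof.
move=> [x0 [s0|[xb sb _]]] ij; first by rewrite ltr_wpDl// sqr_ge0.
rewrite addrC; apply: lt_le_trans sb _; have bb := cpos_leq D ij.
by rewrite lerD2l lerXn2r ?nnegrE; lra.
Qed.

(** For s > 0 the denominator is at least sqrt (x^2 + s) - x; otherwise x < b_(i-1) <= b_j makes it
    positive directly. *)
Lemma corner_reg_lo i j x s : corner_reg i x s -> (j < i)%N ->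
  0 < (x - b j) ^+ 2 + s /\ 0 < rm j x s - x + b j.
Proof.
move=> [x0 H] ij.
have [s0|/negP s0] := boolP (0 < s).
  split; first by rewrite ltr_wpDl// sqr_ge0.
  rewrite /rm -sqrrN opprB -addrA [- x + _]addrC.
  have := @sqrtr_add_ge _ x s (b j - x) s (ltW x0) (ltW s0) (lexx _).
  rewrite lerBrDl => H1; apply: lt_le_trans (H1 _); last by have := cpos_gt0 D j; lra.
  rewrite subr_gt0 -{1}(gtr0_norm x0) -sqrtr_sqr ltr_sqrt ?ltrDl//.
  by rewrite ltr_wpDl ?sqr_ge0.
case: H => [//|[_ _]]; case: i ij => // i; rewrite ltnS => ij [xb sb].
have bb := cpos_leq D ij.
have pos : 0 < (x - b j) ^+ 2 + s.
  rewrite addrC -sqrrN opprB; apply: lt_le_trans sb _.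
  by rewrite lerD2l lerXn2r ?nnegrE; lra.
split=> //; rewrite -addrA ltr_pwDl ?sqrtr_gt0//; lra.
Qed.

Lemma Cinfty_rp i j : Cinfty (set2 (corner_reg i)) (fun q => rp j (q 0 0) (q 0 1)).
Proof.
have o := @open_corner_reg i.
apply: Cinfty_sqrt => //; first by move=> q; exact: corner_reg_p.
apply: CinftyD => //; last exact: Cinfty_coord.
apply: CinftyX => //; apply: CinftyD => //; [exact: Cinfty_coord|exact: Cinfty_cst].
Qed.

Lemma rp_denom_gt0 i j x s : corner_reg i x s -> 0 < rp j x s + x + b j.
Proof.
move=> H; have [x0 _] := H; have := cpos_gt0 D j.
have : 0 < rp j x s by rewrite sqrtr_gt0; exact: corner_reg_p H.
lra.
Qed.

Lemma Cinfty_rp_denom i j :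
  Cinfty (set2 (corner_reg i)) (fun q => (rp j (q 0 0) (q 0 1) + q 0 0 + b j)^-1).
Proof.
have o := @open_corner_reg i.
apply: CinftyV => //; first by move=> q; exact: rp_denom_gt0.
apply: CinftyD => //; last exact: Cinfty_cst.
by apply: CinftyD => //; [exact: Cinfty_rp|exact: Cinfty_coord].
Qed.

Lemma Cinfty_phi_lo i j : (j < i)%N ->
  Cinfty (set2 (corner_reg i)) (fun q => phi_lo j (q 0 0) (q 0 1)).
Proof.
move=> ji; have o := @open_corner_reg i.
apply: CinftyM => //; first exact: Cinfty_cst.
apply: CinftyB => //; first exact: Cinfty_rp_denom.
apply: CinftyV => //; first by move=> q /corner_reg_lo /(_ ji)[].
apply: CinftyD => //; last exact: Cinfty_cst.
apply: CinftyB => //; last exact: Cinfty_coord.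
apply: Cinfty_sqrt => //; first by move=> q /corner_reg_lo /(_ ji)[].
apply: CinftyD => //; last exact: Cinfty_coord.
by apply: CinftyX => //; apply: CinftyB => //; [exact: Cinfty_coord|exact: Cinfty_cst].
Qed.

Lemma Cinfty_phi_eq i : Cinfty (set2 (corner_reg i)) (fun q => phi_eq i (q 0 0) (q 0 1)).
Proof.
have o := @open_corner_reg i.
apply: CinftyM => //; first exact: Cinfty_cst.
exact: Cinfty_rp_denom.
Qed.

Lemma near_pos (T : topologicalType) (f : T -> R) q : continuous f -> 0 < f q ->
  \forall z \near q, f q / 2 < f z.
Proof.
move=> /(_ q) /cvgrPdist_lt fc fq; have := fc (f q / 2).
rewrite divr_gt0// => /(_ isT); apply: filterS => z zq.
by move: zq => /(le_lt_trans (ler_norm _)) /= zq; lra.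
Qed.

(** The lower bounds must be uniform over the infinitely many corners j > i. *)
Lemma tail_bounds i (q : 'rV[R]_2) : set2 (corner_reg i) q -> exists2 c, 0 < c &
  \forall z \near q, forall j, (i < j)%N ->
    let x := (z : 'rV[R]_2) 0 0 in let s := z 0 1 in
    [/\ c <= (x + b j) ^+ 2 + s, c <= (x - b j) ^+ 2 + s & c <= rm j x s + x - b j].
Proof.
move=> [x0 [s0|[xb sb _]]].
  have nx := near_pos (@continuous_coord2 0) x0.
  have ns := near_pos (@continuous_coord2 1) s0.
  pose T := b 0; have T0 : 0 < T by exact: cpos_gt0.
  (* Since x > 0, one has x - b_j >= - b_0 for every j, and s stays above half its value at q. *)
  pose c := Num.sqrt (T ^+ 2 + q 0 1 / 2) - T.
  have c0 : 0 < c.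
    rewrite subr_gt0 -{1}(gtr0_norm T0) -sqrtr_sqr ltr_sqrt ?ltrDl ?divr_gt0//.
    by rewrite ltr_wpDl ?sqr_ge0 ?divr_gt0.
  exists (Num.min c (q 0 1 / 2)); first by rewrite lt_min c0 divr_gt0.
  near=> z => j ij /=.
  have zx : q 0 0 / 2 < z 0 0 by near: z.
  have zs : q 0 1 / 2 < z 0 1 by near: z.
  have := cpos_leq D (leq0n j) => bj.
  rewrite !ge_min; split; apply/orP.
  - by right; rewrite ler_wpDl ?sqr_ge0// ltW.
  - by right; rewrite ler_wpDl ?sqr_ge0// ltW.
  - left; rewrite -addrA; apply: sqrtr_add_ge; rewrite ?ltW// ?divr_gt0// -/T.
    rewrite /T; lra.
(* In the other case j = i + 1 is the worst index, because it is the corner closest to x among those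
   with j > i. *)
have nx := near_pos (@continuous_affine (b i.+1)) (_ : 0 < q 0 0 - b i.+1).
have ns := near_pos (@continuous_quad (b i.+1)) sb.
set c := (q 0 1 + (q 0 0 - b i.+1) ^+ 2) / 2 in ns.
have c0 : 0 < c by rewrite divr_gt0.
exists (Num.min c (Num.sqrt c)); first by rewrite lt_min c0 sqrtr_gt0.
have {}nx := nx (ltac:(by rewrite subr_gt0)).
near=> z => j ij /=.
have zx : (q 0 0 - b i.+1) / 2 < z 0 0 - b i.+1 by near: z.
have zs : c < z 0 1 + (z 0 0 - b i.+1) ^+ 2 by near: z.
have zx0 : 0 < z 0 0 - b i.+1 by apply: lt_trans zx; rewrite divr_gt0// subr_gt0.
have bj := cpos_leq D ij; have b0 := cpos_gt0 D j; have b1 := cpos_gt0 D i.+1.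
have B1 : c <= (z 0 0 - b j) ^+ 2 + z 0 1.
  rewrite addrC; apply: le_trans (ltW zs) _.
  by rewrite lerD2l lerXn2r ?nnegrE; lra.
rewrite !ge_min; split; apply/orP.
- left; apply: le_trans B1 _; rewrite lerD2r -ler_sqrt ?sqr_ge0// !sqrtr_sqr.
  rewrite !ger0_norm; lra.
- by left.
- right; rewrite -addrA -[leLHS]addr0; apply: lerD; last lra.
  exact: ler_wsqrtr.
Unshelve. all: by end_near. Qed.

Lemma unif_Ck_tail i k : unif_Ck k (set2 (corner_reg i))
  (fun j q => phi_hi (j + i.+1)%N (q 0 0) (q 0 1)).
Proof.
have o := @open_corner_reg i.
have bC : unif_Ck k (set2 (corner_reg i)) (fun j _ => b (j + i.+1)%N).
  apply: (@unif_Ck_cst _ _ _ o _ _ (b 0)) => j.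
  by rewrite gtr0_norm ?cpos_gt0// cpos_leq.
have xC : unif_Ck k (set2 (corner_reg i)) (fun _ q => q 0 0) by exact: unif_Ck_coord.
have sC : unif_Ck k (set2 (corner_reg i)) (fun _ q => q 0 1) by exact: unif_Ck_coord.
have lt_j j : (i < j + i.+1)%N by rewrite addnS ltnS leq_addl.
pose P j (q : 'rV[R]_2) := rp (j + i.+1)%N (q 0 0) (q 0 1).
pose M j (q : 'rV[R]_2) := rm (j + i.+1)%N (q 0 0) (q 0 1).
have bp : bounded_away (set2 (corner_reg i))
    (fun j q => (q 0 0 + b (j + i.+1)%N) * (q 0 0 + b (j + i.+1)%N) + q 0 1).
  move=> q /tail_bounds[c c0 H]; exists c => //; apply: filterS H => z H j.
  by have [+ _ _] := H _ (lt_j j); rewrite expr2.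
have bm : bounded_away (set2 (corner_reg i))
    (fun j q => (q 0 0 - b (j + i.+1)%N) * (q 0 0 - b (j + i.+1)%N) + q 0 1).
  move=> q /tail_bounds[c c0 H]; exists c => //; apply: filterS H => z H j.
  by have [_ + _] := H _ (lt_j j); rewrite expr2.
have PC : unif_Ck k (set2 (corner_reg i)) P.
  apply: unif_Ck_eq (unif_Ck_sqrt o bp (unif_CkD o (unif_CkM o (unif_CkD o xC bC)
     (unif_CkD o xC bC)) sC)) => // j q _.
have MC : unif_Ck k (set2 (corner_reg i)) M.
  apply: unif_Ck_eq (unif_Ck_sqrt o bm (unif_CkD o (unif_CkM o (unif_CkB o xC bC)
     (unif_CkB o xC bC)) sC)) => // j q _.
have nU (q : 'rV[R]_2) : set2 (corner_reg i) q -> \forall z \near q, set2 (corner_reg i) z.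
  by move=> Uq; exact: open_nbhs_nbhs.
have P0 q j : set2 (corner_reg i) q -> 0 < P j q.
  by move=> H; rewrite sqrtr_gt0; exact: corner_reg_p H.
have M0 q j : 0 <= M j q by exact: sqrtr_ge0.
have PB := bounded_away_sqrt bp.
have b1 : bounded_away (set2 (corner_reg i)) (fun j q => P j q + M j q).
  move=> q /PB[c c0 H]; exists c => //; apply: filterS H => z H j.
  by apply: le_trans (H j) _; rewrite lerDl.
have b2 : bounded_away (set2 (corner_reg i)) (fun j q => P j q + q 0 0 + b (j + i.+1)%N).
  move=> q Uq; have [c c0 H] := PB q Uq; exists c => //.
  apply: filterS2 H (nU q Uq) => z H [z0 _] j.
  by apply: le_trans (H j) _; rewrite -addrA lerDl addr_ge0 ?ltW// cpos_gt0.
have b3 : bounded_away (set2 (corner_reg i)) (fun j q => M j q + q 0 0 - b (j + i.+1)%N).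
  move=> q /tail_bounds[c c0 H]; exists c => //; apply: filterS H => z H j.
  by have [_ _ +] := H _ (lt_j j).
have oneC : unif_Ck k (set2 (corner_reg i)) (fun _ _ => 1).
  by apply: (@unif_Ck_cst _ _ _ o _ _ 1) => _; rewrite normr1.
apply: unif_Ck_eq (unif_CkN o (unif_CkM o (unif_CkD o oneC (unif_CkM o (unif_CkZ o 2 xC)
   (unif_CkV o b1 (unif_CkD o PC MC))))
   (unif_CkM o (unif_CkV o b2 (unif_CkD o (unif_CkD o PC xC) bC))
    (unif_CkV o b3 (unif_CkB o (unif_CkD o MC xC) bC))))) => // j q _.
by rewrite /phi_hi invfM.
Qed.

Lemma Cinfty_Hfun i : Cinfty (set2 (corner_reg i)) (fun q => Hfun i (q 0 0) (q 0 1)).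
Proof.
have o := @open_corner_reg i.
apply: CinftyD => //; last first.
  move=> k; exact: (unif_Ck_wsum o (@weight_tail_summable _ D i.+1)
    (unif_Ck_tail i k.+1)).
apply: CinftyD => //; last first.
  by apply: CinftyM => //; [exact: Cinfty_cst|exact: Cinfty_phi_eq].
apply: Cinfty_sum => // j.
by apply: CinftyM => //; [exact: Cinfty_cst|exact: Cinfty_phi_lo].
Qed.

End Regions.

(** * The series for f and its expansion at a corner *)

Section Potential.
Context {R : realType} (D : cusp_data R).
Local Notation b := (cpos D).
Local Notation kappa := (weight D).
Local Notation k_ := (slope D).
Local Notation rp := (rp D).
Local Notation rm := (rm D).

Definition Fterm j x s : R := 2 * x / (rp j x s + rm j x s).
(** Twice the s-derivative of [Fterm]: as d/dy = 2 y d/ds, the sum [gfun] is f_y / y. *)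
Definition gterm j x s : R := - (2 * x) / ((rp j x s + rm j x s) * (rp j x s * rm j x s)).
Definition Ffun x s := wsum kappa (fun j => Fterm j x s).
Definition gfun x s := wsum kappa (fun j => gterm j x s).

Lemma bounded_of_tail (a : nat -> R) N C : (forall j, (N <= j)%N -> `|a j| <= C) ->
  exists C', forall j, `|a j| <= C'.
Proof.
move=> H; exists (`|C| + \sum_(j < N) `|a j|) => j.
have [/H jN|jN] := leqP N j.
  by apply: le_trans jN _; apply: le_trans (ler_norm _) _; rewrite lerDl sumr_ge0.
rewrite (bigD1 (Ordinal jN))//= addrCA lerDl addr_ge0//.
by rewrite sumr_ge0.
Qed.

Lemma rp_rm_ge j x s : 0 < x -> 0 <= s -> 2 * x <= rp j x s + rm j x s.
Proof.
move=> x0 s0.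
have H (t : R) : t <= Num.sqrt (t ^+ 2 + s).
  by apply: le_trans (ler_norm _) _; rewrite -sqrtr_sqr ler_wsqrtr// lerDl.
have := H (x + b j); have := H (x - b j); rewrite -/(rp _ _ _) -/(rm _ _ _); lra.
Qed.

Lemma rp_rm_gt0 j x s : 0 < x -> 0 <= s -> 0 < rp j x s + rm j x s.
Proof. by move=> x0 s0; have := rp_rm_ge j x0 s0; lra. Qed.

Lemma Fterm_bound j x s : 0 < x -> 0 <= s -> `|Fterm j x s| <= 1.
Proof.
move=> x0 s0; have H := rp_rm_ge j x0 s0; rewrite /Fterm.
have p0 := rp_rm_gt0 j x0 s0.
rewrite ger0_norm; last by apply: divr_ge0; lra.
by rewrite ler_pdivrMr// mul1r.
Qed.

Lemma Ffun_gt0 x s : 0 < x -> 0 <= s -> 0 < Ffun x s.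
Proof.
move=> x0 s0; rewrite -oppr_lt0 -mulN1r /Ffun.
rewrite -(wsumZ _ (@weight_summable _ D) (fun j => Fterm_bound j x0 s0)).
have P j : 0 < Fterm j x s.
  by have := rp_rm_ge j x0 s0; rewrite /Fterm => H; apply: divr_gt0; lra.
apply: (@wsum_lt0 _ _ _ 1 0) => //; first exact: weight_summable.
- by move=> j; rewrite mulN1r normrN Fterm_bound.
- by move=> j; rewrite mulN1r mulrN oppr_le0 mulr_ge0 ?ltW ?weight_gt0.
- by rewrite mulN1r mulrN oppr_lt0 mulr_gt0 ?weight_gt0.
Qed.

Lemma rp_sq j x s : 0 <= s -> rp j x s ^+ 2 = (x + b j) ^+ 2 + s.
Proof. by move=> s0; rewrite sqr_sqrtr// addr_ge0// sqr_ge0. Qed.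

Lemma rm_sq j x s : 0 <= s -> rm j x s ^+ 2 = (x - b j) ^+ 2 + s.
Proof. by move=> s0; rewrite sqr_sqrtr// addr_ge0// sqr_ge0. Qed.

Section Decomposition.
Variables (i : nat) (x s : R).
Hypotheses (rxs : corner_reg D i x s) (s0 : 0 <= s).
Let x0 : 0 < x. Proof. by case: rxs. Qed.

(** Rationalisation, from rp^2 - (x + b_j)^2 = s. The quotients in [Hfun] all arise from this
    identity and its analogues for rm. *)
Let lin_rp j : s / (rp j x s + x + b j) = rp j x s - x - b j.
Proof.
have H := rp_denom_gt0 j rxs; have E := rp_sq j x s0.
apply: (canLR (mulfK _)); first by rewrite gt_eqF.
by rewrite -[LHS](addKr ((x + b j) ^+ 2)) -E; ring.
Qed.

Lemma Fterm_half j : kappa j * Fterm j x s = k_ j / 2 * (rp j x s - rm j x s).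
Proof.
have H := rp_rm_ge j x0 s0; have E := rp_sq j x s0; have E' := rm_sq j x s0.
have n0 : rp j x s + rm j x s != 0 by rewrite gt_eqF// rp_rm_gt0.
rewrite weightE /Fterm -[RHS](mulfK n0) mulrA; congr (_ / _).
transitivity (k_ j / 2 * (rp j x s ^+ 2 - rm j x s ^+ 2)); last by ring.
by rewrite E E'; field.
Qed.

Let Fterm_lo (j : 'I_i) :
  kappa j * Fterm j x s = k_ j * x + s * (kappa j * phi_lo D j x s).
Proof.
have [_ H2] := corner_reg_lo rxs (ltn_ord j).
have E' := rm_sq j x s0.
have L : s / (rm j x s - x + b j) = rm j x s + x - b j.
  apply: (canLR (mulfK _)); first by rewrite gt_eqF.
  by rewrite -[LHS](addKr ((x - b j) ^+ 2)) -E'; ring.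
rewrite Fterm_half /phi_lo weightE.
have -> : s * (k_ j * b j * ((2 * b j)^-1 * ((rp j x s + x + b j)^-1 -
   (rm j x s - x + b j)^-1))) = k_ j * (b j * (2 * b j)^-1) *
   (s / (rp j x s + x + b j) - s / (rm j x s - x + b j)) by ring.
by rewrite lin_rp L; field; rewrite cpos_neq0.
Qed.

Let Fterm_eq : kappa i * Fterm i x s =
  k_ i / 2 * (x + b i) + s * (kappa i * phi_eq D i x s) - k_ i / 2 * rm i x s.
Proof.
rewrite Fterm_half /phi_eq weightE.
have -> : s * (k_ i * b i * ((2 * b i)^-1 * (rp i x s + x + b i)^-1)) =
   k_ i * (b i * (2 * b i)^-1) * (s / (rp i x s + x + b i)) by ring.
by rewrite lin_rp; field; rewrite cpos_neq0.
Qed.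

Let hi_gt0 j : (i < j)%N -> 0 < rm j x s + x - b j.
Proof.
move=> ij; have [c c0 H] := @tail_bounds _ D i (\row_k [:: x; s]`_k) (ltac:(by rewrite /set2 /= !mxE)).
by have := nbhs_singleton H j ij; rewrite /= !mxE /= => -[_ _]; apply: lt_le_trans.
Qed.

Let Fterm_hi j : (i < j)%N -> Fterm j x s = 1 + s * phi_hi D j x s.
Proof.
move=> ij; have H1 := rp_denom_gt0 j rxs; have H2 := hi_gt0 ij.
have H3 := rp_rm_ge j x0 s0; have E' := rm_sq j x s0.
have n0 : rp j x s + rm j x s != 0 by rewrite gt_eqF// rp_rm_gt0.
have L : s / (rm j x s + x - b j) = rm j x s - x + b j.
  apply: (canLR (mulfK _)); first by rewrite gt_eqF.
  by rewrite -[LHS](addKr ((x - b j) ^+ 2)) -E'; ring.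
have L' := lin_rp j.
have E2 : s * phi_hi D j x s = - ((s / (rp j x s + x + b j) + s / (rm j x s + x - b j)) /
    (rp j x s + rm j x s)).
  rewrite /phi_hi; field.
  by rewrite !gt_eqF// rp_rm_gt0.
by rewrite E2 L L' /Fterm; field.
Qed.

Lemma tail_bounded : exists C, forall j, `|phi_hi D (j + i.+1)%N x s| <= C.
Proof.
have rq : set2 (corner_reg D i) (\row_k [:: x; s]`_k) by rewrite /set2 /= !mxE.
have [C C0 H] := unif_Ck_bounded (@unif_Ck_tail _ D i 0) rq.
by exists C => j; have := nbhs_singleton H j; rewrite !mxE.
Qed.

(** The corners j < i contribute k_j x each, which add up to m_i x; those with j > i contribute
    their weights, which add up to [cd D i.+1]; the corner i contributes half of its slope and of
    its weight, and the term with the radius r_i. *)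
Lemma Ffun_decomp : Ffun x s = (cm D i + k_ i / 2) * x + (cd D i - kappa i / 2) +
  s * Hfun D i x s - k_ i / 2 * rm i x s.
Proof.
have [C HC] := tail_bounded.
rewrite /Ffun (@wsum_split _ _ _ 1 i.+1 (@weight_summable _ D)); last first.
  by move=> j; exact: Fterm_bound.
rewrite big_ord_recr /= Fterm_eq (eq_bigr _ (fun j _ => Fterm_lo j)) big_split /=.
rewrite -mulr_suml sum_slope -mulr_sumr.
have -> : wsum (fun j => kappa (j + i.+1)%N) (fun j => Fterm (j + i.+1)%N x s) =
   cd D i.+1 + s * wsum (fun j => kappa (j + i.+1)%N) (fun j => phi_hi D (j + i.+1)%N x s).
  rewrite -(wsum_weight D i.+1) -(wsumZ _ (@weight_tail_summable _ D i.+1) HC).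
  rewrite -(@wsumD _ _ _ _ 1 (`|s| * C) (@weight_tail_summable _ D i.+1)).
  - apply: eq_wsum => j; rewrite Fterm_hi//= addnS ltnS leq_addl//.
  - by move=> j; rewrite normr1.
  - by move=> j; rewrite normrM ler_wpM2l.
have W := weightE D i; rewrite /Hfun.
have -> : cd D i.+1 = cd D i - kappa i by rewrite /weight; ring.
rewrite W.
by field.
Qed.

Section Regular.
Hypothesis rm0 : 0 < (x - b i) ^+ 2 + s.

(** For j > i a term is at most 1 / (p_j r_j) in absolute value, hence at most 1 / c; only finitely
    many others remain. *)
Lemma gterm_bounded : exists C, forall j, `|gterm j x s| <= C.
Proof.
have x0' : 0 < x := x0.
have [c c0 H] := @tail_bounds _ D i (\row_k [:: x; s]`_k) (ltac:(by rewrite /set2 /= !mxE)).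
apply: (@bounded_of_tail _ i.+1 c^-1) => j ij.
have [] := nbhs_singleton H j ij; rewrite /= !mxE /= => c1 c2 _.
have H3 := rp_rm_ge j x0 s0; have p0 := rp_rm_gt0 j x0 s0.
have sp : Num.sqrt c <= rp j x s by apply: ler_wsqrtr.
have sm : Num.sqrt c <= rm j x s by apply: ler_wsqrtr.
have sc : 0 < Num.sqrt c by rewrite sqrtr_gt0.
have pm : c <= rp j x s * rm j x s.
  have -> : c = Num.sqrt c * Num.sqrt c by rewrite -expr2 sqr_sqrtr// ltW.
  by apply: ler_pM => //; rewrite ltW.
have pm0 : 0 < rp j x s * rm j x s by exact: lt_le_trans pm.
rewrite /gterm mulNr normrN ger0_norm; last first.
  by apply: divr_ge0; [lra|rewrite mulr_ge0 ?ltW].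
rewrite invfM mulrA -[leRHS]mul1r; apply: ler_pM.
- by apply: divr_ge0; lra.
- by rewrite invr_ge0 ltW.
- by rewrite ler_pdivrMr// mul1r.
- by rewrite lef_pV2.
Qed.

Lemma rm_pos j : 0 < rm j x s.
Proof.
rewrite sqrtr_gt0; case: (ltngtP j i) => [ji|ij|->//].
  by have [] := corner_reg_lo rxs ji.
exact: corner_reg_hi rxs ij.
Qed.

Lemma rp_pos j : 0 < rp j x s.
Proof. by rewrite sqrtr_gt0; exact: corner_reg_p rxs. Qed.

Lemma gfun_lt0 : gfun x s < 0.
Proof.
have x0' : 0 < x := x0.
have [C HC] := gterm_bounded.
have P j : gterm j x s < 0.
  rewrite /gterm mulNr oppr_lt0 divr_gt0//; first by lra.
  by have := rp_pos j; have := rm_pos j => ? ?; rewrite mulr_gt0 ?addr_gt0 ?mulr_gt0.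
apply: (@wsum_lt0 _ _ _ C 0) => //; first exact: weight_summable.
  by move=> j; rewrite pmulr_rle0 ?weight_gt0 ?ltW.
by rewrite pmulr_rlt0 ?weight_gt0.
Qed.

Lemma gterm_half j : kappa j * gterm j x s = k_ j / 2 * ((rp j x s)^-1 - (rm j x s)^-1).
Proof.
have H := rp_rm_ge j x0 s0; have E := rp_sq j x s0; have E' := rm_sq j x s0.
have p0 := rp_pos j; have r0 := rm_pos j.
have n0 : rp j x s + rm j x s != 0 by rewrite gt_eqF// rp_rm_gt0.
have X : 2 * x * b j = (rp j x s ^+ 2 - rm j x s ^+ 2) / 2 by rewrite E E'; field.
rewrite weightE /gterm.
have -> : k_ j * b j * (- (2 * x) / ((rp j x s + rm j x s) * (rp j x s * rm j x s))) =
  - k_ j * (2 * x * b j) / ((rp j x s + rm j x s) * (rp j x s * rm j x s)) by ring.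
by rewrite X; field; rewrite n0 !gt_eqF.
Qed.

(** Nothing is differentiated on the axis: at s = 0 each term g_j equals 2 [phi_lo] or 2 [phi_hi],
    the s-derivative of F_j read off its expansion, and the term of the corner i adds - k_i / (2
    r_i). *)
Lemma gfun_axis : s = 0 -> gfun x 0 = 2 * Hfun D i x 0 - k_ i / (2 * rm i x s).
Proof.
have x0' : 0 < x := x0.
move=> s00; have [C HC] := tail_bounded; have [C' HC'] := gterm_bounded.
rewrite -{1}s00 /gfun (wsum_split i.+1 (@weight_summable _ D) HC').
have P j : rp j x s = x + b j.
  by rewrite /rp s00 addr0 sqrtr_sqr ger0_norm// ltW// addr_gt0// cpos_gt0.
have bi0 := cpos_gt0 D i.
have lo (j : 'I_i) : kappa j * gterm j x s = 2 * (kappa j * phi_lo D j x s).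
  have [_ H2] := corner_reg_lo rxs (ltn_ord j).
  have Mj : rm j x s = b j - x.
    have : rm j x s ^+ 2 = (b j - x) ^+ 2 by rewrite rm_sq// s00 addr0 -sqrrN opprB.
    by move=> /eqP; rewrite eqf_sqr => /orP[/eqP//|/eqP E]; move: H2; rewrite E; lra.
  have bj0 := cpos_gt0 D j; have r0 := rm_pos j.
  rewrite gterm_half /phi_lo weightE P Mj; field.
  by move: r0; rewrite Mj => r0; rewrite !gt_eqF//; lra.
rewrite big_ord_recr /= (eq_bigr _ (fun j _ => lo j)) -mulr_sumr.
have -> : kappa i * gterm i x s = 2 * (kappa i * phi_eq D i x s) - k_ i / (2 * rm i x s).
  have r0 := rm_pos i; rewrite gterm_half /phi_eq weightE P; field.
  by rewrite !gt_eqF//; lra.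
have -> : wsum (fun j => kappa (j + i.+1)%N) (fun j => gterm (j + i.+1)%N x s) =
   2 * wsum (fun j => kappa (j + i.+1)%N) (fun j => phi_hi D (j + i.+1)%N x s).
  rewrite -(wsumZ _ (@weight_tail_summable _ D i.+1) HC); apply: eq_wsum => j0.
  have lt_j : (i < j0 + i.+1)%N by rewrite addnS ltnS leq_addl.
  move: (j0 + i.+1)%N lt_j => j ij; have H2 := hi_gt0 ij.
  have Mj : rm j x s = x - b j.
    have : rm j x s ^+ 2 = (x - b j) ^+ 2 by rewrite rm_sq// s00 addr0.
    by move=> /eqP; rewrite eqf_sqr => /orP[/eqP//|/eqP E]; move: H2; rewrite E; lra.
  have bj0 := cpos_gt0 D j; have r0 := rm_pos j.
  rewrite /gterm /phi_hi P Mj; field.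
  by move: r0; rewrite Mj => r0; rewrite !gt_eqF//; lra.
by rewrite /Hfun s00; ring.
Qed.

End Regular.
End Decomposition.
End Potential.

Lemma derive_quotient {R : realType} (V : normedModType R) (x p r : V -> R) q v dp dr :
  derivable x q v -> 'D_v x q = 0 -> derivable p q v -> 'D_v p q = dp ->
  derivable r q v -> 'D_v r q = dr -> p q + r q != 0 ->
  'D_v (fun q => 2 * x q * (p q + r q)^-1) q =
    - (2 * x q * (p q + r q) ^- 2 * (dp + dr)).
Proof.
move=> gx ex gp ep gr er n0.
have g2 := @derivableZ _ _ _ (x : V -> R^o) 2 q v gx.
have e2 : 'D_v (2 \*: (x : V -> R^o)) q = 0.
  by rewrite (deriveZ _ gx) ex scaler0.
have gD := @derivableD _ _ _ p r q v gp gr.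
have eD : 'D_v (p + r) q = dp + dr by rewrite (deriveD gp gr) ep er.
have gV := @derivableV _ _ (p + r) q v n0 gD.
have eV := @deriveV _ _ (p + r) q v n0 gD.
apply: etrans (@deriveM _ _ (2 \*: (x : V -> R^o)) (fun q => ((p + r) q)^-1) q v g2 gV) _.
rewrite eV eD e2 scaler0 addr0 -![_ *: _]/(_ * _) mulNr mulrN mulrA.
by [].
Qed.

Lemma derive_combination {R : realType} (V : normedModType R) (x s h r : V -> R)
    q v dx ds dh dr (A B C : R) :
  derivable x q v -> 'D_v x q = dx -> derivable s q v -> 'D_v s q = ds ->
  derivable h q v -> 'D_v h q = dh -> derivable r q v -> 'D_v r q = dr ->
  'D_v (fun q => A * x q + B + s q * h q - C * r q) q =
    A * dx + (s q * dh + h q * ds) - C * dr.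
Proof.
move=> gx ex gs es gh eh gr er.
have g1 := @derivableZ _ _ _ (x : V -> R^o) A q v gx.
have e1 := @deriveZ _ _ _ (x : V -> R^o) A q v gx.
have g2 := @derivable_cst _ _ _ (B : R^o) q v.
have g3 := @derivableM _ _ s h q v gs gh.
have e3 := @deriveM _ _ s h q v gs gh.
have g4 := @derivableZ _ _ _ (r : V -> R^o) C q v gr.
have e4 := @deriveZ _ _ _ (r : V -> R^o) C q v gr.
have g12 := @derivableD _ _ _ _ _ q v g1 g2.
have e12 := @deriveD _ _ _ _ _ q v g1 g2.
have g123 := @derivableD _ _ _ _ _ q v g12 g3.
have e123 := @deriveD _ _ _ _ _ q v g12 g3.
apply: etrans (@deriveB _ _ _ _ _ q v g123 g4) _.
by rewrite e123 e12 e3 e4 e1 derive_cst addr0 ex es eh er.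
Qed.

(** * Partial derivatives of the potential *)

Section PotentialDerivatives.
Context {R : realType} (D : cusp_data R).
Local Notation b := (cpos D).
Local Notation kappa := (weight D).
Local Notation k_ := (slope D).
Local Notation rp := (rp D).
Local Notation rm := (rm D).

Definition row2 (x s : R) : 'rV[R]_2 := \row_k [:: x; s]`_k.

Lemma row2_0 x s : row2 x s 0 0 = x. Proof. by rewrite mxE. Qed.
Lemma row2_1 x s : row2 x s 0 1 = s. Proof. by rewrite mxE. Qed.
Lemma row2_eta (q : 'rV[R]_2) : row2 (q 0 0) (q 0 1) = q.
Proof.
apply/rowP => k; rewrite mxE.
case: k => [[|[|//]]] p /=; by congr (q _ _); apply: val_inj.
Qed.

Definition lift2 (h : R -> R -> R) (q : 'rV[R]_2) := h (q 0 0) (q 0 1).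
Definition dx2 (h : R -> R -> R) x s := 'D_(delta_mx 0 0) (lift2 h) (row2 x s).
Definition ds2 (h : R -> R -> R) x s := 'D_(delta_mx 0 1) (lift2 h) (row2 x s).

Lemma lift2_dx2 h : lift2 (dx2 h) = 'D_(delta_mx 0 0) (lift2 h).
Proof. by apply/funext => q; rewrite /lift2 /dx2 row2_eta. Qed.

Lemma lift2_ds2 h : lift2 (ds2 h) = 'D_(delta_mx 0 1) (lift2 h).
Proof. by apply/funext => q; rewrite /lift2 /ds2 row2_eta. Qed.

Lemma Cinfty_dx2 P h : open (set2 P) -> Cinfty (set2 P) (lift2 h) ->
  Cinfty (set2 P) (lift2 (dx2 h)).
Proof. by move=> o H; rewrite lift2_dx2; apply: Cinfty_deriv. Qed.

Lemma Cinfty_ds2 P h : open (set2 P) -> Cinfty (set2 P) (lift2 h) ->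
  Cinfty (set2 P) (lift2 (ds2 h)).
Proof. by move=> o H; rewrite lift2_ds2; apply: Cinfty_deriv. Qed.

Lemma derive_coord2 (k l : 'I_2) (q : 'rV[R]_2) :
  is_derive q (delta_mx 0 l) (fun q => q 0 k) (k == l)%:R.
Proof.
apply: DeriveDef; first by apply: diff_derivable; exact: differentiable_coord.
rewrite deriveE; last exact: differentiable_coord.
have := @diff_coord R 'rV[R]_2 2 id q k (delta_mx 0 l) (@ex_diff _ _ _ _ _ _ _ (is_diff_id q)).
by move=> ->; rewrite diff_val mxE eqxx.
Qed.

Lemma radius_derive (c : R) (q : 'rV[R]_2) (l : 'I_2) : 0 < (q 0 0 - c) ^+ 2 + q 0 1 ->
  let r := fun q : 'rV[R]_2 => Num.sqrt ((q 0 0 - c) ^+ 2 + q 0 1) in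
  differentiable r q /\
  is_derive q (delta_mx 0 l) r
   ((2 * r q)^-1 * (2 * (q 0 0 - c) * (0 == l)%:R + (1 == l)%:R)).
Proof.
move=> r0 r.
pose f (q : 'rV[R]_2) := (q 0 0 - c) * (q 0 0 - c) + q 0 1.
have fE : (fun q : 'rV[R]_2 => (q 0 0 - c) ^+ 2 + q 0 1) = f by apply/funext => z; rewrite expr2.
have d0 : differentiable (fun q : 'rV[R]_2 => q 0 0) q by exact: differentiable_coord.
have d1 : differentiable (fun q : 'rV[R]_2 => q 0 1) q by exact: differentiable_coord.
have dB : differentiable (fun q : 'rV[R]_2 => q 0 0 - c) q by exact: differentiableB.
have dM : differentiable (fun q : 'rV[R]_2 => (q 0 0 - c) * (q 0 0 - c)) q.
  exact: differentiableM.
have df : differentiable f q by exact: differentiableD.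
have rE : r = Num.sqrt \o f by apply/funext => z; rewrite /r /= -fE.
have f0 : 0 < f q by rewrite -fE.
have I := is_diff_sqrt_comp f0 df.
have dr : differentiable r q by rewrite rE; case: I.
split=> //; apply: DeriveDef; first exact: diff_derivable.
rewrite deriveE// rE diff_val /= -deriveE//; congr (_ * _).
have [g0 e0] := derive_coord2 0 l q; have [g1 e1] := derive_coord2 1 l q.
have gB : derivable (fun q : 'rV[R]_2 => q 0 0 - c) q (delta_mx 0 l).
  exact: diff_derivable.
have eB : 'D_(delta_mx 0 l) (fun q : 'rV[R]_2 => q 0 0 - c) q = (0 == l)%:R.
  apply: etrans (@deriveB _ _ _ (fun q : 'rV[R]_2 => q 0 0) (cst c) _ _ g0 _) _.
    exact: derivable_cst.
  by rewrite e0 derive_cst subr0.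
have gM : derivable (fun q : 'rV[R]_2 => (q 0 0 - c) * (q 0 0 - c)) q (delta_mx 0 l).
  exact: diff_derivable.
have eM := @deriveM _ _ (fun q : 'rV[R]_2 => q 0 0 - c) (fun q : 'rV[R]_2 => q 0 0 - c)
   _ _ gB gB.
apply: etrans (@deriveD _ _ _ (fun q : 'rV[R]_2 => (q 0 0 - c) * (q 0 0 - c))
   (fun q : 'rV[R]_2 => q 0 1) _ _ gM g1) _.
apply: etrans (congr2 _ eM e1) _; rewrite eB.
rewrite -![_ *: _]/(_ * _); ring.
Qed.

Definition quadrant (x s : R) := 0 < x /\ 0 < s.

Lemma open_quadrant : open (set2 quadrant).
Proof.
rewrite (_ : set2 _ = [set q : 'rV[R]_2 | 0 < q 0 0] `&` [set q : 'rV[R]_2 | 0 < q 0 1])//.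
by apply: openI; apply: open_pos; exact: continuous_coord2.
Qed.

Lemma quadrant_corner_reg i x s : quadrant x s -> corner_reg D i x s.
Proof. by move=> [x0 s0]; split=> //; left. Qed.

Lemma lift2_rm j : lift2 (rm j) = fun q => Num.sqrt ((q 0 0 - b j) ^+ 2 + q 0 1).
Proof. by []. Qed.

Lemma lift2_rp j : lift2 (rp j) = fun q => Num.sqrt ((q 0 0 - - b j) ^+ 2 + q 0 1).
Proof. by apply/funext => q; rewrite opprK. Qed.

Lemma Fterm_ds j (q : 'rV[R]_2) : set2 quadrant q ->
  'D_(delta_mx 0 1) (lift2 (Fterm D j)) q = gterm D j (q 0 0) (q 0 1) / 2.
Proof.
move=> [x0 s0].
have m0 : 0 < (q 0 0 - b j) ^+ 2 + q 0 1 by rewrite ltr_wpDl ?sqr_ge0.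
have p0 : 0 < (q 0 0 - - b j) ^+ 2 + q 0 1 by rewrite ltr_wpDl ?sqr_ge0.
have := radius_derive 1 m0; have := radius_derive 1 p0.
rewrite -lift2_rp -lift2_rm /=; set p := lift2 (rp j); set r := lift2 (rm j).
rewrite !mulr0 !add0r !mulr1 => -[dp [gp ep]] [dr [gr er]].
have pq : 0 < p q by rewrite /p lift2_rp sqrtr_gt0.
have rq : 0 < r q by rewrite /r lift2_rm sqrtr_gt0.
have FE : lift2 (Fterm D j) = fun q => (2 * q 0 0) * (p q + r q)^-1 by [].
have [g0 e0] := derive_coord2 0 1 q.
have n0 : p q + r q != 0 by rewrite gt_eqF// addr_gt0.
rewrite FE (derive_quotient g0 e0 gp ep gr er n0).
rewrite /gterm -/(lift2 (rp j) q) -/(lift2 (rm j) q) -/p -/r.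
by field; rewrite n0 !gt_eqF.
Qed.

Lemma unif_Ck_Fterm k : unif_Ck k (set2 quadrant) (fun j => lift2 (Fterm D j)).
Proof.
have o := open_quadrant.
have bC : unif_Ck k (set2 quadrant) (fun j _ => b j).
  apply: (@unif_Ck_cst _ _ _ o _ _ (b 0)) => j.
  by rewrite gtr0_norm ?cpos_gt0// cpos_leq.
have xC : unif_Ck k (set2 quadrant) (fun _ q => q 0 0) by exact: unif_Ck_coord.
have sC : unif_Ck k (set2 quadrant) (fun _ q => q 0 1) by exact: unif_Ck_coord.
have ba (c : nat -> R) : bounded_away (set2 quadrant)
    (fun j (q : 'rV[R]_2) => (q 0 0 + c j) * (q 0 0 + c j) + q 0 1).
  move=> q [x0 s0]; exists (q 0 1 / 2); first by rewrite divr_gt0.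
  have := near_pos (@continuous_coord2 R 1) s0; apply: filterS => z zq j.
  by rewrite -expr2 ler_wpDl ?sqr_ge0// ltW.
have PC : unif_Ck k (set2 quadrant) (fun j => lift2 (rp j)).
  exact: unif_Ck_eq (unif_Ck_sqrt o (ba b) (unif_CkD o (unif_CkM o (unif_CkD o xC bC)
     (unif_CkD o xC bC)) sC)).
have MC : unif_Ck k (set2 quadrant) (fun j => lift2 (rm j)).
  exact: unif_Ck_eq (unif_Ck_sqrt o (ba (fun j => - b j)) (unif_CkD o (unif_CkM o
   (unif_CkB o xC bC) (unif_CkB o xC bC)) sC)).
have b1 : bounded_away (set2 quadrant) (fun j q => lift2 (rp j) q + lift2 (rm j) q).
  move=> q /(bounded_away_sqrt (ba b))[c c0 H]; exists c => //; apply: filterS H => z H j.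
  by apply: le_trans (H j) _; rewrite lerDl sqrtr_ge0.
exact: unif_Ck_eq (unif_CkM o (unif_CkZ o 2 xC) (unif_CkV o b1 (unif_CkD o PC MC))).
Qed.

Lemma Ffun_diff (q : 'rV[R]_2) : set2 quadrant q ->
  differentiable (lift2 (Ffun D)) q /\
  'D_(delta_mx 0 1) (lift2 (Ffun D)) q = gfun D (q 0 0) (q 0 1) / 2.
Proof.
move=> Hq; have o := open_quadrant.
have [dF EF] := unif_Ck_wsum_diff o (@weight_summable _ D) (unif_Ck_Fterm 1) Hq.
split=> //; rewrite deriveE// EF.
have [x0 s0] := Hq.
have [C HC] : exists C, forall j, `|gterm D j (q 0 0) (q 0 1)| <= C.
  apply: (@gterm_bounded _ D 0); first exact: quadrant_corner_reg.
  exact: ltW.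
rewrite mulrC /gfun -(wsumZ _ (@weight_summable _ D) HC); apply: eq_wsum => j.
rewrite -deriveE; last exact: (unif_Ck_diff _ (unif_Ck_Fterm 1) Hq).
by rewrite Fterm_ds// mulrC.
Qed.

Section AtCorner.
Variables (i : nat).
Local Notation mu := (cm D i + k_ i / 2).
Local Notation nu := (cd D i - kappa i / 2).
Local Notation H := (Hfun D i).

Lemma Hfun_diff (q : 'rV[R]_2) : set2 (corner_reg D i) q -> differentiable (lift2 H) q.
Proof. by move=> Hq; exact: Cinfty_diff (@Cinfty_Hfun _ D i) Hq. Qed.

(** The expansion at any corner i holds on the whole open quadrant and may be differentiated there;
    only the derivatives of H_i stay implicit. *)
Lemma Ffun_derive (q : 'rV[R]_2) (l : 'I_2) : set2 quadrant q ->
  'D_(delta_mx 0 l) (lift2 (Ffun D)) q =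
  mu * (0 == l)%:R + (q 0 1 * 'D_(delta_mx 0 l) (lift2 H) q + lift2 H q * (1 == l)%:R) -
  k_ i / 2 * ((2 * lift2 (rm i) q)^-1 * (2 * (q 0 0 - b i) * (0 == l)%:R + (1 == l)%:R)).
Proof.
move=> Hq; have [x0 s0] := Hq.
have m0 : 0 < (q 0 0 - b i) ^+ 2 + q 0 1 by rewrite ltr_wpDl ?sqr_ge0.
have := radius_derive l m0; rewrite -lift2_rm /=; set r := lift2 (rm i) => -[dr [gr er]].
have [g0 e0] := derive_coord2 0 l q; have [g1 e1] := derive_coord2 1 l q.
have gH : derivable (lift2 H) q (delta_mx 0 l).
  by apply: diff_derivable; apply: Hfun_diff; exact: quadrant_corner_reg.
have E : 'D_(delta_mx 0 l) (lift2 (Ffun D)) q =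
    'D_(delta_mx 0 l) (fun q : 'rV[R]_2 => mu * q 0 0 + nu + q 0 1 * lift2 H q - k_ i / 2 * r q) q.
  apply: near_eq_derive.
  have : \forall z \near q, set2 quadrant z.
    by apply: open_nbhs_nbhs; split=> //; exact: open_quadrant.
  apply: filterS => z Hz; rewrite /r /lift2 (@Ffun_decomp _ D i)//.
    exact: quadrant_corner_reg.
  by case: Hz => _ /ltW.
by rewrite E (derive_combination _ _ _ g0 e0 g1 e1 gH erefl gr er).
Qed.

Lemma Ffun_dx x s : quadrant x s ->
  dx2 (Ffun D) x s = mu + s * dx2 H x s - k_ i * (x - b i) / (2 * rm i x s).
Proof.
move=> Hq; have Hq' : set2 quadrant (row2 x s) by rewrite /set2 /= !mxE.
rewrite /dx2 Ffun_derive// eqxx /= !mulr1 !mulr0 !addr0 /lift2 row2_0 row2_1.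
congr (_ - _); have : 0 < rm i x s by rewrite sqrtr_gt0 ltr_wpDl ?sqr_ge0//; case: Hq.
by move=> r0; field; rewrite gt_eqF.
Qed.

Lemma Ffun_ds x s : quadrant x s -> ds2 (Ffun D) x s = gfun D x s / 2.
Proof.
move=> Hq; have Hq' : set2 quadrant (row2 x s) by rewrite /set2 /= !mxE.
by rewrite /ds2 (Ffun_diff Hq').2 row2_0 row2_1.
Qed.

(** For s > 0 two expressions of the s-derivative of f are compared, the termwise series and the
    expansion at the corner i. The case s = 0 is what carries the sign of g over to the boundary. *)
Lemma gfunE x s : corner_reg D i x s -> 0 <= s -> 0 < (x - b i) ^+ 2 + s ->
  gfun D x s = 2 * H x s + 2 * s * ds2 H x s - k_ i / (2 * rm i x s).
Proof.
move=> rxs s0 m0; move: s0; rewrite le_eqVlt => /predU1P[s0|s0].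
  have := gfun_axis rxs (_ : 0 <= s) m0 (esym s0); rewrite -{1}s0 => /(_ (lexx _)).
  by rewrite -s0 => ->; ring.
have Hq : quadrant x s by split=> //; case: rxs.
have Hq' : set2 quadrant (row2 x s) by rewrite /set2 /= !mxE.
have := Ffun_ds Hq; rewrite /ds2 Ffun_derive//= /lift2 row2_0 row2_1 => E.
have -> : gfun D x s = 2 * (gfun D x s / 2) by field.
have r0 : 0 < rm i x s by rewrite sqrtr_gt0.
by rewrite -E -/(lift2 H) -/(ds2 H x s); field; rewrite gt_eqF.
Qed.

End AtCorner.
End PotentialDerivatives.

(** * The integral formula for the potential *)

Section PoissonKernel.
Context {R : realType}.
Variables (x y : R).
Hypothesis y0 : 0 < y.
Local Notation mu := (@lebesgue_measure R).

Definition rho (t : R) := Num.sqrt ((x - t) ^+ 2 + y ^+ 2).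
Definition kern (t : R) := y ^+ 2 / (2 * rho t ^+ 3).

Lemma rho_gt0 t : 0 < rho t.
Proof. by rewrite sqrtr_gt0 ltr_wpDl ?sqr_ge0 ?exprn_gt0. Qed.

Lemma rho_sq t : rho t ^+ 2 = (x - t) ^+ 2 + y ^+ 2.
Proof. by rewrite sqr_sqrtr// addr_ge0 ?sqr_ge0. Qed.

Lemma kern_ge0 t : 0 <= kern t.
Proof. by rewrite divr_ge0 ?sqr_ge0// mulr_ge0// exprn_ge0// ltW// rho_gt0. Qed.

Lemma kernE t : y ^+ 2 / (2 * ((x - t) ^+ 2 + y ^+ 2) `^ (3 / 2)) = kern t.
Proof.
rewrite /kern; congr (_ / (2 * _)).
rewrite mulrC powRrM powR12_sqrt ?addr_ge0 ?sqr_ge0// -/(rho t).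
by rewrite powR_mulrn// ltW// rho_gt0.
Qed.

Lemma rho_derive (t : R) : is_derive t 1 rho ((t - x) / rho t).
Proof.
pose h (t : R) := (x - t) ^+ 2 + y ^+ 2.
have dh : is_derive t 1 h (2 * (t - x)).
  have d1 : is_derive t 1 (fun t : R => x - t) (- 1).
    have H := @is_deriveB _ _ _ (cst x) id t 1 0 1 (is_derive_cst _ _ _) (is_derive_id _ _).
    exact: (is_derive_eq H (sub0r 1)).
  have d2 := @is_deriveX _ _ (fun t : R => x - t) 2 t 1 (-1) d1.
  have d3 := @is_deriveD _ _ _ _ (cst (y ^+ 2) : R -> R) t 1 _ 0 d2 (is_derive_cst _ _ _).
  apply: (is_derive_eq d3); rewrite -![_ *: _]/(_ * _); ring.
have r0 := rho_gt0 t.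
have h0 : 0 < h t by rewrite ltr_wpDl ?sqr_ge0 ?exprn_gt0.
have dc := @is_derive1_comp _ Num.sqrt h t _ _ (is_derive1_sqrt h0) dh.
apply: (is_derive_eq dc); rewrite -/(rho t); field.
by rewrite gt_eqF.
Qed.

Lemma rho_continuous : continuous rho.
Proof.
move=> t; apply: differentiable_continuous; apply/derivable1_diffP.
by case: (rho_derive t).
Qed.

Lemma kern_continuous : continuous kern.
Proof.
move=> t; apply: cvgM; first exact: cvg_cst.
apply: cvgV; first by rewrite mulf_neq0// expf_neq0// gt_eqF// rho_gt0.
apply: cvgM; first exact: cvg_cst.
rewrite /= !exprS expr0 mulr1.
under eq_fun do rewrite !exprS expr0 mulr1.
by apply: cvgM; [|apply: cvgM]; exact: rho_continuous.
Qed.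

(** Primitives of the kernel and of its product with t - c. The second arises by parts, as (t - c)
    [prim0] - rho / 2, because rho / 2 is a primitive of [prim0]. *)
Definition prim0 (t : R) := (t - x) / (2 * rho t).
Definition prim1 (c t : R) := ((t - c) * (t - x) / rho t - rho t) / 2.

Lemma prim0_derive (t : R) : is_derive t 1 prim0 (kern t).
Proof.
have r0 := rho_gt0 t; have [gr er] := rho_derive t.
have n0 : (fun t => 2 * rho t) t != 0 by rewrite /= mulf_neq0// gt_eqF.
have d1 : is_derive t 1 (fun t : R => t - x) 1.
  have H := @is_deriveB _ _ _ id (cst x) t 1 1 0 (is_derive_id _ _) (is_derive_cst _ _ _).
  exact: (is_derive_eq H (subr0 1)).
have d2 := @is_deriveZ _ _ _ rho 2 t 1 _ (rho_derive t).
have d3 : is_derive t 1 (fun t => (2 * rho t)^-1) (- (2 * rho t)^-2 * (2 * ((t - x) / rho t))).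
  have [g2 e2] := d2; apply: DeriveDef; first exact: (@derivableV _ _ (2 \*: rho)).
  by rewrite (@deriveV _ _ (2 \*: rho) _ _ n0 g2) e2.
have dM := @is_deriveM _ _ (fun t : R => t - x) (fun t => (2 * rho t)^-1) t 1 _ _ d1 d3.
have -> : prim0 = ((fun t : R => t - x) * (fun t => (2 * rho t)^-1))%R by [].
apply: (is_derive_eq dM); rewrite -![_ *: _]/(_ * _) /kern -[y ^+ 2](addKr ((x - t) ^+ 2)) -rho_sq.
by field; rewrite gt_eqF.
Qed.

Lemma prim1_derive (c t : R) : is_derive t 1 (prim1 c) (kern t * (t - c)).
Proof.
have r0 := rho_gt0 t; have d0 := prim0_derive t; have dr := rho_derive t.
have d1 : is_derive t 1 (fun t : R => t - c) 1.
  have H := @is_deriveB _ _ _ id (cst c) t 1 1 0 (is_derive_id _ _) (is_derive_cst _ _ _).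
  exact: (is_derive_eq H (subr0 1)).
have d2 := @is_deriveM _ _ (fun t : R => t - c) prim0 t 1 _ _ d1 d0.
have d3 := @is_deriveZ _ _ _ rho 2^-1 t 1 _ dr.
have d4 := @is_deriveB _ _ _ _ _ t 1 _ _ d2 d3.
have -> : prim1 c = ((fun t : R => t - c) * prim0 - 2^-1 \*: rho)%R.
  apply/funext => z; rewrite /prim1 /prim0 !fctE /= -[_ *: _]/(_ * _).
  by field; rewrite gt_eqF// rho_gt0.
apply: (is_derive_eq d4); rewrite -![_ *: _]/(_ * _) /prim0 /=.
by field; rewrite gt_eqF.
Qed.

Lemma rhoV_cvg0 : (rho t)^-1 @[t --> +oo%R] --> (0 : R).
Proof.
apply/gtr0_cvgV0; first by near=> t; exact: rho_gt0.
apply/cvgryPge => A; near=> t.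
have tA : x + `|A| <= t by near: t; apply: nbhs_pinfty_ge; exact: num_real.
have [A0|A0] := leP A 0; first exact: le_trans A0 (ltW (rho_gt0 t)).
rewrite -(gtr0_norm A0) -sqrtr_sqr; apply: ler_wsqrtr.
apply: (@le_trans _ _ ((x - t) ^+ 2)); last by rewrite lerDl sqr_ge0.
by rewrite -[leRHS]sqrrN opprB lerXn2r ?nnegrE; move: tA; rewrite (gtr0_norm A0); lra.
Unshelve. all: by end_near. Qed.

Lemma prim0_cvg : prim0 t @[t --> +oo%R] --> (2^-1 : R).
Proof.
(* Lower bound for the squeeze: 1 - (t - x) / rho = y^2 / (rho (rho + t - x)), which is at most y^2
   / rho^2 once t > x. *)
have H : 1 - y ^+ 2 * (rho t)^-1 * (rho t)^-1 @[t --> +oo%R] --> (1 : R).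
  rewrite -[X in _ --> X](_ : 1 - y ^+ 2 * 0 * 0 = 1); last by rewrite mulr0 subr0.
  apply: cvgB; first exact: cvg_cst.
  apply: cvgM; last exact: rhoV_cvg0.
  by apply: cvgM; [exact: cvg_cst|exact: rhoV_cvg0].
have H' : (t - x) / rho t @[t --> +oo%R] --> (1 : R).
  apply: (squeeze_cvgr _ H (cvg_cst (1 : R))); near=> t.
  have r0 := rho_gt0 t; have E := rho_sq t.
  have tx : x < t by near: t; apply: nbhs_pinfty_gt; exact: num_real.
  have rx : t - x <= rho t.
    apply: le_trans (ler_norm _) _; rewrite -sqrtr_sqr; apply: ler_wsqrtr.
    by rewrite -sqrrN opprB lerDl sqr_ge0.
  apply/andP; split; last by rewrite ler_pdivrMr// mul1r.
  rewrite ler_pdivlMr// mulrBl mul1r mulfVK ?gt_eqF// lerBlDr -lerBlDl.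
  rewrite ler_pdivlMr//.
  have : y ^+ 2 = (rho t - (t - x)) * (rho t + (t - x)).
    by rewrite -[LHS](addKr ((x - t) ^+ 2)) -E; ring.
  move=> ->; apply: ler_wpM2l; lra.
rewrite -[X in _ --> X]mulr1.
rewrite (_ : prim0 = fun t => 2^-1 * ((t - x) / rho t)).
  by apply: cvgM => //; exact: cvg_cst.
by apply/funext => t; rewrite /prim0; field; rewrite gt_eqF// rho_gt0.
Unshelve. all: by end_near. Qed.

Lemma prim1_cvg c : prim1 c t @[t --> +oo%R] --> ((x - c) / 2 : R).
Proof.
rewrite -[X in _ --> X](_ : (x - c) * 2^-1 - y ^+ 2 / 2 * 0 = _); last by rewrite mulr0 subr0.
rewrite (_ : prim1 c = fun t => (x - c) * prim0 t - y ^+ 2 / 2 * (rho t)^-1).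
  apply: cvgB; apply: cvgM; [exact: cvg_cst|exact: prim0_cvg|exact: cvg_cst|exact: rhoV_cvg0].
apply/funext => t; rewrite /prim1 /prim0 -[y ^+ 2](addKr ((x - t) ^+ 2)) -rho_sq.
by field; rewrite gt_eqF// rho_gt0.
Qed.

Lemma integral_kern_half a :
  (\int[mu]_(t in `[a, +oo[) (kern t)%:E = (2^-1 - prim0 a)%:E)%E.
Proof.
have := @ge0_continuous_FTC2y _ kern prim0 a 2^-1.
rewrite -EFinB; apply.
- by move=> t _; exact: kern_ge0.
- exact: (continuous_subspaceT kern_continuous).
- exact: prim0_cvg.
- by move=> t _; case: (prim0_derive t).
- apply: cvg_at_right_filter; apply: differentiable_continuous; apply/derivable1_diffP.
  by case: (prim0_derive a).
- by move=> t _; rewrite derive1E; case: (prim0_derive t).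
Qed.

Lemma integral_kern_ramp c :
  (\int[mu]_(t in `[c, +oo[) (kern t * (t - c))%:E = ((x - c + rho c) / 2)%:E)%E.
Proof.
have -> : (x - c + rho c) / 2 = (x - c) / 2 - prim1 c c.
  by rewrite /prim1 subrr mul0r mul0r sub0r; field.
have := @ge0_continuous_FTC2y _ (fun t => kern t * (t - c)) (prim1 c) c ((x - c) / 2).
rewrite -EFinB; apply.
- by move=> t ct; rewrite mulr_ge0 ?kern_ge0// subr_ge0.
- apply: continuous_subspaceT => t; apply: cvgM; first exact: kern_continuous.
  by apply: cvgB; [exact: cvg_id|exact: cvg_cst].
- exact: prim1_cvg.
- by move=> t _; case: (prim1_derive c t).
- apply: cvg_at_right_filter; apply: differentiable_continuous; apply/derivable1_diffP.
  by case: (prim1_derive c c).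
- by move=> t _; rewrite derive1E; case: (prim1_derive c t).
Qed.

End PoissonKernel.

(** * Integrals of clamps against the kernel *)

Section KernelIntegrals.
Context {R : realType}.
Variables (x y : R).
Hypothesis y0 : 0 < y.
Local Notation mu := (@lebesgue_measure R).
Local Notation K := (kern x y).

Lemma measurable_kern : measurable_fun setT K.
Proof. by apply: continuous_measurable_fun; exact: kern_continuous. Qed.

Lemma kern_opp t : K (- t) = kern (- x) y t.
Proof. by rewrite /kern /rho -(sqrrN (x - - t)) opprD opprK. Qed.

(** The line is cut at 0 and the left half reflected, which changes x into - x; the two values of
    [prim0] at 0 then cancel. *)
Lemma integral_kern : (\int[mu]_t (K t)%:E = 1)%E.
Proof.
have mposnums : measurable [set t : R | 0 <= t] by rewrite -set_itvcy.
rewrite -(setUv [set t : R | 0 <= t]) ge0_integral_setU//=; last 4 first.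
- exact: measurableC.
- by rewrite setUv; apply/measurable_EFinP; exact: measurable_kern.
- by move=> t _; rewrite lee_fin kern_ge0.
- exact/disj_setPCl.
rewrite -set_itvcy// setCitvr.
rewrite integral_itv_bndo_bndc; last first.
  by apply/measurable_EFinP/measurable_funTS; exact: measurable_kern.
rewrite -{2}oppr0 ge0_integration_by_substitutionNy//; last first.
- by move=> t _; exact: kern_ge0.
- by apply: continuous_subspaceT; exact: kern_continuous.
have -> : (\int[mu]_(t in `[0%R, +oo[) ((K \o -%R) t)%:E =
    \int[mu]_(t in `[0%R, +oo[) (kern (- x) y t)%:E)%E.
  by apply: eq_integral => t _; rewrite /= kern_opp.
rewrite !integral_kern_half// -EFinD; congr EFin.
rewrite /prim0 /rho !subr0 sqrrN !sub0r opprK.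
have r0 : 0 < rho x y 0 by exact: rho_gt0.
rewrite /rho subr0 in r0; field.
by rewrite gt_eqF.
Qed.

Lemma integrable_kern : mu.-integrable setT (EFin \o K).
Proof.
apply/integrableP; split; first by apply/measurable_EFinP; exact: measurable_kern.
under eq_integral do rewrite /= ger0_norm ?kern_ge0//.
by rewrite integral_kern ltry.
Qed.

Definition ramp (c t : R) := Num.max 0 (t - c).

Lemma ramp_continuous c : continuous (ramp c).
Proof.
move=> t; apply: (@continuous_max _ _ (cst 0) (fun t => t - c)); first exact: cvg_cst.
by apply: cvgB; [exact: cvg_id|exact: cvg_cst].
Qed.

Lemma measurable_kern_ramp c : measurable_fun setT (fun t => K t * ramp c t).
Proof.
apply: measurable_funM; first exact: measurable_kern.
by apply: continuous_measurable_fun; exact: ramp_continuous.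
Qed.

Lemma integral_kern_ramp_T c :
  (\int[mu]_t (K t * ramp c t)%:E = ((x - c + rho x y c) / 2)%:E)%E.
Proof.
rewrite -integral_kern_ramp// [RHS]integral_mkcond.
apply: eq_integral => t _; rewrite patchE; case: ifPn => [|].
  rewrite inE /= in_itv /= andbT => ct.
  by rewrite /ramp max_r// subr_ge0.
rewrite notin_setE /= in_itv /= andbT => /negP; rewrite -ltNge => tc.
by rewrite /ramp max_l ?mulr0// subr_le0 ltW.
Qed.

Lemma integrable_kern_ramp c : mu.-integrable setT (EFin \o (fun t => K t * ramp c t)).
Proof.
apply/integrableP; split; first by apply/measurable_EFinP; exact: measurable_kern_ramp.
under eq_integral.
  move=> t _; rewrite /= ger0_norm; last by rewrite mulr_ge0 ?kern_ge0// le_max lexx.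
  over.
by rewrite integral_kern_ramp_T ltry.
Qed.

(** The clamp of t - a to [- b, b] when b > 0, as a difference of ramps: each ramp is integrable
    against the kernel, which decays like the inverse cube of t. *)
Definition clampf (a b t : R) := ramp (a - b) t - ramp (a + b) t - b.

Lemma kern_clampE a b : (fun t => K t * clampf a b t) =
  (fun t => K t * ramp (a - b) t - K t * ramp (a + b) t - b * K t).
Proof. by apply/funext => t; rewrite /clampf; ring. Qed.

Let iZ b : mu.-integrable setT (EFin \o (fun t => b * K t)).
Proof.
have := integrableZl measurableT b integrable_kern.
by apply: eq_integrable.
Qed.

Let iB a b : mu.-integrable setT (EFin \o (fun t => K t * ramp (a - b) t - K t * ramp (a + b) t)).
Proof.
have := integrableB measurableT (integrable_kern_ramp (a - b)) (integrable_kern_ramp (a + b)).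
by apply: eq_integrable.
Qed.

Lemma integrable_kern_clamp a b : mu.-integrable setT (EFin \o (fun t => K t * clampf a b t)).
Proof.
rewrite kern_clampE.
have := integrableB measurableT (iB a b) (iZ b).
by apply: eq_integrable.
Qed.

(** The affine parts of the two ramp integrals differ by b, which the constant - b cancels because
    the kernel has mass 1. *)
Lemma Rintegral_kern_clamp a b :
  \int[mu]_t (K t * clampf a b t) = (rho x y (a - b) - rho x y (a + b)) / 2.
Proof.
rewrite kern_clampE RintegralB//= RintegralB//=; [|exact: integrable_kern_ramp..].
rewrite RintegralZl//; last exact: integrable_kern.
rewrite /Rintegral !integral_kern_ramp_T integral_kern /=; by field.
Qed.

Variables (a : R) (k b del : nat -> R) (u : R -> R).
Hypothesis du : forall n t, `|u t - \sum_(i < n) k i * clampf a (b i) t| <= del n.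
Hypothesis del0 : del @ \oo --> 0.

Definition clamp_sum n t := \sum_(i < n) k i * clampf a (b i) t.

Lemma clampf_continuous c d : continuous (clampf c d).
Proof.
move=> t; apply: cvgB; last exact: cvg_cst.
by apply: cvgB; exact: ramp_continuous.
Qed.

Lemma clamp_sumS n t : clamp_sum n.+1 t = clamp_sum n t + k n * clampf a (b n) t.
Proof. by rewrite /clamp_sum big_ord_recr. Qed.

Lemma measurable_clamp_sum n : measurable_fun setT (clamp_sum n).
Proof.
elim: n => [|n IH].
  rewrite (_ : clamp_sum 0 = cst 0); first exact: measurable_cst.
  by apply/funext => t; rewrite /clamp_sum big_ord0.
rewrite (_ : clamp_sum n.+1 = fun t => clamp_sum n t + k n * clampf a (b n) t); last first.
  by apply/funext => t; exact: clamp_sumS.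
apply: measurable_funD => //; apply: measurable_funM; first exact: measurable_cst.
by apply: continuous_measurable_fun; exact: clampf_continuous.
Qed.

Lemma integral_clamp_sum n : mu.-integrable setT (EFin \o (fun t => K t * clamp_sum n t)) /\
  \int[mu]_t (K t * clamp_sum n t) =
    \sum_(i < n) k i * ((rho x y (a - b i) - rho x y (a + b i)) / 2).
Proof.
elim: n => [|n [IH1 IH2]].
  have E : (fun t => K t * clamp_sum 0 t) = cst 0.
    by apply/funext => t; rewrite /clamp_sum big_ord0 mulr0.
  rewrite E big_ord0; split; first exact: (@integrable0 _ _ _ mu setT).
  by rewrite /Rintegral integral0.
have E : (fun t => K t * clamp_sum n.+1 t) =
    (fun t => K t * clamp_sum n t + k n * (K t * clampf a (b n) t)).
  by apply/funext => t; rewrite clamp_sumS; ring.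
have iC : mu.-integrable setT (EFin \o (fun t => k n * (K t * clampf a (b n) t))).
  have := integrableZl measurableT (k n) (integrable_kern_clamp a (b n)).
  by apply: eq_integrable.
rewrite E; split.
  have := integrableD measurableT IH1 iC; by apply: eq_integrable.
rewrite RintegralD//= IH2 RintegralZl//; last exact: integrable_kern_clamp.
by rewrite Rintegral_kern_clamp big_ord_recr.
Qed.

Lemma measurable_limit : measurable_fun setT u.
Proof.
apply: (measurable_fun_cvg measurable_clamp_sum) => t _.
apply/cvgrPdist_le => eps e0.
have /cvgrPdist_le /(_ _ e0) := del0; apply: filterS => n /=.
rewrite sub0r normrN => H.
by apply: le_trans (du n t) _; apply: le_trans H; exact: ler_norm.
Qed.

(** The kernel is a probability density, so a uniform error [del n] in u causes an error of at most
    [del n] in the integral; the measurability of u comes from the same approximation. *)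
Lemma Rintegral_kern_limit :
  (fun n => \sum_(i < n) k i * ((rho x y (a - b i) - rho x y (a + b i)) / 2)) @ \oo -->
  \int[mu]_t (K t * u t).
Proof.
have Kd n t : `|K t * (u t - clamp_sum n t)| <= del n * K t.
  by rewrite normrM [`|K t|]ger0_norm ?kern_ge0// mulrC ler_wpM2r ?kern_ge0// /clamp_sum.
have mu_ n : measurable_fun setT (fun t => K t * (u t - clamp_sum n t)).
  apply: measurable_funM; first exact: measurable_kern.
  by apply: measurable_funB; [exact: measurable_limit|exact: measurable_clamp_sum].
have d0 n : 0 <= del n by apply: le_trans (du n 0).
have iD n : mu.-integrable setT (EFin \o (fun t => K t * (u t - clamp_sum n t))).
  apply: (le_integrable measurableT _ _ (iZ (del n))).
    by apply/measurable_EFinP; exact: mu_.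
  move=> t _; rewrite /= lee_fin; apply: le_trans (Kd n t) _; exact: ler_norm.
have iU : mu.-integrable setT (EFin \o (fun t => K t * u t)).
  have := integrableD measurableT (iD 0%N) (integral_clamp_sum 0).1.
  apply: eq_integrable => // t _.
  by rewrite /= -EFinD -mulrDr subrK.
apply/cvgrPdist_le => eps e0.
have /cvgrPdist_le /(_ _ e0) := del0; apply: filterS => n /=.
rewrite sub0r normrN => H.
rewrite -(integral_clamp_sum n).2 -RintegralB//; last exact: (integral_clamp_sum n).1.
have -> : \int[mu]_t (K t * u t - K t * clamp_sum n t) =
    \int[mu]_t (K t * (u t - clamp_sum n t)).
  by apply: eq_Rintegral => t _; rewrite mulrBr.
apply: le_trans (le_normr_Rintegral _ (iD n)) _ => //.
apply: (@le_trans _ _ (\int[mu]_t (del n * K t))).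
  apply: le_Rintegral => //.
  have := integrable_abse (iD n); by apply: eq_integrable.
rewrite RintegralZl//; last exact: integrable_kern.
rewrite /Rintegral integral_kern /= mulr1; apply: le_trans H; exact: ler_norm.
Qed.

End KernelIntegrals.

(** * The envelope as a sum of clamps *)

Section EnvelopeExpansion.
Context {R : realType}.
Variables (e : nat -> int) (alpha : R).

Definition represents (D : cusp_data R) := forall j,
  cm D j = (mn e j).1%:~R /\ cd D j = (mn e j).1%:~R * alpha - (mn e j).2%:~R.

Lemma cusp_data_exists : (forall j, (1 <= j)%N -> 3 <= e j) ->
  (fun k => ratr (cfrac e k) : R) @ \oo --> alpha -> exists D, represents D.
Proof.
move=> e3 ca.
pose M j : R := (mn e j).1%:~R.
pose d j : R := (mn e j).1%:~R * alpha - (mn e j).2%:~R.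
have ME j : M j = (linrec e 0 1 j)%:~R by rewrite /M mnE.
have dE j : d j = (linrec e 0 1 j)%:~R * alpha - (linrec e (-1) 0 j)%:~R by rewrite /d mnE.
have dlt j : d j.+1 < d j by rewrite !dE; exact: gap_lt.
have dg j : d j.+1 - d j.+2 < d j - d j.+1 by rewrite !dE; exact: gap_diff_lt.
have Mlt j : M j < M j.+1 by rewrite !ME ltr_int den_lt.
have Mle j : M j.+1 - M j <= M j.+2 - M j.+1.
  by rewrite !ME -!intrB ler_int den_diff_le.
have d0 j : 0 < d j by rewrite dE; exact: gap_gt0.
have dc : d @ \oo --> 0.
  rewrite (_ : d = fun j => (linrec e 0 1 j)%:~R * alpha - (linrec e (-1) 0 j)%:~R).
    exact: gap_cvg0.
  by apply/funext.
have M0 : M 0 = 0 by [].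
have d00 : d 0 = 1 by rewrite /d /= mul0r sub0r mulrN1z opprK.
have det j : M j.+1 * d j - M j * d j.+1 = 1.
  have H : (linrec e 0 1 j * linrec e (-1) 0 j.+1 -
      linrec e 0 1 j.+1 * linrec e (-1) 0 j)%:~R = 1 :> R by rewrite den_det.
  rewrite intrB !intrM in H; apply: etrans H; rewrite !dE !ME.
  move: (linrec e 0 1 j)%:~R (linrec e 0 1 j.+1)%:~R (linrec e (-1) 0 j)%:~R
    (linrec e (-1) 0 j.+1)%:~R => m0 m1 n0 n1. ring.
(* The corners decrease because the differences of gaps in the numerators strictly decrease, while
   the denominators do not. *)
have cl j : (d j.+1 - d j.+2) / (M j.+2 - M j.+1) < (d j - d j.+1) / (M j.+1 - M j).
  have := Mle j; have := dg j; have := dlt j; have := dlt j.+1; have := Mlt j; have := Mlt j.+1.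
  move: (M j) (M j.+1) (M j.+2) (d j) (d j.+1) (d j.+2) => m1 m2 m3 d1 d2 d3 *.
  rewrite ltr_pdivrMr ?subr_gt0// mulrAC ltr_pdivlMr ?subr_gt0//; nra.
by exists (CuspData M0 d00 Mlt d0 dlt dc det cl).
Qed.

Variable D : cusp_data R.
Hypothesis rD : represents D.
Local Notation b := (cpos D).

Lemma cornerE j : corner e j = alpha + b j.
Proof.
have [m1 d1] := rD j; have [m2 d2] := rD j.+1; have s0 := slope_neq0 D j.
have s0' : ((mn e j.+1).1 - (mn e j).1)%:~R != 0 :> R by rewrite intrB -m1 -m2.
rewrite /corner /cpos /weight /slope d1 d2 m1 m2 -!intrB.
apply: (canLR (mulfK s0')); rewrite mulrDl divfK// !intrB; ring.
Qed.

(** The b_j tend to 0, so there is a least j with b_j <= t. *)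
Lemma edge_cover t : 0 < t -> exists j, b j <= t /\ (if j is j'.+1 then t <= b j' else True).
Proof.
move=> t0.
have ex : exists j, b j <= t.
  have /cvgrPdist_le /(_ _ t0) [N _ HN] := cpos_cvg0 D.
  exists N; have := HN N (leqnn N) => /=.
  by rewrite sub0r normrN gtr0_norm ?cpos_gt0.
case: (ex_minnP ex) => j bj jm; exists j; split=> //.
case: j bj jm => // j bj jm; rewrite leNgt; apply/negP => /ltW /jm.
by rewrite ltnn.
Qed.

Lemma corner_value j : cm D j * b j + cd D j = cm D j.+1 * b j + cd D j.+1.
Proof. by have := weightE D j; rewrite /weight /slope => E; lra. Qed.

Lemma edgeE j t : edge e j (alpha + t) <->
  b j <= t /\ (if j is j'.+1 then t <= b j' else True).
Proof.
rewrite /edge /= cornerE lerD2l; case: j => [|j] /=; first by rewrite leey; split=> -[].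
by rewrite cornerE lee_fin lerD2l.
Qed.

Lemma open_edgeE j t : open_edge e j (alpha + t) <->
  b j < t /\ (if j is j'.+1 then t < b j' else True).
Proof.
rewrite /open_edge /= cornerE ltrD2l; case: j => [|j] /=; first by rewrite ltry; split=> -[].
by rewrite cornerE lte_fin ltrD2l.
Qed.

(** Two different edges meet at most in a common corner, where their affine functions agree; hence
    the value picked by [xget] is unique. *)
Lemma envelopeE j t : 0 < t -> b j <= t -> (if j is j'.+1 then t <= b j' else True) ->
  envelope e alpha (alpha + t) = cm D j * t + cd D j.
Proof.
move=> t0 bj bj'; rewrite /envelope leNgt ltrDl t0 /=.
have val i : (mn e i).1%:~R * (alpha + t) - (mn e i).2%:~R = cm D i * t + cd D i.
  by have [-> ->] := rD i; ring.
have uniq i : b i <= t -> (if i is i'.+1 then t <= b i' else True) ->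
    cm D i * t + cd D i = cm D j * t + cd D j.
  wlog ij : i j bj bj' / (i <= j)%N.
    by move=> W; case: (leqP i j) => [|/ltnW] ij H1 H2; [|apply/esym]; apply: W.
  move=> H1 H2; move: ij; rewrite leq_eqVlt => /predU1P[->//|ij].
  have E : j = i.+1.
    apply/eqP; rewrite eqn_leq ij andbT leqNgt; apply/negP => ij2.
    move: bj'; case: (j) ij2 => // j' ij' tb.
    by have := cpos_ltn D (ij' : (i < j')%N); lra.
  subst j; have -> : t = b i by apply/le_anti; rewrite H1 bj'.
  exact: corner_value.
apply: xget_unique.
  by exists j; split; [apply/edgeE|rewrite val].
by move=> v [i [/edgeE[H1 H2] ->]]; rewrite val; exact: uniq.
Qed.

Lemma clampfE (c s t : R) : 0 < c -> clampf s c (s + t) =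
  if t <= - c then - c else if t <= c then t else c.
Proof.
move=> c0; rewrite /clampf /ramp.
have -> : s + t - (s - c) = t + c by ring.
have -> : s + t - (s + c) = t - c by ring.
case: leP => tc; first by rewrite !max_l; lra.
case: leP => tc'; first by rewrite max_r ?max_l; lra.
by rewrite !max_r; lra.
Qed.

(** Let t lie on the edge j. If n <= j, all n clamps are still linear, with sum m_n t, and the error
    lies between 0 and [cd D n]. If n > j, the clamps from j on are saturated and the error is
    exactly [cd D n]. *)
Lemma envelope_bound n t : 0 < t ->
  `|envelope e alpha (alpha + t) - \sum_(i < n) slope D i * clampf alpha (b i) (alpha + t)|
    <= cd D n.
Proof.
move=> t0; have [j [bj bj']] := edge_cover t0.
have bj'' i : (i < j)%N -> t <= b i.
  case: j bj bj' => // j _ tb; rewrite ltnS => ij; exact: le_trans tb (cpos_leq D ij).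
have bi i : (j <= i)%N -> b i <= t by move=> ji; exact: le_trans (cpos_leq D ji) bj.
have lo i : (i < j)%N -> slope D i * clampf alpha (b i) (alpha + t) = slope D i * t.
  move=> ij; rewrite clampfE ?cpos_gt0//; have := cpos_gt0 D i; have := bj'' i ij => H1 H2.
  by rewrite leNgt (_ : - b i < t) ?H1//; lra.
have hi i : (j <= i)%N -> slope D i * clampf alpha (b i) (alpha + t) = weight D i.
  move=> ji; rewrite clampfE ?cpos_gt0// weightE; have := cpos_gt0 D i; have := bi i ji => H1 H2.
  rewrite leNgt (_ : - b i < t) /=; last lra.
  by case: leP => // H3; congr (_ * _); lra.
rewrite (envelopeE t0 bj bj'); case: (leqP n j) => nj.
  rewrite (eq_bigr (fun i : 'I_n => slope D i * t)); last first.
    by move=> i _; apply: lo; exact: leq_trans nj.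
  rewrite -mulr_suml sum_slope.
  have H m : (n + m <= j)%N -> 0 <= cm D (n + m) * t - cm D n * t <= cd D n - cd D (n + m)%N.
    elim: m => [|m IH]; first by rewrite addn0 !subrr lexx.
    rewrite addnS => nm; have /andP[A B] := IH (ltnW nm).
    have := weightE D (n + m); have := bj'' _ nm; have := slope_gt0 D (n + m).
    move=> s0 tb W.
    have P1 : 0 <= slope D (n + m) * t by rewrite mulr_ge0 ?ltW.
    have P2 : slope D (n + m) * t <= weight D (n + m) by rewrite W; apply: ler_wpM2l tb; exact: ltW.
    rewrite /weight /slope in P1 P2.
    apply/andP; split; lra.
  have := H (j - n)%N; rewrite subnKC// => /(_ (leqnn j)) /andP[A B].
  have dj := cd_gt0 D j; rewrite ger0_norm; lra.
have T1 : \sum_(0 <= i < j) slope D i * clampf alpha (b i) (alpha + t) = cm D j * t.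
  rewrite (eq_big_nat _ _ (F2 := fun i => slope D i * t)); last first.
    by move=> i /andP[_ ij]; exact: lo.
  by rewrite big_mkord -mulr_suml sum_slope.
have T2 : \sum_(j <= i < n) slope D i * clampf alpha (b i) (alpha + t) = cd D j - cd D n.
  rewrite (eq_big_nat _ _ (F2 := weight D)); last first.
    by move=> i /andP[ji _]; exact: hi.
  by rewrite -{1}[j]add0n big_addn big_mkord sum_weight_nat subnK// ltnW.
rewrite -(big_mkord xpredT (fun i => slope D i * clampf alpha (b i) (alpha + t))).
rewrite (@big_cat_nat _ _ _ j)//=; last exact: ltnW.
rewrite T1 T2.
rewrite (_ : _ - _ = cd D n); last ring.
by rewrite ger0_norm// ltW// cd_gt0.
Qed.

(** Both u and the clamps are odd about alpha, which reduces t < alpha to t > alpha; at alpha both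
    vanish. *)
Lemma u_bound n t : `|u_alpha e alpha t -
  \sum_(i < n) slope D i * clampf alpha (b i) t| <= cd D n.
Proof.
rewrite -[t](subrKC alpha); move: (t - alpha) => {}t.
have env0 s : s <= 0 -> envelope e alpha (alpha + s) = 0.
  by move=> s0; rewrite /envelope gerDl s0.
rewrite /u_alpha (_ : 2 * alpha - (alpha + t) = alpha + - t); last ring.
case: (ltrgtP t 0) => t0.
- rewrite (env0 t (ltW t0)) sub0r.
  have nt0 : 0 < - t by rewrite oppr_gt0.
  have : \sum_(i < n) slope D i * clampf alpha (b i) (alpha + - t) =
    - \sum_(i < n) slope D i * clampf alpha (b i) (alpha + t).
    rewrite -sumrN; apply: eq_bigr => i _.
    rewrite -mulrN; congr (_ * _); rewrite !clampfE ?cpos_gt0//; have := cpos_gt0 D i => b0.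
    by repeat (case: leP => ?); lra.
  have := envelope_bound n nt0; rewrite -normrN opprB => + E; rewrite E.
  move: (envelope _ _ _) (\sum_(_ < _) _) => p q; by rewrite [- p - q]addrC.
- have nt0 : - t <= 0 by rewrite oppr_le0 ltW.
  by rewrite (env0 _ nt0) subr0; exact: envelope_bound.
- rewrite t0 oppr0 env0// subrr sub0r normrN big1; first by rewrite normr0 ltW// cd_gt0.
  move=> i _; rewrite clampfE ?cpos_gt0//; have := cpos_gt0 D i => b0.
  by rewrite leNgt oppr_lt0 b0 /= ltW// mulr0.
Qed.

Lemma f_alphaE x y : alpha < x -> 0 < y ->
  f_alpha e alpha x y = Ffun D (x - alpha) (y ^+ 2).
Proof.
move=> xa y0; rewrite /f_alpha.
under eq_Rintegral do rewrite kernE//.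
have H := @Rintegral_kern_limit _ x y y0 _ _ _ _ _ u_bound (@cd_cvg _ D).
have Q : quadrant (x - alpha) (y ^+ 2) by split; rewrite ?subr_gt0 ?exprn_gt0.
rewrite -(cvg_lim _ H)//; congr (limn _); apply/funext => n.
rewrite /series /= big_mkord; apply: eq_bigr => i _.
rewrite (@Fterm_half _ D 0)//; last 2 first.
- exact: quadrant_corner_reg.
- by rewrite exprn_ge0// ltW.
rewrite /rho /rp /rm -mulrA [2^-1 * _]mulrC; congr (_ * ((_ - _) / _)).
  by congr (Num.sqrt (_ ^+ 2 + _)); ring.
by congr (Num.sqrt (_ ^+ 2 + _)); ring.
Qed.

End EnvelopeExpansion.

(** * The metric in edge and corner charts *)

Section MetricFunctions.
Context {R : realType}.

(** The definitions of f_x and f_y differentiate one-variable slices, whereas the calculus above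
    lives on row vectors. *)
Lemma slice_derive (h : R -> R -> R) (x s : R) :
  differentiable (lift2 h) (row2 x s) ->
  is_derive x 1 (h ^~ s) (dx2 h x s) /\ is_derive s 1 (h x) (ds2 h x s).
Proof.
move=> dh.
have H (l : 'I_2) (t : R) (k : R -> R) :
   (forall z, k (z + t) = lift2 h (z *: delta_mx 0 l + row2 x s)) ->
   is_derive t 1 k ('D_(delta_mx 0 l) (lift2 h) (row2 x s)).
  move=> E.
  have Eq : (fun z : R => z^-1 *: ((k \o shift t) (z *: 1) - k t)) =
     (fun z : R => z^-1 *: ((lift2 h \o shift (row2 x s)) (z *: delta_mx 0 l) -
       lift2 h (row2 x s))).
    apply/funext => z; rewrite /= [z *: 1]mulr1 E.
    by have := E 0; rewrite add0r scale0r add0r => ->.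
  split; last by rewrite /derive Eq.
  by rewrite /derivable Eq; exact: diff_derivable.
split; apply: H => z; rewrite /lift2 !mxE /=.
  by rewrite mulr1 mulr0 add0r.
by rewrite mulr0 add0r mulr1.
Qed.

Variables (e : nat -> int) (alpha : R) (D : cusp_data R).
Hypothesis rD : represents e alpha D.

Section At.
Variables (x y : R).
Hypotheses (xa : alpha < x) (y0 : 0 < y).
Let xi := x - alpha.
Let s := y ^+ 2.

Lemma quadrant_alpha : quadrant xi s.
Proof. by split; rewrite ?subr_gt0 ?exprn_gt0. Qed.

Let dF : differentiable (lift2 (Ffun D)) (row2 xi s).
Proof.
have H : set2 quadrant (row2 xi s) by rewrite /set2 /= row2_0 row2_1; exact: quadrant_alpha.
by have [] := Ffun_diff D H.
Qed.

Lemma fx_alphaE : fx_alpha e alpha x y = dx2 (Ffun D) xi s.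
Proof.
rewrite /fx_alpha derive1E.
have [d1 _] := slice_derive dF.
pose k (t : R) := Ffun D (t - alpha) s.
have -> : 'D_1 (fun t => f_alpha e alpha t y) x = 'D_1 k x.
  apply: near_eq_derive; near=> t; rewrite (f_alphaE rD)//.
  by near: t; exact: lt_nbhsr.
have dsub : is_derive x 1 (fun t : R => t - alpha) 1.
  have H := @is_deriveB _ _ _ id (cst alpha) x 1 1 0 (is_derive_id _ _) (is_derive_cst _ _ _).
  exact: (is_derive_eq H (subr0 1)).
have H := @is_derive1_comp _ (fun u => Ffun D u s) (fun t : R => t - alpha) x _ _ d1 dsub.
have [_ E] := H; apply: etrans E _; exact: mulr1.
Unshelve. all: by end_near. Qed.

Lemma fy_alphaE : fy_alpha e alpha x y = y * gfun D xi s.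
Proof.
rewrite /fy_alpha derive1E.
have [_ d2] := slice_derive dF.
pose k (t : R) := Ffun D xi (t ^+ 2).
have -> : 'D_1 (fun t => f_alpha e alpha x t) y = 'D_1 k y.
  apply: near_eq_derive; near=> t; rewrite (f_alphaE rD)//.
  by near: t; exact: lt_nbhsr.
have dsq := @is_deriveX _ _ id 2 y 1 1 (is_derive_id _ _).
have H := @is_derive1_comp _ (fun u => Ffun D xi u) (id ^+ 2 : R -> R) y _ _ d2 dsq.
have [_ E] := H; apply: etrans E _.
rewrite (Ffun_ds D quadrant_alpha) -[_ *: _]/(_ * _) /=.
by field.
Unshelve. all: by end_near. Qed.

End At.

(** This is w with f_y = y g and s = y^2, which removes the division by y. *)
Definition wI (f fx g s : R) := fx ^+ 2 + s * g ^+ 2 - f * g.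

Lemma w_alphaE x y : alpha < x -> 0 < y ->
  w_alpha e alpha x y = wI (Ffun D (x - alpha) (y ^+ 2)) (dx2 (Ffun D) (x - alpha) (y ^+ 2))
    (gfun D (x - alpha) (y ^+ 2)) (y ^+ 2).
Proof.
move=> xa y0; rewrite /w_alpha fx_alphaE// fy_alphaE// (f_alphaE rD)// /wI.
by field; rewrite gt_eqF.
Qed.

Lemma wI_gt0 f fx g s : 0 <= s -> 0 < f -> g < 0 -> 0 < wI f fx g s.
Proof. by move=> s0 f0 g0; rewrite /wI; have := sqr_ge0 fx; have := sqr_ge0 g; nra. Qed.

Section Intrinsic.
Variable i : nat.
Local Notation b := (cpos D i).
Local Notation k := (slope D i).

(** [fI], [fxI] and [gI] are f, f_x and f_y / y as given by the expansion at the corner i. On the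
    axis, where the integral for f degenerates, they define the boundary values. *)
Definition fI x s := (cm D i + k / 2) * x + (cd D i - weight D i / 2) +
  s * Hfun D i x s - k / 2 * rm D i x s.
Definition fxI x s := cm D i + k / 2 + s * dx2 (Hfun D i) x s - k * (x - b) / (2 * rm D i x s).
Definition gI x s := 2 * Hfun D i x s + 2 * s * ds2 (Hfun D i) x s - k / (2 * rm D i x s).

Lemma fI_quadrant x s : quadrant x s -> fI x s = Ffun D x s.
Proof.
move=> H; rewrite /fI -Ffun_decomp//; first exact: quadrant_corner_reg.
by case: H => _ /ltW.
Qed.

Lemma fxI_quadrant x s : quadrant x s -> fxI x s = dx2 (Ffun D) x s.
Proof. by move=> H; rewrite (@Ffun_dx _ D i). Qed.

Lemma gIE x s : corner_reg D i x s -> 0 <= s -> 0 < (x - b) ^+ 2 + s -> gI x s = gfun D x s.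
Proof. by move=> *; rewrite (@gfunE _ D i). Qed.

Lemma rm_axis x : rm D i x 0 = `|x - b|.
Proof. by rewrite /rm addr0 sqrtr_sqr. Qed.

(** On the axis f restricts to the affine pieces of the envelope on both sides of the corner, which
    gives its positivity there. *)
Lemma fI_axis_gt x : b <= x -> fI x 0 = cm D i * x + cd D i.
Proof.
move=> xb; have W := weightE D i.
by rewrite /fI rm_axis ger0_norm ?subr_ge0// mul0r addr0 W; field.
Qed.

Lemma fI_axis_lt x : x <= b -> fI x 0 = cm D i.+1 * x + cd D i.+1.
Proof.
move=> xb; have W := weightE D i.
have -> : cd D i.+1 = cd D i - weight D i by rewrite /weight; ring.
have -> : cm D i.+1 = cm D i + k by rewrite /slope; ring.
by rewrite /fI rm_axis ler0_norm ?subr_le0// mul0r addr0 W; field.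
Qed.

Lemma fI_gt0 x s : corner_reg D i x s -> 0 <= s -> 0 < fI x s.
Proof.
move=> H; have [x0 _] := H; rewrite le_eqVlt => /predU1P[<-|s0].
  have [xb|xb] := leP b x.
    by rewrite fI_axis_gt// ltr_wpDl ?cd_gt0// mulr_ge0 ?cm_ge0// ltW.
  by rewrite fI_axis_lt 1?ltW// ltr_wpDl ?cd_gt0// mulr_ge0 ?cm_ge0// ltW.
by rewrite fI_quadrant// Ffun_gt0// ltW.
Qed.

Lemma fxI_axis_gt x : b < x -> fxI x 0 = cm D i.
Proof.
move=> xb; rewrite /fxI rm_axis gtr0_norm ?subr_gt0//; field.
by rewrite subr_eq0 gt_eqF.
Qed.

Lemma fxI_axis_lt x : x < b -> fxI x 0 = cm D i.+1.
Proof.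
move=> xb; rewrite /fxI rm_axis ltr0_norm ?subr_lt0//.
have -> : cm D i.+1 = cm D i + k by rewrite /slope; ring.
have n0 : b - x != 0 by rewrite subr_eq0 gt_eqF.
have n1 : x - b != 0 by rewrite subr_eq0 lt_eqF.
by rewrite opprB; field; rewrite ?n0 ?n1.
Qed.

Lemma w_gt0 x s : corner_reg D i x s -> 0 <= s -> 0 < (x - b) ^+ 2 + s ->
  0 < wI (fI x s) (fxI x s) (gI x s) s.
Proof.
move=> H s0 r0; apply: wI_gt0 => //; first exact: fI_gt0.
by rewrite gIE//; exact: gfun_lt0 H s0 r0.
Qed.

End Intrinsic.
End MetricFunctions.

(** * Quadratic forms and local expressions of the metric *)

Section QuadraticForms.
Context {R : realType}.
Implicit Types (G : 'M[R]_4) (a b v : 'rV[R]_4).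

Definition qf G v : R := (v *m G *m v^T) 0 0.
Definition pr a v : R := (v *m a^T) 0 0.
Definition sym_form a b : 'M[R]_4 := a^T *m b + b^T *m a.

Lemma qfD G G' v : qf (G + G') v = qf G v + qf G' v.
Proof. by rewrite /qf mulmxDr mulmxDl mxE. Qed.

Lemma qfZ c G v : qf (c *: G) v = c * qf G v.
Proof. by rewrite /qf -scalemxAr -scalemxAl mxE. Qed.

Lemma qf_tensor a b v : qf (a^T *m b) v = pr a v * pr b v.
Proof.
rewrite /qf mulmxA -mulmxA [LHS]mxE big_ord1; congr (_ * _).
by have -> : b *m v^T = (v *m b^T)^T by [rewrite trmx_mul trmxK]; rewrite mxE.
Qed.

Lemma qf_sq a v : qf (sq_form a) v = pr a v ^+ 2.
Proof. by rewrite /sq_form qf_tensor expr2. Qed.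

Lemma qf_sym a b v : qf (sym_form a b) v = 2 * pr a v * pr b v.
Proof. by rewrite /sym_form qfD !qf_tensor; ring. Qed.

Lemma sum4 (F : 'I_4 -> R) : \sum_i F i = F 0 + F 1 + F 2 + F 3.
Proof.
rewrite !big_ord_recl big_ord0 addr0 !addrA.
by congr (_ + _ + _ + _); congr F; apply: val_inj.
Qed.

Lemma row4E (a b c d : R) (i : 'I_4) : row4 a b c d 0 i = [:: a; b; c; d]`_i.
Proof. by rewrite mxE. Qed.

Lemma pr_row4 c0 c1 c2 c3 v :
  pr (row4 c0 c1 c2 c3) v = c0 * v 0 0 + c1 * v 0 1 + c2 * v 0 2 + c3 * v 0 3.
Proof.
rewrite /pr mxE sum4 /=; rewrite !mxE /=; ring.
Qed.

Lemma sq_form_sym a : (sq_form a)^T = sq_form a.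
Proof. by rewrite /sq_form trmx_mul trmxK. Qed.

Lemma sym_form_sym a b : (sym_form a b)^T = sym_form a b.
Proof. by rewrite /sym_form raddfD /= !trmx_mul !trmxK addrC. Qed.

Lemma trmxD_sym G G' : G^T = G -> G'^T = G' -> (G + G')^T = G + G'.
Proof. by move=> {2}<- {2}<-; rewrite raddfD. Qed.

Lemma trmxZ_sym c G : G^T = G -> (c *: G)^T = c *: G.
Proof. by move=> {2}<-; rewrite linearZ. Qed.

(** Polarisation: the law between symmetric matrices may be checked on quadratic forms, where it
    becomes an identity between scalars. *)
Lemma eq_of_qf G G' : G^T = G -> G'^T = G' -> (forall v, qf G v = qf G' v) -> G = G'.
Proof.
move=> sG sG' H; apply/matrixP => i j.
have qE (M : 'M[R]_4) (u v : 'rV[R]_4) : M^T = M ->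
    qf M (u + v) = qf M u + qf M v + 2 * (u *m M *m v^T) 0 0.
  move=> sM; rewrite /qf raddfD /= !mulmxDl !mulmxDr !mxE.
  have -> : \sum_j (v *m M) 0 j * u^T j 0 = \sum_j (u *m M) 0 j * v^T j 0.
    transitivity ((v *m M *m u^T) 0 0); first by rewrite [RHS]mxE.
    by rewrite -[M in LHS]sM -[in LHS](trmxK v) -!trmx_mul mxE mulmxA [LHS]mxE.
  ring.
have E (M : 'M[R]_4) : ((delta_mx 0 i : 'rV[R]_4) *m M *m (delta_mx 0 j : 'rV[R]_4)^T) 0 0 = M i j.
  by rewrite -rowE trmx_delta -colE !mxE.
have := H (delta_mx 0 i + delta_mx 0 j); rewrite !qE// !H E E => /addrI.
by move=> /(mulfI _); apply; rewrite pnatr_eq0.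
Qed.

End QuadraticForms.

Section MetricForms.
Context {R : realType}.

Definition eps2 (u v : R * R) : R := u.1 * v.2 - u.2 * v.1.

(* In the coordinates (x, t, X, Y), eta is X dY - Y dX. *)
Definition edge_form (w f s : R) (V1 V2 mn pq : R * R) (X Y : R) : 'M[R]_4 :=
  let v2 := (mn.1 + s * V2.1, mn.2 + s * V2.2) in
  let A := eps2 V2 mn in let B := eps2 v2 pq in
  let C := eps2 V1 mn in let E := eps2 V1 pq in
  let Dd := - (eps2 V1 V2 * (C + w)) in
  let eta := row4 0 0 (- Y) X in
  (w / f ^+ 2) *: (sq_form (row4 1 0 0 0) + sq_form (row4 0 0 1 0) + sq_form (row4 0 0 0 1) +
    (w ^+ 2)^-1 *: ((Dd + A ^+ 2) *: sq_form eta + (C * E + A * B) *: sym_form eta (row4 0 1 0 0)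
     + (s * E ^+ 2 + B ^+ 2) *: sq_form (row4 0 1 0 0))).

(* In the coordinates (X1, Y1, X2, Y2), eta_i is X_i dY_i - Y_i dX_i; the vectors
   are such that P1 = - mn' + R2 P1' and P2 = mn + R1 P2'. *)
Definition corner_form (W f R1 R2 : R) (P1' P2' mn mn' : R * R) (q : 'rV[R]_4) : 'M[R]_4 :=
  let P1 := (- mn'.1 + R2 * P1'.1, - mn'.2 + R2 * P1'.2) in
  let P2 := (mn.1 + R1 * P2'.1, mn.2 + R1 * P2'.2) in
  let A := eps2 P1 mn in let B := eps2 P1' mn' in
  let C := eps2 P2' mn in let E := eps2 P2 mn' in
  let D1 := - ((A + 2 * W) * eps2 P1 P2') in
  let D2 := - ((E + 2 * W) * eps2 P1' P2) in
  let eta1 := row4 (- q 0 1) (q 0 0) 0 0 in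
  let eta2 := row4 0 0 (- q 0 3) (q 0 2) in
  (W / f ^+ 2) *: (4 *: (sq_form (row4 1 0 0 0) + sq_form (row4 0 1 0 0) +
     sq_form (row4 0 0 1 0) + sq_form (row4 0 0 0 1)) +
    (W ^+ 2)^-1 *: ((D1 + R2 * C ^+ 2) *: sq_form eta1 + (A * B + C * E) *: sym_form eta1 eta2
     + (D2 + R1 * B ^+ 2) *: sq_form eta2)).

Lemma edge_form_sym w f s V1 V2 mn pq X Y :
  (edge_form w f s V1 V2 mn pq X Y)^T = edge_form w f s V1 V2 mn pq X Y.
Proof.
rewrite /edge_form /=; apply: trmxZ_sym.
by do ?[exact: sq_form_sym | exact: sym_form_sym | apply: trmxZ_sym | apply: trmxD_sym].
Qed.

Lemma corner_form_sym W f R1 R2 P1' P2' mn mn' q :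
  (corner_form W f R1 R2 P1' P2' mn mn' q)^T = corner_form W f R1 R2 P1' P2' mn mn' q.
Proof.
rewrite /corner_form /=; apply: trmxZ_sym.
by do ?[exact: sq_form_sym | exact: sym_form_sym | apply: trmxZ_sym | apply: trmxD_sym].
Qed.

Lemma qf_edge_form w f s V1 V2 mn pq X Y v :
  qf (edge_form w f s V1 V2 mn pq X Y) v =
  let v2 := (mn.1 + s * V2.1, mn.2 + s * V2.2) in
  let A := eps2 V2 mn in let B := eps2 v2 pq in
  let C := eps2 V1 mn in let E := eps2 V1 pq in
  let eta := X * v 0 3 - Y * v 0 2 in
  w / f ^+ 2 * (v 0 0 ^+ 2 + v 0 2 ^+ 2 + v 0 3 ^+ 2 + (w ^+ 2)^-1 *
    ((- (eps2 V1 V2 * (C + w)) + A ^+ 2) * eta ^+ 2 + (C * E + A * B) * (2 * eta * v 0 1) +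
     (s * E ^+ 2 + B ^+ 2) * v 0 1 ^+ 2)).
Proof.
rewrite /edge_form /= qfZ !qfD !qfZ !qfD !qfZ qf_sym !qf_sq !pr_row4.
by move: (w ^+ 2)^-1 (w / f ^+ 2) => a0 a1; ring.
Qed.

Lemma qf_corner_form W f R1 R2 P1' P2' mn mn' q v :
  qf (corner_form W f R1 R2 P1' P2' mn mn' q) v =
  let P1 := (- mn'.1 + R2 * P1'.1, - mn'.2 + R2 * P1'.2) in
  let P2 := (mn.1 + R1 * P2'.1, mn.2 + R1 * P2'.2) in
  let A := eps2 P1 mn in let B := eps2 P1' mn' in
  let C := eps2 P2' mn in let E := eps2 P2 mn' in
  let eta1 := q 0 0 * v 0 1 - q 0 1 * v 0 0 in
  let eta2 := q 0 2 * v 0 3 - q 0 3 * v 0 2 in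
  W / f ^+ 2 * (4 * (v 0 0 ^+ 2 + v 0 1 ^+ 2 + v 0 2 ^+ 2 + v 0 3 ^+ 2) + (W ^+ 2)^-1 *
    ((- ((A + 2 * W) * eps2 P1 P2') + R2 * C ^+ 2) * eta1 ^+ 2 +
     (A * B + C * E) * (2 * eta1 * eta2) +
     (- ((E + 2 * W) * eps2 P1' P2) + R1 * B ^+ 2) * eta2 ^+ 2)).
Proof.
rewrite /corner_form /= qfZ !qfD !qfZ !qfD !qfZ qf_sym !qf_sq !pr_row4.
by move: (W ^+ 2)^-1 (W / f ^+ 2) => a0 a1; ring.
Qed.

(* The pull-back of the edge form to D_+ x T^2 under z = s mn + t pq,
   (X, Y) = y (cos s, sin s). *)
Lemma edge_form_interior (w f y : R) (V1 V2 mn pq : R * R) (c sn dx dy ds dt : R) :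
  w != 0 -> y != 0 -> c ^+ 2 + sn ^+ 2 = 1 ->
  let s := y ^+ 2 in
  let v2 := (mn.1 + s * V2.1, mn.2 + s * V2.2) in
  w = eps2 V1 v2 ->
  qf (edge_form w f s V1 V2 mn pq (y * c) (y * sn))
     (row4 dx dt (c * dy - y * sn * ds) (sn * dy + y * c * ds)) =
  w / f ^+ 2 * (dx ^+ 2 + dy ^+ 2 + (w ^+ 2)^-1 *
    ((y * (eps2 V1 mn * ds + eps2 V1 pq * dt)) ^+ 2 +
     (eps2 v2 mn * ds + eps2 v2 pq * dt) ^+ 2)).
Proof.
move=> w0 y0 cs s v2 wE; rewrite qf_edge_form !row4E /=.
have -> : y * c * (sn * dy + y * c * ds) - y * sn * (c * dy - y * sn * ds) =
    (c ^+ 2 + sn ^+ 2) * (s * ds) by rewrite /s; ring.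
rewrite cs mul1r; congr (_ * _).
have -> : dx ^+ 2 + (c * dy - y * sn * ds) ^+ 2 + (sn * dy + y * c * ds) ^+ 2 =
   dx ^+ 2 + (c ^+ 2 + sn ^+ 2) * (dy ^+ 2 + s * ds ^+ 2) by rewrite /s; ring.
rewrite cs mul1r -[LHS]addrA -[RHS]addrA; congr (_ + _).
rewrite -[LHS]addrA; congr (_ + _).
have w2 : w ^+ 2 != 0 by rewrite expf_neq0.
apply: (mulfI w2); rewrite mulrDr !mulVKf//.
(* With C = [eps2 V1 mn] one has w = C + s [eps2 V1 V2], so the required coefficient (C^2 - w^2) / s
   of eta^2 is - [eps2 V1 V2] (C + w), which has no denominator. *)
rewrite wE /v2 /s /eps2 /=; ring.
Qed.

Section CornerEdge.
Variables (R1 R2 w f : R) (V1 V2 mn mn' P1' : R * R).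
Hypotheses (R20 : 0 < R2) (R10 : 0 <= R1) (w0 : w != 0).
Let rho := R1 + R2.
Let s := 4 * R1 * R2.
Let v2 := (mn.1 + s * V2.1, mn.2 + s * V2.2).
Let P2' := (4 * R2 * V2.1 + 2 * V1.1, 4 * R2 * V2.2 + 2 * V1.2).
Let P1 := (- v2.1 + 2 * R2 * V1.1, - v2.2 + 2 * R2 * V1.2).
Hypothesis wE : w = eps2 V1 v2.
Hypothesis P1E : (R2 * P1'.1 = mn'.1 + P1.1) /\ (R2 * P1'.2 = mn'.2 + P1.2).

(** The corner form is the edge form pulled back by x - a = R2 - R1, X + iY = 2 r2 (X1 + i Y1), with
    t the angle of the second coordinate. Here P1 = 2 R2 V1 - v2 and P2 = 2 R1 V1 + v2, so that
    [eps2] of P1 and P2 is 2 (R1 + R2) w, and dx^2 + dy^2 = 4 (R1 + R2) (dr1^2 + dr2^2) explains the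
    factor rho w in place of w. *)
Lemma corner_edge_form (q v : 'rV[R]_4) (r2 X Y c2 s2 : R) :
  q 0 0 ^+ 2 + q 0 1 ^+ 2 = R1 -> q 0 2 ^+ 2 + q 0 3 ^+ 2 = R2 -> r2 ^+ 2 = R2 -> 0 < r2 ->
  let sg1 := q 0 0 * v 0 0 + q 0 1 * v 0 1 in
  let sg2 := q 0 2 * v 0 2 + q 0 3 * v 0 3 in
  let eta2 := q 0 2 * v 0 3 - q 0 3 * v 0 2 in
  qf (corner_form (rho * w) f R1 R2 P1' P2' mn mn' q) v =
  qf (edge_form w f s V1 V2 mn mn' (2 * r2 * q 0 0) (2 * r2 * q 0 1))
    (row4 (2 * (sg2 - sg1)) (eta2 / R2) (2 * r2 * v 0 0 + 2 * q 0 0 * sg2 / r2)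
      (2 * r2 * v 0 1 + 2 * q 0 1 * sg2 / r2)).
Proof.
move=> e1 e2 er r20 sg1 sg2 eta2.
have R2n : R2 != 0 by rewrite gt_eqF.
have r2n : r2 != 0 by rewrite gt_eqF.
have rhon : rho != 0 by rewrite gt_eqF// ltr_wpDl.
rewrite qf_corner_form qf_edge_form !row4E /=.
have -> : (- mn'.1 + R2 * P1'.1, - mn'.2 + R2 * P1'.2) = P1.
  by case: P1E => -> ->; rewrite !addKr -surjective_pairing.
have -> : (mn.1 + R1 * P2'.1, mn.2 + R1 * P2'.2) = (v2.1 + 2 * R1 * V1.1, v2.2 + 2 * R1 * V1.2).
  by congr pair; rewrite /v2 /P2' /s /=; ring.
set eta1 := q 0 0 * v 0 1 - q 0 1 * v 0 0; rewrite -/eta2.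
have -> : 2 * r2 * q 0 0 * (2 * r2 * v 0 1 + 2 * q 0 1 * sg2 / r2) -
   2 * r2 * q 0 1 * (2 * r2 * v 0 0 + 2 * q 0 0 * sg2 / r2) = 4 * R2 * eta1.
  by rewrite -er /eta1; field.
have N1 : R1 * (v 0 0 ^+ 2 + v 0 1 ^+ 2) = sg1 ^+ 2 + eta1 ^+ 2 by rewrite -e1 /sg1 /eta1; ring.
have N2 : R2 * (v 0 2 ^+ 2 + v 0 3 ^+ 2) = sg2 ^+ 2 + eta2 ^+ 2 by rewrite -e2 /sg2 /eta2; ring.
have -> : (2 * (sg2 - sg1)) ^+ 2 + (2 * r2 * v 0 0 + 2 * q 0 0 * sg2 / r2) ^+ 2 +
   (2 * r2 * v 0 1 + 2 * q 0 1 * sg2 / r2) ^+ 2 =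
   4 * rho * (v 0 0 ^+ 2 + v 0 1 ^+ 2 + v 0 2 ^+ 2 + v 0 3 ^+ 2) -
   4 * rho * eta2 ^+ 2 / R2 - 4 * eta1 ^+ 2.
  apply: (mulfI R2n).
  have -> : R2 * (4 * rho * (v 0 0 ^+ 2 + v 0 1 ^+ 2 + v 0 2 ^+ 2 + v 0 3 ^+ 2) -
     4 * rho * eta2 ^+ 2 / R2 - 4 * eta1 ^+ 2) =
     4 * rho * (R2 * (v 0 2 ^+ 2 + v 0 3 ^+ 2)) - 4 * rho * eta2 ^+ 2 +
     4 * R2 * (R1 * (v 0 0 ^+ 2 + v 0 1 ^+ 2)) + 4 * R2 * R2 * (v 0 0 ^+ 2 + v 0 1 ^+ 2) -
     4 * R2 * eta1 ^+ 2 by rewrite /rho; field.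
  rewrite N1 N2.
  have -> : R2 * ((2 * (sg2 - sg1)) ^+ 2 + (2 * r2 * v 0 0 + 2 * q 0 0 * sg2 / r2) ^+ 2 +
     (2 * r2 * v 0 1 + 2 * q 0 1 * sg2 / r2) ^+ 2) =
     R2 * (4 * (sg2 - sg1) ^+ 2 + 4 * R2 * (v 0 0 ^+ 2 + v 0 1 ^+ 2) + 8 * sg1 * sg2) +
     4 * (q 0 0 ^+ 2 + q 0 1 ^+ 2) * sg2 ^+ 2 by rewrite -er /sg1; field.
  by rewrite e1 /rho; ring.
set nz := _ + _ + _ + v 0 3 ^+ 2.
set A := eps2 P1 mn; set Bc := eps2 P1' mn'; set Cc := eps2 P2' mn.
set Ec := eps2 _ mn'.
set Ae := eps2 V2 mn; set Be := eps2 v2 mn'; set Ce := eps2 V1 mn; set Ee := eps2 V1 mn'.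
set D1 := (A + _) * _; set D2 := (Ec + _) * _; set De := eps2 V1 V2 * _.
(* [I1], [I2] and [I3] compare the coefficients of eta1^2, eta1 eta2 and eta2^2. The last two are
   multiplied by powers of R2, since P1' is known only through R2 P1'. *)
have I1 : - D1 + R2 * Cc ^+ 2 = rho * (- 4 * w ^+ 2 + 16 * R2 ^+ 2 * (- De + Ae ^+ 2)).
  by rewrite /D1 /De /A /Cc /Ae /Ce /rho wE /P1 /P2' /v2 /s /eps2 /=; ring.
have R2B : R2 * Bc = 2 * R2 * Ee - Be.
  rewrite /Bc /eps2 mulrBr !mulrA P1E.1 P1E.2 /P1 /Ee /Be /eps2 /=; ring.
have I2 : A * Bc + Cc * Ec = 4 * rho * (Ce * Ee + Ae * Be).
  apply: (mulfI R2n).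
  have -> : R2 * (A * Bc + Cc * Ec) = A * (R2 * Bc) + R2 * Cc * Ec by ring.
  by rewrite R2B /A /Cc /Ec /Ce /Ee /Ae /Be /rho /P1 /P2' /v2 /s /eps2 /=; ring.
have R2D : R2 * D2 = 4 * (rho * w) ^+ 2 - Ec ^+ 2.
  have -> : R2 * D2 = (Ec + 2 * (rho * w)) * (R2 * eps2 P1' (v2.1 + 2 * R1 * V1.1, v2.2 + 2 * R1 * V1.2)).
    by rewrite /D2; ring.
  have -> : R2 * eps2 P1' (v2.1 + 2 * R1 * V1.1, v2.2 + 2 * R1 * V1.2) = 2 * (rho * w) - Ec.
    rewrite /eps2 mulrBr !mulrA P1E.1 P1E.2 /P1 /Ec wE /rho /eps2 /=; ring.
  by ring.
have I3 : R2 ^+ 2 * (- D2 + R1 * Bc ^+ 2) = rho * (- 4 * rho * w ^+ 2 * R2 + s * Ee ^+ 2 + Be ^+ 2).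
  have -> : R2 ^+ 2 * (- D2 + R1 * Bc ^+ 2) = - (R2 * (R2 * D2)) + R1 * (R2 * Bc) ^+ 2 by ring.
  rewrite R2D R2B.
  have -> : Ec = Be + 2 * R1 * Ee by rewrite /Ec /Be /Ee /eps2 /=; ring.
  by rewrite /rho /s; ring.
have {}I3 : - D2 + R1 * Bc ^+ 2 = rho * (- 4 * rho * w ^+ 2 * R2 + s * Ee ^+ 2 + Be ^+ 2) / R2 ^+ 2.
  by apply: (canRL (mulfK _)); [exact: expf_neq0|rewrite -I3 mulrC].
rewrite I1 I2 I3.
(* If f = 0, both sides are 0 by the convention 1 / 0 = 0. *)
have [->|fn] := eqVneq f 0; first by rewrite expr0n /= invr0 !mulr0 !mul0r.
by field; rewrite rhon w0 fn R2n.
Qed.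

End CornerEdge.
End MetricForms.

(** * Smoothness of pulled-back functions and of matrix fields *)

Section PullBack.
Context {R : realType}.

Lemma unif_Ck_sub n k (U V : set 'rV[R]_n) (phi : nat -> 'rV[R]_n -> R) :
  U `<=` V -> unif_Ck k V phi -> unif_Ck k U phi.
Proof.
move=> UV; elim: k phi => [|k IHk] phi [b H].
  by split=> // q Uq; exact: b (UV q Uq).
split; first by move=> q Uq; exact: b (UV q Uq).
case: H => d H; split; first by move=> j q Uq; exact: d (UV q Uq).
by move=> i; apply: IHk (H i).
Qed.

Lemma Cinfty_sub n (U V : set 'rV[R]_n) h : U `<=` V -> Cinfty V h -> Cinfty U h.
Proof. by move=> UV H k; exact: unif_Ck_sub UV (H k). Qed.

Lemma smooth_on_sub n (U V : set 'rV[R]_n) (h : 'rV[R]_n -> R) :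
  open V -> U `<=` V -> Cinfty V h -> smooth_on U h.
Proof. by move=> oV UV H; apply: Cinfty_smooth; exact: Cinfty_sub H. Qed.

Variables (X S : 'rV[R]_4 -> R).
Hypotheses (cX : Cinfty setT X) (cS : Cinfty setT S).

Lemma continuous_Cinfty (h : 'rV[R]_4 -> R) : Cinfty setT h -> continuous h.
Proof. by move=> H q; apply: differentiable_continuous; exact: Cinfty_diff H _. Qed.

Lemma open_pull (P : R -> R -> Prop) : open (set2 P) -> open [set q : 'rV[R]_4 | P (X q) (S q)].
Proof.
move=> oP.
have -> : [set q : 'rV[R]_4 | P (X q) (S q)] = (fun q => row2 (X q) (S q)) @^-1` set2 P.
  by apply/seteqP; split => q; rewrite /set2 /= row2_0 row2_1.
apply: open_comp => // q _; apply: differentiable_continuous.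
apply: differentiable_rV => a.
have [->|->] : a = 0 \/ a = 1.
  by case: a => [[|[|//]] p]; [left|right]; exact: val_inj.
  rewrite (_ : (fun q => _) = X); first exact: Cinfty_diff cX _.
  by apply/funext => z; rewrite row2_0.
rewrite (_ : (fun q => _) = S); first exact: Cinfty_diff cS _.
by apply/funext => z; rewrite row2_1.
Qed.

(** X and S stand for xi and s in the coordinates of a chart. *)
Lemma Cinfty_pull (P : R -> R -> Prop) (h : R -> R -> R) : open (set2 P) ->
  Cinfty (set2 P) (lift2 h) -> Cinfty [set q | P (X q) (S q)] (fun q => h (X q) (S q)).
Proof.
move=> oP H.
have oU := open_pull oP.
have -> : (fun q => h (X q) (S q)) = lift2 h \o (fun q => row2 (X q) (S q)).
  by apply/funext => q; rewrite /lift2 /= row2_0 row2_1.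
apply: (Cinfty_comp oU oP _ _ H).
  by move=> q; rewrite /set2 /= row2_0 row2_1.
move=> a; have [->|->] : a = 0 \/ a = 1.
  by case: a => [[|[|//]] p]; [left|right]; exact: val_inj.
  rewrite (_ : (fun q => _) = X); first exact: Cinfty_sub cX.
  by apply/funext => z; rewrite row2_0.
rewrite (_ : (fun q => _) = S); first exact: Cinfty_sub cS.
by apply/funext => z; rewrite row2_1.
Qed.

End PullBack.

(** Proves smoothness of polynomial expressions in functions known to be smooth; inverses and square
    roots, which require positivity, are supplied beforehand as hypotheses. *)
Ltac cinfty := first
  [ assumption | exact: Cinfty_cst | exact: Cinfty_coord
  | (apply: CinftyX; [assumption | cinfty])
  | (apply: CinftyB; [assumption | cinfty | cinfty])
  | (apply: CinftyN; [assumption | cinfty])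
  | (apply: CinftyD; [assumption | cinfty | cinfty])
  | (apply: CinftyM; [assumption | cinfty | cinfty]) | idtac ].

Section FormSmoothness.
Context {R : realType}.
Variable U : set 'rV[R]_4.
Hypothesis oU : open U.
Implicit Types a b c d : 'rV[R]_4 -> R.

Lemma Cinfty_row4 a b c d (i : 'I_4) : Cinfty U a -> Cinfty U b -> Cinfty U c -> Cinfty U d ->
  Cinfty U (fun q => row4 (a q) (b q) (c q) (d q) 0 i).
Proof.
move=> ca cb cc cd'; have -> : (fun q => row4 (a q) (b q) (c q) (d q) 0 i) =
   (fun q => [:: a q; b q; c q; d q]`_i) by apply/funext => q; rewrite mxE.
by case: i => [[|[|[|[|//]]]] p].
Qed.

Definition Cmx (G : 'rV[R]_4 -> 'M[R]_4) := forall i j, Cinfty U (fun q => G q i j).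

Lemma Cmx_D G G' : Cmx G -> Cmx G' -> Cmx (fun q => G q + G' q).
Proof.
move=> cG cG' i j; rewrite (_ : (fun q => _) = fun q => G q i j + G' q i j).
  exact: CinftyD.
by apply/funext => q; rewrite mxE.
Qed.

Lemma Cmx_Z a G : Cinfty U a -> Cmx G -> Cmx (fun q => a q *: G q).
Proof.
move=> ca cG i j; rewrite (_ : (fun q => _) = fun q => a q * G q i j).
  exact: CinftyM.
by apply/funext => q; rewrite mxE.
Qed.

Lemma Cmx_tensor (u v : 'rV[R]_4 -> 'rV[R]_4) :
  (forall i, Cinfty U (fun q => u q 0 i)) -> (forall i, Cinfty U (fun q => v q 0 i)) ->
  Cmx (fun q => (u q)^T *m v q).
Proof.
move=> cu cv i j; rewrite (_ : (fun q => _) = fun q => u q 0 i * v q 0 j).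
  exact: CinftyM.
by apply/funext => q; rewrite mxE big_ord1 !mxE.
Qed.

Lemma Cmx_sq (u : 'rV[R]_4 -> 'rV[R]_4) :
  (forall i, Cinfty U (fun q => u q 0 i)) -> Cmx (fun q => sq_form (u q)).
Proof. by move=> cu; exact: Cmx_tensor. Qed.

Lemma Cmx_sym (u v : 'rV[R]_4 -> 'rV[R]_4) :
  (forall i, Cinfty U (fun q => u q 0 i)) -> (forall i, Cinfty U (fun q => v q 0 i)) ->
  Cmx (fun q => sym_form (u q) (v q)).
Proof. by move=> cu cv; apply: Cmx_D; exact: Cmx_tensor. Qed.

Lemma Cmx_edge_form (w f s X Y : 'rV[R]_4 -> R) (V1 V2 : 'rV[R]_4 -> R * R) (mn pq : R * R) :
  (forall q, U q -> 0 < w q) -> (forall q, U q -> 0 < f q) ->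
  Cinfty U w -> Cinfty U f -> Cinfty U s -> Cinfty U X -> Cinfty U Y ->
  Cinfty U (fun q => (V1 q).1) -> Cinfty U (fun q => (V1 q).2) ->
  Cinfty U (fun q => (V2 q).1) -> Cinfty U (fun q => (V2 q).2) ->
  Cmx (fun q => edge_form (w q) (f q) (s q) (V1 q) (V2 q) mn pq (X q) (Y q)).
Proof.
move=> wp fp cw cf cs cX cY c11 c12 c21 c22.
have cw2 : Cinfty U (fun q => (w q ^+ 2)^-1).
  by apply: CinftyV => //; [move=> q /wp ?; rewrite exprn_gt0|cinfty].
have cf2 : Cinfty U (fun q => (f q ^+ 2)^-1).
  by apply: CinftyV => //; [move=> q /fp ?; rewrite exprn_gt0|cinfty].
have c1 k : Cinfty U (fun q : 'rV[R]_4 => row4 0 1 0 0 0 k) by exact: Cinfty_cst.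
have ce k : Cinfty U (fun q => row4 0 0 (- Y q) (X q) 0 k).
  by apply: Cinfty_row4; cinfty.
rewrite /edge_form /eps2 /=; apply: Cmx_Z; first by cinfty.
apply: Cmx_D; first by apply: Cmx_D; [apply: Cmx_D|]; apply: Cmx_sq => k; exact: Cinfty_cst.
apply: Cmx_Z => //; apply: Cmx_D; last by apply: Cmx_Z; [cinfty|exact: Cmx_sq].
apply: Cmx_D; apply: Cmx_Z; [cinfty|exact: Cmx_sq|cinfty|exact: Cmx_sym].
Qed.

Lemma Cmx_corner_form (W f R1 R2 : 'rV[R]_4 -> R) (P1' P2' : 'rV[R]_4 -> R * R) (mn mn' : R * R) :
  (forall q, U q -> 0 < W q) -> (forall q, U q -> 0 < f q) ->
  Cinfty U W -> Cinfty U f -> Cinfty U R1 -> Cinfty U R2 ->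
  Cinfty U (fun q => (P1' q).1) -> Cinfty U (fun q => (P1' q).2) ->
  Cinfty U (fun q => (P2' q).1) -> Cinfty U (fun q => (P2' q).2) ->
  Cmx (fun q => corner_form (W q) (f q) (R1 q) (R2 q) (P1' q) (P2' q) mn mn' q).
Proof.
move=> wp fp cw cf cR1 cR2 c11 c12 c21 c22.
have cw2 : Cinfty U (fun q => (W q ^+ 2)^-1).
  by apply: CinftyV => //; [move=> q /wp ?; rewrite exprn_gt0|cinfty].
have cf2 : Cinfty U (fun q => (f q ^+ 2)^-1).
  by apply: CinftyV => //; [move=> q /fp ?; rewrite exprn_gt0|cinfty].
have e1 k : Cinfty U (fun q : 'rV[R]_4 => row4 (- q 0 1) (q 0 0) 0 0 0 k).
  by apply: Cinfty_row4; cinfty.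
have e2 k : Cinfty U (fun q : 'rV[R]_4 => row4 0 0 (- q 0 3) (q 0 2) 0 k).
  by apply: Cinfty_row4; cinfty.
rewrite /corner_form /eps2 /=; apply: Cmx_Z; first by cinfty.
apply: Cmx_D.
  apply: Cmx_Z; first exact: Cinfty_cst.
  by do 3?[apply: Cmx_D]; apply: Cmx_sq => k; exact: Cinfty_cst.
apply: Cmx_Z => //; apply: Cmx_D; last by apply: Cmx_Z; [cinfty|exact: Cmx_sq].
apply: Cmx_D; apply: Cmx_Z; [cinfty|exact: Cmx_sq|cinfty|exact: Cmx_sym].
Qed.

End FormSmoothness.

(** * The components of the metric in the charts *)

Section ChartMetrics.
Context {R : realType}.
Variables (D : cusp_data R) (alpha : R).
Local Notation fI := (fI D). Local Notation fxI := (fxI D). Local Notation gI := (gI D).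

(* Lattice vectors are sheared by (u, v) |-> (u, v - alpha u), under which (m_j, n_j)
   becomes (m_j, - cd j); this leaves eps2 unchanged. *)
Definition mnr j : R * R := (cm D j, - cd D j).
Definition shear (v : int * int) : R * R := (v.1%:~R, v.2%:~R - alpha * v.1%:~R).

Section Corner.
Variable i : nat.
Local Notation b := (cpos D i).
Local Notation k := (slope D i).
Local Notation mu := (cm D i + k / 2).
Local Notation nu := (cd D i - weight D i / 2).
Local Notation H := (Hfun D i).

(** [V1v] and [v2v] are v_1 / y and v_2 after the shear, whose effect is to replace x by xi = x -
    alpha in their second components. *)
Definition V1v x s : R * R := (gI i x s, x * gI i x s - fxI i x s).
Definition v2v x s : R * R := (fxI i x s, x * fxI i x s + s * gI i x s - fI i x s).
Definition wv x s := wI (fI i x s) (fxI i x s) (gI i x s) s.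

Lemma eps2_V1v_v2v x s : eps2 (V1v x s) (v2v x s) = wv x s.
Proof. by rewrite /eps2 /wv /wI /=; ring. Qed.

(* V2v is the quotient (v2v - mnr i) / s, in a form that makes sense at s = 0. *)
Definition lE x s := dx2 H x s + k / 2 * (rm D i x s * (rm D i x s + x - b))^-1.
Definition hE x s := H x s - k / 2 * (rm D i x s + x - b)^-1.
Definition V2v x s : R * R := (lE x s, x * lE x s + gI i x s - hE x s).

(** s / (r_i + x - b_i) = r_i - (x - b_i): the terms of f and f_x that contain the radius combine
    with affine ones into multiples of s. *)
Lemma v2vE x s : 0 <= s -> 0 < rm D i x s -> 0 < rm D i x s + x - b ->
  v2v x s = ((mnr i).1 + s * (V2v x s).1, (mnr i).2 + s * (V2v x s).2).
Proof.
move=> s0 r0 z0; have E := rm_sq D i x s0.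
have rn : rm D i x s != 0 by rewrite gt_eqF.
have zn : rm D i x s + x - b != 0 by rewrite gt_eqF.
have W := weightE D i.
have sE : s = (rm D i x s - (x - b)) * (rm D i x s + x - b).
  by rewrite -[LHS](addKr ((x - b) ^+ 2)) -E; ring.
have A : s / (rm D i x s + x - b) = rm D i x s - (x - b).
  by apply: (canLR (mulfK zn)).
have fxE : fxI i x s = cm D i + s * lE x s.
  rewrite /fxI /lE [(rm D i x s * _)^-1]invfM.
  have -> : s * (dx2 H x s + k / 2 * ((rm D i x s)^-1 * (rm D i x s + x - b)^-1)) =
     s * dx2 H x s + k / 2 * (rm D i x s)^-1 * (s / (rm D i x s + x - b)) by ring.
  by rewrite A; field.
have fE : fI i x s = cm D i * x + cd D i + s * hE x s.
  rewrite /fI /hE W.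
  have -> : s * (H x s - k / 2 * (rm D i x s + x - b)^-1) =
     s * H x s - k / 2 * (s / (rm D i x s + x - b)) by ring.
  by rewrite A; field.
rewrite /v2v /V2v /mnr /= fE fxE; congr pair; ring.
Qed.

Section Rad.
Variables (R1 R2 : R).
Hypotheses (R10 : 0 <= R1) (R20 : 0 <= R2).
Local Notation x := (b + R2 - R1).
Local Notation s := (4 * R1 * R2).
Let h := H x s.
Let l := dx2 H x s.
Let e := ds2 H x s.

(* P1c and P2c are (2 R2 V1v - v2v + mnr i.+1) / R2 and (2 R1 V1v + v2v - mnr i) / R1, in
   which the terms in 1 / (R1 + R2) have cancelled; Wc is then (R1 + R2) wv. *)
Definition L1c := 4 * h + 4 * R1 * (4 * R2 * e - l).
Definition L2c := 4 * h + 4 * R2 * (l + 4 * R1 * e).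
Definition Phi1c := - cm D i.+1 + R2 * L1c.
Definition Phi2c := cm D i + R1 * L2c.
Definition P1c : R * R := (L1c, x * L1c + (4 * R1 * h - k) - 2 * Phi2c).
Definition P2c : R * R := (L2c, x * L2c + 2 * Phi1c - (4 * R2 * h - k)).
Definition fc := mu * x + nu + s * h - k / 2 * (R1 + R2).
Definition Wc := 2^-1 *
  eps2 (- (mnr i.+1).1 + R2 * P1c.1, - (mnr i.+1).2 + R2 * P1c.2)
       ((mnr i).1 + R1 * P2c.1, (mnr i).2 + R1 * P2c.2).

(** The radicand (R2 - R1)^2 + 4 R1 R2 is a square: this is why the square-root coordinates resolve
    the singular term at the corner. *)
Lemma rm_corner : rm D i x s = R1 + R2.
Proof.
rewrite /rm (_ : (x - b) ^+ 2 + s = (R1 + R2) ^+ 2); last ring.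
by rewrite sqrtr_sqr ger0_norm// addr_ge0.
Qed.

Lemma fcE : fc = fI i x s.
Proof. by rewrite /fI rm_corner. Qed.

Lemma Pc_vectors : 0 < R1 + R2 ->
  (- (mnr i.+1).1 + R2 * P1c.1, - (mnr i.+1).2 + R2 * P1c.2) =
    (- (v2v x s).1 + 2 * R2 * (V1v x s).1, - (v2v x s).2 + 2 * R2 * (V1v x s).2) /\
  ((mnr i).1 + R1 * P2c.1, (mnr i).2 + R1 * P2c.2) =
    ((v2v x s).1 + 2 * R1 * (V1v x s).1, (v2v x s).2 + 2 * R1 * (V1v x s).2).
Proof.
move=> rho0; have rn : R1 + R2 != 0 by rewrite gt_eqF.
have W := weightE D i.
have M : cm D i.+1 = cm D i + k by rewrite /slope; ring.
have C : cd D i.+1 = cd D i - k * b by rewrite -W /weight; ring.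
rewrite /v2v /V1v /fI /fxI /gI rm_corner /mnr /P1c /P2c /Phi1c /Phi2c /L1c /L2c -/h -/l -/e /=.
rewrite M C W; split; congr pair; by field.
Qed.

Lemma P2c_vector : 0 < R2 ->
  P2c = (4 * R2 * (V2v x s).1 + 2 * (V1v x s).1, 4 * R2 * (V2v x s).2 + 2 * (V1v x s).2).
Proof.
move=> R2p; have R2n : R2 != 0 by rewrite gt_eqF.
have rn : R1 + R2 != 0 by rewrite gt_eqF// ltr_wpDl.
have M : cm D i.+1 = cm D i + k by rewrite /slope; ring.
rewrite /V2v /lE /hE /V1v /fxI /gI rm_corner /P2c /Phi1c /L1c /L2c -/h -/l -/e /=.
have -> : R1 + R2 + x - b = 2 * R2 by ring.
by rewrite M; congr pair; field; rewrite R2n rn.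
Qed.

Lemma WcE : 0 < R1 + R2 -> Wc = (R1 + R2) * wv x s.
Proof.
move=> rho0; rewrite /Wc; have [-> ->] := Pc_vectors rho0.
by rewrite -eps2_V1v_v2v /eps2 /=; field.
Qed.

Lemma Wc_corner : R1 = 0 -> R2 = 0 -> Wc = 2^-1.
Proof.
move=> r1 r2; rewrite /Wc r1 r2 !mul0r !addr0 /eps2 /mnr /=.
rewrite -[RHS]mulr1 -(cm_cd_det D i); congr (_ * _); ring.
Qed.

(** Off the corner [Wc] is (R1 + R2) w and inherits the sign of w; at the corner itself, where w
    becomes infinite, its value 1/2 comes from the determinant. *)
Lemma Wc_gt0 : corner_reg D i x s -> 0 < Wc.
Proof.
move=> H1; have s0 : 0 <= s by rewrite !mulr_ge0.
have [rho0|rho0] := leP (R1 + R2) 0.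
  have /andP[/eqP r1 /eqP r2] : (R1 == 0) && (R2 == 0).
    by rewrite -paddr_eq0// eq_le rho0 addr_ge0.
  by rewrite Wc_corner// invr_gt0.
rewrite WcE//; apply: mulr_gt0 => //; apply: w_gt0 => //.
by rewrite (_ : _ + _ = (R1 + R2) ^+ 2); [rewrite exprn_gt0|ring].
Qed.

Lemma fc_gt0 : corner_reg D i x s -> 0 < fc.
Proof. by move=> H1; rewrite fcE; apply: fI_gt0; rewrite ?mulr_ge0. Qed.

End Rad.

Definition cR1 (q : 'rV[R]_4) := q 0 0 ^+ 2 + q 0 1 ^+ 2.
Definition cR2 (q : 'rV[R]_4) := q 0 2 ^+ 2 + q 0 3 ^+ 2.

Definition corner_metric (q : 'rV[R]_4) : 'M[R]_4 :=
  corner_form (Wc (cR1 q) (cR2 q)) (fc (cR1 q) (cR2 q)) (cR1 q) (cR2 q)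
    (P1c (cR1 q) (cR2 q)) (P2c (cR1 q) (cR2 q)) (mnr i) (mnr i.+1) q.

Definition corner_dom : set 'rV[R]_4 :=
  [set q | corner_reg D i (b + cR2 q - cR1 q) (4 * cR1 q * cR2 q)].

Lemma cR1_ge0 q : 0 <= cR1 q. Proof. by rewrite addr_ge0 ?sqr_ge0. Qed.
Lemma cR2_ge0 q : 0 <= cR2 q. Proof. by rewrite addr_ge0 ?sqr_ge0. Qed.

Lemma Cinfty_cR (U : set 'rV[R]_4) : open U -> Cinfty U cR1 /\ Cinfty U cR2.
Proof. by move=> oU; rewrite /cR1 /cR2; split; cinfty. Qed.

Let cX : Cinfty setT (fun q => b + cR2 q - cR1 q).
Proof.
have oT : open [set: 'rV[R]_4] by exact: openT.
by have [? ?] := Cinfty_cR oT; cinfty.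
Qed.

Let cS : Cinfty setT (fun q => 4 * cR1 q * cR2 q).
Proof.
have oT : open [set: 'rV[R]_4] by exact: openT.
by have [? ?] := Cinfty_cR oT; cinfty.
Qed.

Lemma open_corner_dom : open corner_dom.
Proof. by apply: (open_pull cX cS); exact: open_corner_reg. Qed.

Lemma Cmx_corner_metric : Cmx corner_dom corner_metric.
Proof.
have oU := open_corner_dom.
have oC := @open_corner_reg _ D i.
have cH : Cinfty (set2 (corner_reg D i)) (lift2 H) by exact: Cinfty_Hfun.
have [c1 c2] := Cinfty_cR oU.
have ch : Cinfty corner_dom (fun q => H (b + cR2 q - cR1 q) (4 * cR1 q * cR2 q)).
  exact: (Cinfty_pull cX cS oC cH).
have cl : Cinfty corner_dom (fun q => dx2 H (b + cR2 q - cR1 q) (4 * cR1 q * cR2 q)).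
  exact: (Cinfty_pull cX cS oC (Cinfty_dx2 oC cH)).
have ce : Cinfty corner_dom (fun q => ds2 H (b + cR2 q - cR1 q) (4 * cR1 q * cR2 q)).
  exact: (Cinfty_pull cX cS oC (Cinfty_ds2 oC cH)).
have cL1 : Cinfty corner_dom (fun q => L1c (cR1 q) (cR2 q)) by rewrite /L1c; cinfty.
have cL2 : Cinfty corner_dom (fun q => L2c (cR1 q) (cR2 q)) by rewrite /L2c; cinfty.
have cP1 : Cinfty corner_dom (fun q => Phi1c (cR1 q) (cR2 q)) by rewrite /Phi1c; cinfty.
have cP2 : Cinfty corner_dom (fun q => Phi2c (cR1 q) (cR2 q)) by rewrite /Phi2c; cinfty.
have d1 : Cinfty corner_dom (fun q => (P1c (cR1 q) (cR2 q)).2) by rewrite /P1c /=; cinfty.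
have d2 : Cinfty corner_dom (fun q => (P2c (cR1 q) (cR2 q)).2) by rewrite /P2c /=; cinfty.
apply: Cmx_corner_form => //.
- by move=> q Hq; apply: Wc_gt0; rewrite ?cR1_ge0 ?cR2_ge0.
- by move=> q Hq; apply: fc_gt0; rewrite ?cR1_ge0 ?cR2_ge0.
- rewrite /Wc /eps2; cbn [fst snd]; by cinfty.
- by rewrite /fc; cinfty.
Qed.

End Corner.

Section Edge.
Variables (j : nat) (pq : int * int).
Definition eX (q : 'rV[R]_4) := q 0 0 - alpha.
Definition eS (q : 'rV[R]_4) := q 0 2 ^+ 2 + q 0 3 ^+ 2.

Definition edge_metric (q : 'rV[R]_4) : 'M[R]_4 :=
  edge_form (wv j (eX q) (eS q)) (fI j (eX q) (eS q)) (eS q) (V1v j (eX q) (eS q))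
    (V2v j (eX q) (eS q)) (mnr j) (shear pq) (q 0 2) (q 0 3).

Definition edge_dom : set 'rV[R]_4 := [set q | edge_reg D j (eX q) (eS q)].

Lemma eS_ge0 q : 0 <= eS q. Proof. by rewrite addr_ge0 ?sqr_ge0. Qed.

Let cX : Cinfty setT eX.
Proof. by have oT : open [set: 'rV[R]_4] by [exact: openT]; rewrite /eX; cinfty. Qed.

Let cS : Cinfty setT eS.
Proof. by have oT : open [set: 'rV[R]_4] by [exact: openT]; rewrite /eS; cinfty. Qed.

Lemma open_edge_dom : open edge_dom.
Proof. by apply: (open_pull cX cS); exact: open_edge_reg. Qed.

Lemma edge_reg_pos x s : edge_reg D j x s ->
  0 < (x - cpos D j) ^+ 2 + s /\ 0 < rm D j x s + x - cpos D j.
Proof.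
move=> [x0 [s0|[xb sb _]]].
  have r0 : 0 < (x - cpos D j) ^+ 2 + s by rewrite ltr_wpDl ?sqr_ge0.
  split=> //; rewrite -addrA.
  have T0 := cpos_gt0 D j.
  have := @sqrtr_add_ge _ (cpos D j) s (x - cpos D j) s (ltW T0) (ltW s0) (lexx _).
  have h1 : - cpos D j <= x - cpos D j by lra.
  move=> /(_ h1); apply: lt_le_trans.
  rewrite subr_gt0 -{1}(gtr0_norm T0) -sqrtr_sqr ltr_sqrt ?ltrDl//.
  by rewrite ltr_wpDl ?sqr_ge0.
have r0 : 0 < (x - cpos D j) ^+ 2 + s by rewrite addrC.
have : 0 < rm D j x s by rewrite sqrtr_gt0.
by split=> //; lra.
Qed.

Lemma Cmx_edge_metric : Cmx edge_dom edge_metric.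
Proof.
have oU := open_edge_dom.
have oC := @open_corner_reg _ D j.
have oE := @open_edge_reg _ D j.
have EC : set2 (edge_reg D j) `<=` set2 (corner_reg D j).
  by move=> q; exact: edge_corner_reg.
have cH : Cinfty (set2 (corner_reg D j)) (lift2 (Hfun D j)) by exact: Cinfty_Hfun.
have cr : Cinfty (set2 (edge_reg D j)) (lift2 (rm D j)).
  have cx : Cinfty (set2 (edge_reg D j)) (fun q => q 0 0) by cinfty.
  have cs : Cinfty (set2 (edge_reg D j)) (fun q => q 0 1) by cinfty.
  apply: Cinfty_sqrt => //; last by cinfty.
  by move=> q /edge_reg_pos[].
have U1 : Cinfty edge_dom (fun q => Hfun D j (eX q) (eS q)).
  exact: (Cinfty_pull cX cS oE (Cinfty_sub EC cH)).
have U2 : Cinfty edge_dom (fun q => dx2 (Hfun D j) (eX q) (eS q)).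
  exact: (Cinfty_pull cX cS oE (Cinfty_sub EC (Cinfty_dx2 oC cH))).
have U3 : Cinfty edge_dom (fun q => ds2 (Hfun D j) (eX q) (eS q)).
  exact: (Cinfty_pull cX cS oE (Cinfty_sub EC (Cinfty_ds2 oC cH))).
have U4 : Cinfty edge_dom (fun q => rm D j (eX q) (eS q)) by exact: (Cinfty_pull cX cS oE cr).
have UX : Cinfty edge_dom eX by rewrite /eX; cinfty.
have US : Cinfty edge_dom eS by rewrite /eS; cinfty.
have rp q : edge_dom q -> 0 < rm D j (eX q) (eS q).
  by move=> /edge_reg_pos[? _]; rewrite sqrtr_gt0.
have UV : Cinfty edge_dom (fun q => (2 * rm D j (eX q) (eS q))^-1).
  by apply: CinftyV => //; [move=> q /rp ?; rewrite mulr_gt0|cinfty].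
have UZ : Cinfty edge_dom (fun q => (rm D j (eX q) (eS q) + eX q - cpos D j)^-1).
  by apply: CinftyV => //; [move=> q /edge_reg_pos[]|cinfty].
have UW : Cinfty edge_dom (fun q => (rm D j (eX q) (eS q) *
    (rm D j (eX q) (eS q) + eX q - cpos D j))^-1).
  apply: CinftyV => //; last by cinfty.
  by move=> q Hq; have [_ ?] := edge_reg_pos Hq; rewrite mulr_gt0// rp.
have cf : Cinfty edge_dom (fun q => fI j (eX q) (eS q)) by rewrite /fI; cinfty.
have cfx : Cinfty edge_dom (fun q => fxI j (eX q) (eS q)) by rewrite /fxI; cinfty.
have cg : Cinfty edge_dom (fun q => gI j (eX q) (eS q)) by rewrite /gI; cinfty.
have clE : Cinfty edge_dom (fun q => lE j (eX q) (eS q)) by rewrite /lE; cinfty.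
have chE : Cinfty edge_dom (fun q => hE j (eX q) (eS q)) by rewrite /hE; cinfty.
apply: Cmx_edge_form => //.
- move=> q Hq; apply: w_gt0; [exact: edge_corner_reg|exact: eS_ge0|].
  by have [] := edge_reg_pos Hq.
- by move=> q Hq; apply: fI_gt0; [exact: edge_corner_reg|exact: eS_ge0].
- by rewrite /wv /wI; cinfty.
- by cinfty.
- by cinfty.
- by rewrite /V1v /=; cinfty.
- by rewrite /V2v /=; cinfty.
Qed.

End Edge.
End ChartMetrics.

(** * Transformation laws and charts *)

Section RelatedCharts.
Context {R : realType} {M : Type} (A : atlas R 4 M).
Variable G : chart_index A -> 'rV[R]_4 -> 'M[R]_4.
Hypothesis chart_inj : forall (c : chart_index A) P P' q, chart c P q -> chart c P' q -> P = P'.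
Hypothesis chart_fun : forall (c : chart_index A) P q q', chart c P q -> chart c P q' -> q = q'.
Hypothesis G_sym : forall c q, (G c q)^T = G c q.

Definition chart_map (c d : chart_index A) q (Phi : 'rV[R]_4 -> 'rV[R]_4) :=
  differentiable Phi q /\ \forall z \near q, exists P, chart c P z /\ chart d P (Phi z).

(** A pointwise transformation law: Phi and Psi represent the coordinate changes near q and q', but
    the two forms are compared at q only. The law between two charts can thus be deduced from a
    third one; Psi gives the symmetry and makes the differential of Phi injective. *)
Definition related c d q q' := exists Phi Psi, [/\ Phi q = q', Psi q' = q,
  chart_map c d q Phi, chart_map d c q' Psi &
  forall v, qf (G c q) v = qf (G d q') ('d Phi q v)].

(** Charts are injective and single-valued, so Psi after Phi is the identity near q. *)
Lemma chart_map_inv c d q Phi Psi : chart_map c d q Phi -> chart_map d c (Phi q) Psi ->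
  forall v, 'd Psi (Phi q) ('d Phi q v) = v.
Proof.
move=> [dP nP] [dQ nQ] v.
have cP : {for q, continuous Phi} by exact: differentiable_continuous.
have E : \forall z \near q, id z = (Psi \o Phi) z.
  have nQ' := cP _ nQ; apply: filterS2 nP nQ' => z [P [cPz dPz]] [P' [dP'z cP'z]].
  have PP := chart_inj dPz dP'z; subst P'.
  exact: chart_fun cPz cP'z.
have did : differentiable (id : 'rV[R]_4 -> 'rV[R]_4) q by [].
have [_ H] := differentiable_near_eq E did.
have C := congr1 (fun h => h v) (diff_comp dP dQ).
have H' := congr1 (fun h => h v) H.
apply: etrans (esym C) (etrans H' _).
exact: (congr1 (fun h => h v) (@diff_val _ _ _ _ _ _ _ (is_diff_id q))).
Qed.

Lemma related_sym c d q q' : related c d q q' -> related d c q' q.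
Proof.
move=> [Phi [Psi [e1 e2 m1 m2 law]]]; subst q'.
exists Psi, Phi; split; [exact: e2|by []|exact: m2|exact: m1|move=> v].
have m1' : chart_map c d (Psi (Phi q)) Phi by rewrite e2.
have E := chart_map_inv m2 m1' v.
rewrite e2 in E.
by rewrite law E.
Qed.

Lemma chart_map_comp c d f q Phi Psi : chart_map c d q Phi -> chart_map d f (Phi q) Psi ->
  chart_map c f q (Psi \o Phi).
Proof.
move=> [dP nP] [dQ nQ]; split; first exact: differentiable_comp.
have cP : {for q, continuous Phi} by exact: differentiable_continuous.
have nQ' := cP _ nQ; apply: filterS2 nP nQ' => z [P [cPz dPz]] [P' [dP'z cP'z]].
have PP := chart_inj dPz dP'z; subst P'.
by exists P.
Qed.

Lemma related_trans c d f q q' q'' : related c d q q' -> related d f q' q'' ->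
  related c f q q''.
Proof.
move=> [Phi [Psi [e1 e2 m1 m2 law]]] [Phi' [Psi' [e1' e2' m1' m2' law']]].
subst q' q''.
exists (Phi' \o Phi), (Psi \o Psi'); split.
- by [].
- by rewrite /= e2'.
- exact: chart_map_comp m1 m1'.
- by apply: chart_map_comp m2' _; rewrite e2'.
- move=> v; rewrite law law'; congr (qf _ _).
  case: m1 => dP _; case: m1' => dQ _.
  exact: (esym (congr1 (fun h => h v) (diff_comp dP dQ))).
Qed.

Lemma related_refl c q : (\forall z \near q, exists P, chart c P z) -> related c c q q.
Proof.
move=> H.
have m : chart_map c c q id.
  by split; [|apply: filterS H => z [P cP]; exists P].
exists id, id; split=> // v.
by rewrite diff_val.
Qed.

(** Near q the [transition] of the atlas coincides with Phi, as the point determines its coordinates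
    and conversely. *)
Lemma related_law c d q q' : related c d q q' ->
  G c q = jacobian (transition c d) q *m G d (transition c d q) *m
    (jacobian (transition c d) q)^T.
Proof.
move=> [Phi [Psi [e1 e2 m1 m2 law]]].
have tE z : (exists P, chart c P z /\ chart d P (Phi z)) -> Phi z = transition c d z.
  move=> [P [cP dP]]; rewrite /transition; symmetry; apply: xget_unique.
    by exists P.
  move=> z' [P' [cP' dP']]; have PP := chart_inj cP cP'; subst P'.
  exact: chart_fun dP' dP.
have [dPhi nPhi] := m1.
have E : \forall z \near q, Phi z = transition c d z by apply: filterS nPhi => z /tE.
have [dT HT] := differentiable_near_eq E dPhi.
have Tq : transition c d q = q' by rewrite -(nbhs_singleton E).
apply: eq_of_qf => [|| v]; [exact: G_sym|by rewrite !trmx_mul trmxK G_sym mulmxA|].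
rewrite law Tq.
have -> : 'd Phi q v = v *m jacobian (transition c d) q.
  rewrite /jacobian mul_rV_lin1; exact: (esym (congr1 (fun h => h v) HT)).
by rewrite /qf trmx_mul !mulmxA.
Qed.

Lemma related_pos c d q q' : related c d q q' ->
  (forall v, v != 0 -> 0 < qf (G d q') v) -> forall v, v != 0 -> 0 < qf (G c q) v.
Proof.
move=> [Phi [Psi [e1 e2 m1 m2 law]]] pos v v0; rewrite law; apply: pos.
subst q'; apply: contraNneq v0 => E.
have I := chart_map_inv m1 m2 v.
apply/eqP; apply: etrans (esym I) _; apply: etrans (congr1 ('d Psi (Phi q)) E) _.
exact: linear0.
Qed.

Lemma related_intro c d q q' P Phi Psi : chart c P q -> chart d P q' ->
  chart_map c d q Phi -> chart_map d c q' Psi ->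
  (forall v, qf (G c q) v = qf (G d (Phi q)) ('d Phi q v)) -> related c d q q'.
Proof.
move=> cP dP m1 m2 law.
have e1 : Phi q = q'.
  have [P' [cP' dP']] := nbhs_singleton m1.2.
  by rewrite (chart_inj cP' cP) in dP'; exact: chart_fun dP' dP.
have e2 : Psi q' = q.
  have [P' [dP' cP']] := nbhs_singleton m2.2.
  by rewrite (chart_inj dP' dP) in cP'; exact: chart_fun cP' cP.
by exists Phi, Psi; split=> // v; rewrite law e1.
Qed.

End RelatedCharts.

(** * Angles and polar coordinates *)

Section Angles.
Context {R : realType}.
Implicit Types (s t r X Y : R) (k : int).

Lemma cos_sin_period t k : cos (t + k%:~R * (2 * pi)) = cos t /\ sin (t + k%:~R * (2 * pi)) = sin t.
Proof.
have E z : (2 * pi) * z = z * (pi *+ 2) :> R by rewrite mulr2n; ring.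
have H (n : nat) (u : R) : cos (u + n%:R * (2 * pi)) = cos u /\ sin (u + n%:R * (2 * pi)) = sin u.
  elim: n u => [|n IH] u; first by rewrite mul0r addr0.
  have [I1 I2] := IH (u + pi *+ 2).
  have -> : u + n.+1%:R * (2 * pi) = u + pi *+ 2 + n%:R * (2 * pi).
    by rewrite -natr1 mulr2n; ring.
  by rewrite I1 I2 cosD2pi sinD2pi.
case: k => n; first exact: H.
have [I1 I2] := H n.+1 (t + (Negz n)%:~R * (2 * pi)).
have e : t + (Negz n)%:~R * (2 * pi) + n.+1%:R * (2 * pi) = t.
  by rewrite NegzE mulrNz -[n.+1%:~R]/(n.+1%:R); ring.
by rewrite e in I1 I2.
Qed.

Lemma cos_sin_inj s t : cos s = cos t -> sin s = sin t -> exists k, t = s + k%:~R * (2 * pi).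
Proof.
move=> ec es.
have p0 : 0 < 2 * pi :> R by rewrite mulr_gt0// pi_gt0.
have c1 : cos (t - s) = 1 by rewrite cosB ec es -!expr2 cos2Dsin2.
pose k := Num.floor ((t - s) / (2 * pi)); pose u := t - s - k%:~R * (2 * pi).
have cu : cos u = 1.
  have [H _] := cos_sin_period u k; rewrite -c1 -H; congr cos; rewrite /u; ring.
have u0 : 0 <= u by rewrite subr_ge0 -ler_pdivlMr// floor_le.
have u1 : u < 2 * pi.
  have := floorD1_gt ((t - s) / (2 * pi)).
  by rewrite ltr_pdivrMr// intrD mulrDl mulr1z mul1r -/k /u => H; lra.
have z : u = 0.
  have [up|up] := leP u pi.
    apply: (@cos_inj R); rewrite ?in_itv /= ?u0 ?up ?lexx ?pi_ge0//.
    by rewrite cu cos0.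
  have : 2 * pi - u = 0.
    apply: (@cos_inj R); rewrite ?in_itv /= ?lexx ?pi_ge0//.
      by apply/andP; split; lra.
    have [H _] := cos_sin_period (- u) 1; rewrite mulr1z in H.
    rewrite cos0; transitivity (cos (- u)); last by rewrite cosN.
    by rewrite -H; congr cos; ring.
  by lra.
by exists k; move: z; rewrite /u; lra.
Qed.

Lemma polar_inj r r' s s' : 0 <= r -> 0 <= r' -> r * cos s = r' * cos s' ->
  r * sin s = r' * sin s' -> r = r' /\ (r = 0 \/ exists k, s' = s + k%:~R * (2 * pi)).
Proof.
move=> r0 r0' ec es.
have E : r = r'.
  have : r ^+ 2 = r' ^+ 2.
    rewrite -[LHS]mulr1 -(cos2Dsin2 s) -[RHS]mulr1 -(cos2Dsin2 s').
    transitivity ((r * cos s) ^+ 2 + (r * sin s) ^+ 2); first ring.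
    rewrite ec es; ring.
  by move/eqP; rewrite eqrXn2// => /eqP.
split=> //; subst r'.
have [->|rn] := eqVneq r 0; first by left.
right; apply: cos_sin_inj; exact: (mulfI rn).
Qed.

(** The branch of the argument with value s0 on the ray of angle s0; it is smooth on the open
    half-plane that this ray bisects. *)
Definition arg_near (s0 X Y : R) :=
  s0 + atan ((Y * cos s0 - X * sin s0) / (X * cos s0 + Y * sin s0)).

Lemma arg_nearE s0 X Y : 0 < X * cos s0 + Y * sin s0 ->
  X = Num.sqrt (X ^+ 2 + Y ^+ 2) * cos (arg_near s0 X Y) /\
  Y = Num.sqrt (X ^+ 2 + Y ^+ 2) * sin (arg_near s0 X Y).
Proof.
move=> p0; set p := X * cos s0 + Y * sin s0 in p0.
pose m := Y * cos s0 - X * sin s0.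
have cs := cos2Dsin2 s0.
have N : X ^+ 2 + Y ^+ 2 = p ^+ 2 + m ^+ 2.
  rewrite /p /m -[LHS]mulr1 -cs; ring.
have q0 : 0 < 1 + (m / p) ^+ 2 by rewrite ltr_pwDl// sqr_ge0.
have S : Num.sqrt (X ^+ 2 + Y ^+ 2) = p * Num.sqrt (1 + (m / p) ^+ 2).
  have -> : X ^+ 2 + Y ^+ 2 = p ^+ 2 * (1 + (m / p) ^+ 2) by rewrite N; field; rewrite gt_eqF.
  by rewrite sqrtrM ?sqr_ge0// sqrtr_sqr gtr0_norm.
have sn : Num.sqrt (1 + (m / p) ^+ 2) != 0 by rewrite gt_eqF// sqrtr_gt0.
have ca : Num.sqrt (X ^+ 2 + Y ^+ 2) * cos (atan (m / p)) = p.
  by rewrite cos_atan S mulfK.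
have sa : Num.sqrt (X ^+ 2 + Y ^+ 2) * sin (atan (m / p)) = m.
  have -> : sin (atan (m / p)) = tan (atan (m / p)) * cos (atan (m / p)).
    by rewrite /tan divfK// cos_atan invr_eq0.
  by rewrite atanK mulrCA ca divfK// gt_eqF.
rewrite /arg_near -/p -/m cosD sinD; split.
  transitivity (cos s0 * (Num.sqrt (X ^+ 2 + Y ^+ 2) * cos (atan (m / p))) -
    sin s0 * (Num.sqrt (X ^+ 2 + Y ^+ 2) * sin (atan (m / p)))); last ring.
  by rewrite ca sa /p /m -[LHS]mulr1 -cs; ring.
transitivity (sin s0 * (Num.sqrt (X ^+ 2 + Y ^+ 2) * cos (atan (m / p))) +
    cos s0 * (Num.sqrt (X ^+ 2 + Y ^+ 2) * sin (atan (m / p)))); last ring.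
by rewrite ca sa /p /m -[LHS]mulr1 -cs; ring.
Qed.

Lemma arg_near_base s0 r : r != 0 -> arg_near s0 (r * cos s0) (r * sin s0) = s0.
Proof.
move=> r0; rewrite /arg_near.
have -> : r * sin s0 * cos s0 - r * cos s0 * sin s0 = 0 by ring.
by rewrite mul0r atan0 addr0.
Qed.

Lemma arg_near_base_gt0 s0 r : 0 < r -> 0 < r * cos s0 * cos s0 + r * sin s0 * sin s0.
Proof.
move=> r0; rewrite -!mulrA -mulrDr -!expr2 cos2Dsin2 mulr1.
by [].
Qed.

End Angles.

(** * Lattice bases and angles modulo 2 pi *)

Section Lattice.
Context {R : realType}.
Implicit Types (v w k : int * int).

Definition detz v w : int := v.1 * w.2 - v.2 * w.1.

(** The unit vectors have integral coordinates in the basis, so the determinant divides 1. In this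
    form it is its own inverse, which is how it is used in Cramer's rule. *)
Lemma zbasis_det v w : zbasis v w -> detz v w * detz v w = 1.
Proof.
move=> H; have [[a1 b1] [[/= e1 e2] _]] := H (1, 0); have [[a2 b2] [[/= e3 e4] _]] := H (0, 1).
have D : (a1 * b2 - a2 * b1) * detz v w = 1.
  rewrite /detz; transitivity ((a1 * v.1 + b1 * w.1) * (a2 * v.2 + b2 * w.2) -
    (a1 * v.2 + b1 * w.2) * (a2 * v.1 + b2 * w.1)); first ring.
  by rewrite -e1 -e2 -e3 -e4.
have /eqP := congr1 absz D; rewrite abszM muln_eq1 => /andP[_ /eqP H1].
by have [->|->] : detz v w = 1 \/ detz v w = -1 by lia.
Qed.

(** Cramer's rule; both angles are determined modulo 2 pi by the class in the torus. *)
Lemma lat_solve v w k (s t s' t' : R) : detz v w * detz v w = 1 ->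
  lat v s' + lat w t' = lat v s + lat w t + lat k (2 * pi) ->
  s' = s + (detz v w * detz k w)%:~R * (2 * pi) /\
  t' = t + (detz v w * detz v k)%:~R * (2 * pi).
Proof.
move=> D [e1 e2].
have D' : (detz v w)%:~R * (detz v w)%:~R = 1 :> R by rewrite -intrM D.
have dE a b : (detz a b)%:~R = a.1%:~R * b.2%:~R - a.2%:~R * b.1%:~R :> R.
  by rewrite /detz intrB !intrM.
split.
  have : (detz v w)%:~R * s' = (detz v w)%:~R * s + (detz k w)%:~R * (2 * pi).
    rewrite !dE; move: e1 e2.
    move: (v.1%:~R) (v.2%:~R) (w.1%:~R) (w.2%:~R) (k.1%:~R) (k.2%:~R) => v1 v2 w1 w2 k1 k2 e1 e2.
    transitivity ((s' * v1 + t' * w1) * w2 - (s' * v2 + t' * w2) * w1); first ring.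
    by rewrite e1 e2; ring.
  move=> /(congr1 (fun z => (detz v w)%:~R * z)); rewrite mulrA D' mul1r => ->.
  by rewrite mulrDr mulrA D' mul1r intrM mulrA.
have : (detz v w)%:~R * t' = (detz v w)%:~R * t + (detz v k)%:~R * (2 * pi).
  rewrite !dE; move: e1 e2.
  move: (v.1%:~R) (v.2%:~R) (w.1%:~R) (w.2%:~R) (k.1%:~R) (k.2%:~R) => v1 v2 w1 w2 k1 k2 e1 e2.
  transitivity (v1 * (s' * v2 + t' * w2) - v2 * (s' * v1 + t' * w1)); first ring.
  by rewrite e1 e2; ring.
move=> /(congr1 (fun z => (detz v w)%:~R * z)); rewrite mulrA D' mul1r => ->.
by rewrite mulrDr mulrA D' mul1r intrM mulrA.
Qed.

Lemma latD v (s t : R) : lat v (s + t) = lat v s + lat v t.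
Proof. by rewrite /lat !mulrDl. Qed.

Lemma window_eq (t0 t t' : R) (k : int) : window t0 t -> window t0 t' ->
  t' = t + k%:~R * (2 * pi) -> t' = t.
Proof.
rewrite /window !ltr_norml => /andP[a b] /andP[c d] e.
have p0 := pi_gt0 R.
suff k0 : k = 0 by rewrite e k0 mul0r addr0.
have P0 : 0 < 2 * pi :> R by rewrite mulr_gt0.
have h3 : k%:~R * (2 * pi) < 1%:~R * (2 * pi) :> R by rewrite mulr1z mul1r; lra.
have h4 : (-1)%:~R * (2 * pi) < k%:~R * (2 * pi) :> R by rewrite mulrN1z mulN1r; lra.
by rewrite !(ltr_pM2r P0) !ltr_int in h3 h4; lia.
Qed.

End Lattice.

Ltac torus_ring :=
  rewrite /lat; repeat match goal with p : _ * _ |- _ => case: p => ? ? end;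
  congr pair; rewrite /= ?intrD ?intrM ?intrN; ring.

(** * Points of [M_alpha] and injectivity of the charts *)

Section Classes.
Context {R : realType}.
Variables (e : nat -> int) (alpha : R) (D : cusp_data R).
Hypothesis rD : represents e alpha D.
Hypothesis e_ge3 : forall j, (1 <= j)%N -> 3 <= e j.
Local Notation b := (cpos D).

Lemma row4_inj (a0 a1 a2 a3 b0 b1 b2 b3 : R) : row4 a0 a1 a2 a3 = row4 b0 b1 b2 b3 ->
  [/\ a0 = b0, a1 = b1, a2 = b2 & a3 = b3].
Proof.
move=> E.
have H (i : 'I_4) : [:: a0; a1; a2; a3]`_i = [:: b0; b1; b2; b3]`_i.
  by rewrite -!row4E E.
by split; [exact: (H 0)|exact: (H 1)|exact: (H 2)|exact: (H 3)].
Qed.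

Lemma open_edge_inj i j (x : R) : open_edge e i x -> open_edge e j x -> i = j.
Proof.
rewrite -(subrKC alpha x) !(open_edgeE rD); move: (x - alpha) => t [h1 h2] [h3 h4].
wlog ij : i j h1 h2 h3 h4 / (i < j)%N.
  by move=> W; case: (ltngtP i j) => // ij; [|apply/esym]; exact: W ij.
exfalso; case: j ij h3 h4 => // j; rewrite ltnS => ij h3 h4.
by have := cpos_leq D ij; lra.
Qed.

Lemma open_edge_corner i j : ~ open_edge e i (corner e j : R).
Proof.
rewrite (cornerE rD) (open_edgeE rD) => -[h1 h2].
case: i h1 h2 => [|i] h1 h2; first by have := cpos_leq D (leq0n j); lra.
case: (leqP j i) => ij; first by have := cpos_leq D ij; lra.
by have := cpos_leq D ij; lra.
Qed.

(** A point lies on at most one open edge, so collapsed vectors add up to collapsed vectors. With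
    opposites they form a subgroup, which makes [mclass] a family of cosets. *)
Lemma collapsedD (x y : R) c c' : collapsed e x y c -> collapsed e x y c' -> collapsed e x y (c + c').
Proof.
move=> [->|[[y0 [j [oj [s ->]]]]|[y0 H]]].
- by move=> H; rewrite (_ : (0, 0) + c' = c')//; case: (c') => a d; congr pair; rewrite /= add0r.
- move=> [->|[[_ [i [oi [s' ->]]]]|H]].
  + right; left; split=> //; exists j; split=> //; exists s.
    by rewrite /lat; congr pair; rewrite /= addr0.
  + have E := open_edge_inj oj oi; subst i.
    by right; left; split=> //; exists j; split=> //; exists (s + s'); rewrite latD.
  + by right; right.
- by move=> _; right; right.
Qed.

Lemma collapsedN (x y : R) c : collapsed e x y c -> collapsed e x y (- c).
Proof.
move=> [->|[[y0 [j [oj [s ->]]]]|H]].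
- by left; congr pair; rewrite /= oppr0.
- right; left; split=> //; exists j; split=> //; exists (- s).
  by rewrite /lat; congr pair; rewrite /= mulNr.
- by right; right.
Qed.

Lemma latZD (k k' : int * int) (s : R) : lat k s + lat k' s = lat (k + k') s.
Proof. by rewrite /lat; congr pair; rewrite /= intrD; ring. Qed.

Lemma latZN (k : int * int) (s : R) : - lat k s = lat (- k) s.
Proof. by rewrite /lat; congr pair; rewrite /= intrN; ring. Qed.

Lemma lat0 (s : R) : lat 0 s = 0.
Proof. by rewrite /lat; congr pair; rewrite /= mulr0. Qed.

Lemma mclass_mem (x y : R) z : mclass e x y z ((x, y), z).
Proof.
split=> //; exists 0, 0; split; first by left.
by rewrite /= lat0 !addr0.
Qed.

Lemma mclass_xy (x y : R) z x' y' z' : mclass e x y z = mclass e x' y' z' -> x = x' /\ y = y'.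
Proof.
move=> E; have := mclass_mem x y z; rewrite E => -[/= [-> ->] _]; by [].
Qed.

Lemma mclass_eqP (x y : R) z z' : mclass e x y z = mclass e x y z' <->
  exists k c, collapsed e x y c /\ z' = z + lat k (2 * pi) + c.
Proof.
split.
  move=> E; have := mclass_mem x y z'; rewrite -E => -[_ [k [c [H /= ->]]]].
  by exists k, c.
move=> [k [c [Hc ->]]]; apply/seteqP; split => p [p1 [k' [c' [Hc' E]]]].
  split=> //; exists (k' - k), (c' - c); split.
    by apply: collapsedD => //; exact: collapsedN.
  rewrite E -latZD -latZN; clear.
  by move: (lat k _) (lat k' _) => u v; torus_ring.
split=> //; exists (k + k'), (c + c'); split; first exact: collapsedD.
rewrite E -latZD -!addrA; congr (_ + (_ + _)).
by rewrite addrCA.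
Qed.

Lemma mclass_interior (x y : R) z z' : 0 < y -> mclass e x y z = mclass e x y z' <->
  exists k, z' = z + lat k (2 * pi).
Proof.
move=> y0; rewrite mclass_eqP; split; last first.
  by move=> [k ->]; exists k, 0; split; [left|rewrite addr0].
have yn : y <> 0 by move=> E; rewrite E ltxx in y0.
by move=> [k [c [[->|[[]|[]]]//]]] ->; exists k; rewrite addr0.
Qed.

Lemma mclass_edge (x : R) z z' j : open_edge e j x -> mclass e x 0 z = mclass e x 0 z' <->
  exists k s, z' = z + lat k (2 * pi) + lat (mn e j) s.
Proof.
move=> oj; rewrite mclass_eqP; split.
  move=> [k [c [[->|[[_ [i [oi [s ->]]]]|[_ [i xi]]]] ->]]].
  - by exists k, 0; rewrite /lat !mul0r.
  - by exists k, s; rewrite (open_edge_inj oj oi).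
  - by case: (@open_edge_corner j i); rewrite -xi.
move=> [k [s ->]]; exists k, (lat (mn e j) s); split=> //.
by right; left; split=> //; exists j; split=> //; exists s.
Qed.

Lemma mclass_corner z z' j : mclass e (corner e j : R) 0 z = mclass e (corner e j) 0 z'.
Proof.
apply/mclass_eqP; exists 0, (z' - z); split; last by rewrite lat0 addr0 subrKC.
by right; right; split=> //; exists j.
Qed.

Lemma lat_period (v : int * int) (s : R) (k : int) :
  lat v (s + k%:~R * (2 * pi)) = lat v s + lat (k * v.1, k * v.2) (2 * pi).
Proof. by rewrite /lat; congr pair; rewrite /= intrM; ring. Qed.

Lemma mn_detz j : detz (mn e j) (mn e j.+1) = 1.
Proof. by rewrite !(mnE e_ge3) /detz /=; apply: etrans (den_det e j); ring. Qed.

Lemma sval_inj (P P' : M_alpha e alpha) : sval P = sval P' -> P = P'.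
Proof. case: P P' => [S h] [S' h'] /= E; subst S'; congr exist; exact: Prop_irrelevance. Qed.

Lemma interior_chart_inj z0 (P P' : M_alpha e alpha) q :
  interior_chart z0 P q -> interior_chart z0 P' q -> P = P'.
Proof.
move=> [x [y [z1 [z2 [_ _ _ E ->]]]]] [x' [y' [z1' [z2' [_ _ _ E' /row4_inj[ex ey e1 e2]]]]]].
by subst; apply: sval_inj; rewrite E E'.
Qed.

Lemma interior_chart_fun z0 (P : M_alpha e alpha) q q' :
  interior_chart z0 P q -> interior_chart z0 P q' -> q = q'.
Proof.
move=> [x [y [z1 [z2 [[xa y0] w1 w2 E ->]]]]] [x' [y' [z1' [z2' [_ w1' w2' E' ->]]]]].
move: E'; rewrite E => E'; have [ex ey] := mclass_xy E'; subst x' y'.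
have [k [e1 e2]] := (mclass_interior _ _ _ y0).1 E'.
have p1 : z1' = z1 by apply: (window_eq w1 w1' (k := k.1)); rewrite e1 mulrC.
have p2 : z2' = z2 by apply: (window_eq w2 w2' (k := k.2)); rewrite e2 mulrC.
by rewrite p1 p2.
Qed.

Lemma edge_chart_inj j pq t0 (P P' : M_alpha e alpha) q :
  edge_chart j pq t0 P q -> edge_chart j pq t0 P' q -> P = P'.
Proof.
move=> [_ [x [y [s [t [[[xa y0] oe] _ E ->]]]]]].
move=> [_ [x' [y' [s' [t' [[[_ y0'] _] _ E' /row4_inj[ex et ec es]]]]]]].
subst x' t'; have [ey H] := polar_inj y0 y0' ec es; subst y'.
apply: sval_inj; rewrite E E'.
have [yy|yn] := eqVneq y 0.
  subst y; apply/(mclass_edge _ _ (oe erefl)); exists 0, (s' - s).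
  rewrite lat0 addr0 addrAC -latD.
  by congr (lat _ _ + _); ring.
case: H => [yy|[k ->]]; first by rewrite yy eqxx in yn.
apply/mclass_interior; first by rewrite lt_neqAle eq_sym yn.
exists (k * (mn e j).1, k * (mn e j).2); by rewrite lat_period addrAC.
Qed.

Lemma edge_chart_fun j pq t0 (P : M_alpha e alpha) q q' :
  edge_chart j pq t0 P q -> edge_chart j pq t0 P q' -> q = q'.
Proof.
move=> [zb [x [y [s [t [[[xa y0] oe] w E ->]]]]]].
move=> [_ [x' [y' [s' [t' [_ w' E' ->]]]]]].
move: E'; rewrite E => E'; have [ex ey] := mclass_xy E'; subst x' y'.
have [yy|yn] := eqVneq y 0.
  subst y; have [k [c H]] := (mclass_edge _ _ (oe erefl)).1 E'.
  have H' : lat (mn e j) s' + lat pq t' = lat (mn e j) (s + c) + lat pq t + lat k (2 * pi).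
    by rewrite H latD -!addrA; congr (_ + _); rewrite [RHS]addrC -!addrA.
  have [_ et] := lat_solve (zbasis_det zb) H'.
  by rewrite (window_eq w w' et) !mul0r.
have yp : 0 < y by rewrite lt_neqAle eq_sym yn.
have [k H] := (mclass_interior _ _ _ yp).1 E'.
have [es et] := lat_solve (zbasis_det zb) H.
rewrite (window_eq w w' et) es.
by have [-> ->] := cos_sin_period s (detz (mn e j) pq * detz k pq).
Qed.

(** The modulus r1^2 + r2^2 of (r2 + i r1)^2 is determined together with its real and imaginary
    parts. *)
Lemma corner_radii (r1 r2 r1' r2' : R) : 0 <= r1 -> 0 <= r2 -> 0 <= r1' -> 0 <= r2' ->
  r2 ^+ 2 - r1 ^+ 2 = r2' ^+ 2 - r1' ^+ 2 -> 2 * r1 * r2 = 2 * r1' * r2' -> r1 = r1' /\ r2 = r2'.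
Proof.
move=> a1 a2 a1' a2' e1 e2.
have S : r2 ^+ 2 + r1 ^+ 2 = r2' ^+ 2 + r1' ^+ 2.
  have : (r2 ^+ 2 + r1 ^+ 2) ^+ 2 = (r2' ^+ 2 + r1' ^+ 2) ^+ 2.
    transitivity ((r2 ^+ 2 - r1 ^+ 2) ^+ 2 + (2 * r1 * r2) ^+ 2); first ring.
    rewrite e1 e2; ring.
  by move/eqP; rewrite eqrXn2// ?addr_ge0 ?sqr_ge0// => /eqP.
split; apply/eqP; rewrite -(@eqrXn2 _ 2)//; apply/eqP; lra.
Qed.

(** These are the four strata of a corner chart: the interior, the two adjacent edges and the
    corner. *)
Lemma corner_chart_edge j (x y r1 r2 : R) : 0 <= r1 -> 0 <= r2 ->
  (y = 0 -> [\/ open_edge e j x, open_edge e j.+1 x | x = corner e j]) ->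
  x - corner e j = r2 ^+ 2 - r1 ^+ 2 -> y = 2 * r1 * r2 ->
  [\/ 0 < y /\ 0 < r1 /\ 0 < r2,
      [/\ y = 0, r1 = 0, 0 < r2 & open_edge e j x],
      [/\ y = 0, 0 < r1, r2 = 0 & open_edge e j.+1 x] |
      [/\ y = 0, r1 = 0, r2 = 0 & x = corner e j]].
Proof.
move=> a1 a2 H ex ey.
move: a1; rewrite le_eqVlt => /predU1P[r10|p1]; move: a2; rewrite le_eqVlt => /predU1P[r20|p2].
- by constructor 4; split=> //; subst; rewrite ?mulr0//; move: ex; rewrite subrr => /subr0_eq.
- constructor 2; have y0 : y = 0 by rewrite ey -r10 mulr0 mul0r.
  split=> //; case: (H y0) => // H'.
    move: H'; rewrite -[x](subrK (corner e j)) ex -r10 (cornerE rD) addrC -addrA (open_edgeE rD) => -[_].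
    by have : 0 < r2 ^+ 2 by [rewrite exprn_gt0]; rewrite expr0n /=; lra.
  exfalso; have : 0 < r2 ^+ 2 by rewrite exprn_gt0.
  by move: ex; rewrite H' -r10 subrr expr0n /=; lra.
- constructor 3; have y0 : y = 0 by rewrite ey -r20 mulr0.
  split=> //; case: (H y0) => // H'.
    move: H'; rewrite -[x](subrK (corner e j)) ex -r20 (cornerE rD) addrC -addrA (open_edgeE rD) => -[+ _].
    by have : 0 < r1 ^+ 2 by [rewrite exprn_gt0]; rewrite expr0n /=; lra.
  exfalso; have : 0 < r1 ^+ 2 by rewrite exprn_gt0.
  by move: ex; rewrite H' -r20 subrr expr0n /=; lra.
- by constructor 1; split=> //; rewrite ey !mulr_gt0.
Qed.

(** An angle is lost from the coordinates exactly when its radius vanishes, and its direction is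
    then among those collapsed on that stratum. *)
Lemma corner_chart_inj j (P P' : M_alpha e alpha) q :
  corner_chart j P q -> corner_chart j P' q -> P = P'.
Proof.
move=> [x [y [r1 [r2 [s1 [s2 [[_ oe] [a1 a2] [ex ey] E ->]]]]]]].
move=> [x' [y' [r1' [r2' [s1' [s2' [_ [a1' a2'] [ex' ey'] E' /row4_inj[c1 c2 c3 c4]]]]]]]].
have [e1 H1] := polar_inj a1 a1' c1 c2; have [e2 H2] := polar_inj a2 a2' c3 c4.
subst r1' r2'; have exx : x = x' by move: ex; rewrite -ex' => /addIr.
have eyy : y = y' by rewrite ey ey'.
subst x'; rewrite -{}eyy in E' ey'.
apply: sval_inj; rewrite E E'.
have per (r s s' : R) : (r = 0 \/ exists k : int, s' = s + k%:~R * (2 * pi)) -> 0 < r ->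
    exists k : int, s' = s + k%:~R * (2 * pi) :> R.
  by move=> [->|//]; rewrite ltxx.
case: (corner_chart_edge a1 a2 oe ex ey) => [[y0 [p1 p2]]|[y0 _ p2 o]|[y0 p1 _ o]|[y0 _ _ xc]].
- have [k1 ->] := per _ _ _ H1 p1; have [k2 ->] := per _ _ _ H2 p2.
  apply/mclass_interior => //; rewrite !lat_period.
  eexists; rewrite addrACA latZD; reflexivity.
- have [k2 ->] := per _ _ _ H2 p2; rewrite y0; apply/(mclass_edge _ _ o).
  by exists (k2 * (mn e j.+1).1, k2 * (mn e j.+1).2), (s1' - s1); torus_ring.
- have [k1 ->] := per _ _ _ H1 p1; rewrite y0; apply/(mclass_edge _ _ o).
  by exists (k1 * (mn e j).1, k1 * (mn e j).2), (s2' - s2); torus_ring.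
- by rewrite y0 xc; exact: mclass_corner.
Qed.

Lemma corner_chart_fun j (P : M_alpha e alpha) q q' :
  corner_chart j P q -> corner_chart j P q' -> q = q'.
Proof.
move=> [x [y [r1 [r2 [s1 [s2 [[_ oe] [a1 a2] [ex ey] E ->]]]]]]].
move=> [x' [y' [r1' [r2' [s1' [s2' [_ [a1' a2'] [ex' ey'] E' ->]]]]]]].
move: E'; rewrite E => E'; have [exx eyy] := mclass_xy E'; subst x'; rewrite -eyy in ey' E'.
have [e1 e2] := corner_radii a1 a2 a1' a2' (etrans (esym ex) ex') (etrans (esym ey) ey').
subst r1' r2'.
have D1 : detz (mn e j) (mn e j.+1) * detz (mn e j) (mn e j.+1) = 1 by rewrite mn_detz.
case: (corner_chart_edge a1 a2 oe ex ey) => [[y0 [p1 p2]]|[y0 z1 p2 o]|[y0 p1 z2 o]|[y0 z1 z2 _]].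
- have [k H] := (mclass_interior _ _ _ y0).1 E'.
  have [-> ->] := lat_solve D1 H.
  by rewrite !(cos_sin_period _ _).1 !(cos_sin_period _ _).2.
- rewrite y0 in E'; have [k [c H]] := (mclass_edge _ _ o).1 E'.
  have H' : lat (mn e j) s1' + lat (mn e j.+1) s2' =
      lat (mn e j) (s1 + c) + lat (mn e j.+1) s2 + lat k (2 * pi).
    by rewrite H latD -!addrA; congr (_ + _); rewrite [RHS]addrC -!addrA.
  have [_ ->] := lat_solve D1 H'.
  by rewrite z1 !mul0r !(cos_sin_period _ _).1 !(cos_sin_period _ _).2.
- rewrite y0 in E'; have [k [c H]] := (mclass_edge _ _ o).1 E'.
  have H' : lat (mn e j) s1' + lat (mn e j.+1) s2' =
      lat (mn e j) s1 + lat (mn e j.+1) (s2 + c) + lat k (2 * pi).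
    by rewrite H latD -!addrA; congr (_ + (_ + _)); rewrite addrC.
  have [-> _] := lat_solve D1 H'.
  by rewrite z2 !mul0r !(cos_sin_period _ _).1 !(cos_sin_period _ _).2.
- by rewrite z1 z2 !mul0r.
Qed.

Lemma atlas_chart_inj (c : chart_index (M_alpha_atlas e alpha)) P P' q :
  chart c P q -> chart c P' q -> P = P'.
Proof.
case: c => [z0|j pq t0|j]; [exact: interior_chart_inj|exact: edge_chart_inj|].
exact: corner_chart_inj.
Qed.

Lemma atlas_chart_fun (c : chart_index (M_alpha_atlas e alpha)) P q q' :
  chart c P q -> chart c P q' -> q = q'.
Proof.
case: c => [z0|j pq t0|j]; [exact: interior_chart_fun|exact: edge_chart_fun|].
exact: corner_chart_fun.
Qed.

End Classes.

(** * Coordinate changes *)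

Section Differentials.
Context {R : realType} {n : nat}.
Implicit Types (f g : 'rV[R]_n -> R) (q v : 'rV[R]_n) (df dg : 'rV[R]_n -> R).

(** With the differential as an explicit argument, the tactic of the same name computes it by
    unification. *)
Definition has_diff q f df := differentiable f q /\ 'd f q =1 df.

Lemma has_diffE q f df dg : has_diff q f df -> df =1 dg -> has_diff q f dg.
Proof. by move=> [a E] F; split=> // v; rewrite E F. Qed.

Lemma has_diff_is q f df : has_diff q f df -> is_diff q f df.
Proof. by move=> [a E]; apply: DiffDef => //; exact/funext. Qed.

Lemma is_diff_has q f df : is_diff q f df -> has_diff q f df.
Proof. by move=> H; split; [exact: ex_diff|move=> v; exact: (congr1 (fun h => h v) (@diff_val _ _ _ _ _ _ _ H))]. Qed.

Lemma has_diff_cst q c : has_diff q (fun=> c) (fun=> 0).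
Proof. exact: is_diff_has (is_diff_cst c q). Qed.

Lemma has_diff_coord q i : has_diff q (fun z => z 0 i) (fun v => v 0 i).
Proof.
split; first exact: differentiable_coord.
move=> v; have d : differentiable (id : 'rV[R]_n -> 'rV[R]_n) q by [].
apply: etrans (diff_coord i v d) _.
by congr (fun_of_matrix _ 0 i); exact: (congr1 (fun h => h v) (@diff_val _ _ _ _ _ _ _ (is_diff_id q))).
Qed.

Lemma has_diffD q f g df dg : has_diff q f df -> has_diff q g dg ->
  has_diff q (fun z => f z + g z) (fun v => df v + dg v).
Proof. by move=> /has_diff_is F /has_diff_is G; exact: is_diff_has (is_diffD F G). Qed.

Lemma has_diffM q f g df dg : has_diff q f df -> has_diff q g dg ->
  has_diff q (fun z => f z * g z) (fun v => f q * dg v + g q * df v).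
Proof. by move=> /has_diff_is F /has_diff_is G; exact: is_diff_has (is_diffM F G). Qed.

Lemma has_diffN q f df : has_diff q f df -> has_diff q (fun z => - f z) (fun v => - df v).
Proof. by move=> /has_diff_is F; exact: is_diff_has (is_diffN F). Qed.

Lemma has_diff_comp q (h : R -> R) f df l : is_derive (f q) 1 h l -> has_diff q f df ->
  has_diff q (fun z => h (f z)) (fun v => df v * l).
Proof.
move=> [dv E] /has_diff_is F.
have ds : differentiable h (f q) by apply/derivable1_diffP.
have H : is_diff (f q) h (fun t => t * l).
  by apply: DiffDef => //; rewrite diff1E// derive1E E; apply/funext.
exact: is_diff_has (@is_diff_comp _ _ _ _ f df h _ q F H).
Qed.

Lemma has_diff_sqrt q f df : 0 < f q -> has_diff q f df ->
  has_diff q (fun z => Num.sqrt (f z)) (fun v => df v * (2 * Num.sqrt (f q))^-1).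
Proof. by move=> f0; exact: has_diff_comp (is_derive1_sqrt f0). Qed.

Lemma has_diff_cos q f df : has_diff q f df ->
  has_diff q (fun z => cos (f z)) (fun v => df v * - sin (f q)).
Proof. exact: has_diff_comp (is_derive_cos _). Qed.

Lemma has_diff_sin q f df : has_diff q f df ->
  has_diff q (fun z => sin (f z)) (fun v => df v * cos (f q)).
Proof. exact: has_diff_comp (is_derive_sin _). Qed.

Lemma has_diffV q f df : f q != 0 -> has_diff q f df ->
  has_diff q (fun z => (f z)^-1) (fun v => df v * - (f q) ^- 2).
Proof.
move=> f0; apply: (has_diff_comp (h := GRing.inv)).
have H := @is_deriveV _ id (f q) 1 1 f0 (is_derive_id _ _).
by apply: (is_derive_eq H); rewrite -[_ *: _]/(_ * _) mulr1.
Qed.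

(** d arg = (X dY - Y dX) / (X^2 + Y^2) for every branch; rotating by - s0 reduces it to the
    derivative of the arctangent. *)
Lemma has_diff_arg q s0 f g df dg : 0 < f q * cos s0 + g q * sin s0 ->
  has_diff q f df -> has_diff q g dg ->
  has_diff q (fun z => arg_near s0 (f z) (g z))
    (fun v => (f q * dg v - g q * df v) / (f q ^+ 2 + g q ^+ 2)).
Proof.
move=> p0 F G; rewrite /arg_near.
have cs := cos2Dsin2 s0.
have P := has_diffD (has_diffM F (has_diff_cst q (cos s0))) (has_diffM G (has_diff_cst q (sin s0))).
have M := has_diffD (has_diffM G (has_diff_cst q (cos s0))) (has_diffN (has_diffM F (has_diff_cst q (sin s0)))).
have pn : f q * cos s0 + g q * sin s0 != 0 by rewrite gt_eqF.
have H := has_diffD (has_diff_cst q s0) (has_diff_comp (is_derive1_atan _) (has_diffM M (has_diffV (f := fun z => f z * cos s0 + g z * sin s0) pn P))).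
apply: (has_diffE H) => v /=.
move: cs p0 pn; move: (cos s0) (sin s0) (f q) (g q) (df v) (dg v) => c s a b da db cs p0 pn.
have N : a ^+ 2 + b ^+ 2 = (a * c + b * s) ^+ 2 + (b * c - a * s) ^+ 2.
  by rewrite -[LHS]mulr1 -cs; ring.
have n0 : (a * c + b * s) ^+ 2 + (b * c - a * s) ^+ 2 != 0.
  by rewrite gt_eqF// ltr_wpDr ?sqr_ge0// exprn_gt0.
have -> : a * db - b * da = (c ^+ 2 + s ^+ 2) * (a * db - b * da) by rewrite cs mul1r.
rewrite N; set p := a * c + b * s in pn n0 *; set m := b * c - a * s in n0 *.
have -> : 1 + (m / p) ^+ 2 = (p ^+ 2 + m ^+ 2) / p ^+ 2 by field.
have -> : (c ^+ 2 + s ^+ 2) * (a * db - b * da) =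
  p * (db * c - da * s) - m * (da * c + db * s) by rewrite /p /m; ring.
by field; rewrite n0 pn.
Qed.

End Differentials.

Ltac has_diff := first
  [ eassumption | exact: has_diff_cst | exact: has_diff_coord
  | (apply: has_diffN; has_diff) | (apply: has_diffD; has_diff) | (apply: has_diffM; has_diff)
  | (apply: has_diff_cos; has_diff) | (apply: has_diff_sin; has_diff) ].

Section RowMaps.
Context {R : realType}.
Implicit Types a b c d : 'rV[R]_4 -> R.

Lemma diff_row4 (q : 'rV[R]_4) a b c d da db dc dd : has_diff q a da -> has_diff q b db ->
  has_diff q c dc -> has_diff q d dd ->
  differentiable (fun z => row4 (a z) (b z) (c z) (d z)) q /\
  'd (fun z => row4 (a z) (b z) (c z) (d z)) q =1 fun v => row4 (da v) (db v) (dc v) (dd v).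
Proof.
move=> [a1 a2] [b1 b2] [c1 c2] [d1 d2].
pose h (i : 'I_4) z := [:: a z; b z; c z; d z]`_i.
have E i : (fun z => row4 (a z) (b z) (c z) (d z) 0 i) = h i.
  by apply/funext => z; rewrite mxE.
have D : differentiable (fun z => row4 (a z) (b z) (c z) (d z)) q.
  by apply: differentiable_rV => i; rewrite E; case: i => [[|[|[|[|//]]]] p].
split=> // v; apply/rowP => i; rewrite -(diff_coord i v D) E mxE.
by case: i => [[|[|[|[|//]]]] p] /=.
Qed.

Lemma near_gt0 {T : topologicalType} (h : T -> R) q : {for q, continuous h} -> 0 < h q ->
  \forall z \near q, 0 < h z.
Proof. by move=> hc h0; exact: (hc [set x | 0 < x] (lt_nbhsr h0)). Qed.

Lemma near_window {T : topologicalType} (h : T -> R) (t0 : R) q : {for q, continuous h} ->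
  window t0 (h q) -> \forall z \near q, window t0 (h z).
Proof.
move=> hc w; apply: (hc (window t0)).
have : nbhs (h q) (ball t0 pi).
  by apply: open_nbhs_nbhs; split; [exact: ball_open|rewrite -ball_normE /= distrC].
by apply: filterS => t; rewrite -ball_normE /= distrC.
Qed.

Lemma polar_exists (X Y : R) : exists s, X = Num.sqrt (X ^+ 2 + Y ^+ 2) * cos s /\
  Y = Num.sqrt (X ^+ 2 + Y ^+ 2) * sin s.
Proof.
case: (ltgtP X 0) => [x0|x0|->].
- by exists (arg_near pi X Y); apply: arg_nearE; rewrite cospi sinpi; lra.
- by exists (arg_near 0 X Y); apply: arg_nearE; rewrite cos0 sin0; lra.
case: (ltgtP Y 0) => [y0|y0|->].
- exists (arg_near (- (pi / 2)) 0 Y); apply: arg_nearE.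
  by rewrite sinN sin_pihalf; lra.
- by exists (arg_near (pi / 2) 0 Y); apply: arg_nearE; rewrite sin_pihalf; lra.
by exists 0; rewrite expr0n addr0 sqrtr0 !mul0r.
Qed.

End RowMaps.

(** * Points and domains of the charts *)

Section ChartPoints.
Context {R : realType}.
Variables (e : nat -> int) (alpha : R) (D : cusp_data R).
Hypothesis rD : represents e alpha D.
Local Notation b := (cpos D).
Implicit Types (q : 'rV[R]_4).

Definition point (x y : R) (z : R * R) (H : Dplus_closed alpha x y) : M_alpha e alpha :=
  exist _ (mclass e x y z) (ex_intro _ x (ex_intro _ y (ex_intro _ z (conj H erefl)))).

(** On s = y^2 the open region is exactly what the chart covers; hence coordinate vectors near a
    given one again come from points of [M_alpha]. *)
Lemma edge_reg_closed j (x y : R) : 0 <= y -> edge_reg D j (x - alpha) (y ^+ 2) <->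
  (Dplus_closed alpha x y /\ (y = 0 -> open_edge e j x)).
Proof.
move=> y0; rewrite -{2 3}(subrKC alpha x) (open_edgeE rD); move: (x - alpha) => t.
rewrite /Dplus_closed ltrDl; split.
  move=> [t0 H]; split=> // yy; case: H => [|[h1 _ h2]]; first by rewrite yy expr0n ltxx.
  by split=> //; case: j h1 h2 => // j _ [].
move=> [[t0 _] H]; split=> //.
move: y0; rewrite le_eqVlt => /predU1P[yy|y0]; last by left; rewrite exprn_gt0.
right; have [h1 h2] := H (esym yy); rewrite -yy expr0n /= !add0r.
split=> //; first by rewrite exprn_gt0 ?subr_gt0.
by case: j h1 h2 H => // j h1 h2 _; rewrite /below_next add0r exprn_gt0 ?subr_gt0.
Qed.

Lemma corner_reg_closed j (x y : R) : 0 <= y -> corner_reg D j (x - alpha) (y ^+ 2) <->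
  (Dplus_closed alpha x y /\ (y = 0 -> [\/ open_edge e j x, open_edge e j.+1 x | x = corner e j])).
Proof.
move=> y0.
have oE i : open_edge e i x = (b i < x - alpha /\ (if i is i'.+1 then x - alpha < b i' else True)).
  by apply: propext; rewrite -(open_edgeE rD) subrKC.
have cE : (x = corner e j) = (x - alpha = b j).
  by apply: propext; rewrite (cornerE rD); split => [->|<-]; rewrite ?subrKC//; ring.
rewrite cE !oE /Dplus_closed -subr_gt0 {cE oE}.
move: (x - alpha) => t; have bj := cpos_ltn D (ltnSn j); split.
  move=> [t0 H]; split=> // yy; case: H => [|[h1 _ h2]]; first by rewrite yy expr0n ltxx.
  case: (ltgtP t (b j)) => [tb|tb|tb].
  - by constructor 2.
  - by constructor 1; split=> //; case: j h1 h2 bj tb => // j _ [].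
  - by constructor 3.
move=> [[t0 _] H]; split=> //.
move: y0; rewrite le_eqVlt => /predU1P[yy|y0]; last by left; rewrite exprn_gt0.
right; rewrite -yy expr0n /= add0r.
have [h1 h2] : b j.+1 < t /\ (if j is j'.+1 then t < b j' else True).
  case: (H (esym yy)) => [[h1 h2]|[h1 h2]|h]; split=> //; first exact: lt_trans h1.
  - by case: j h2 {H bj h1} => // j h2; apply: lt_trans h2 _; exact: cpos_ltn.
  - by rewrite h.
  - by rewrite h; case: j {H bj h} => // j; exact: cpos_ltn.
split=> //; first by rewrite exprn_gt0 ?subr_gt0.
by case: j h1 h2 {H bj} => // j h1 h2; rewrite /below_next add0r exprn_gt0 ?subr_gt0.
Qed.

Lemma edge_reg_corner_reg j x s : edge_reg D j.+1 x s -> corner_reg D j x s.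
Proof.
move=> [x0 [s0|[xb sb [h1 h2]]]]; first by split=> //; left.
split=> //; right; split=> //; case: j xb sb h1 h2 => // j _ sb h1 h2.
have bb := cpos_ltn D (ltnSn j); split; first exact: lt_trans bb.
apply: lt_le_trans h2 _; rewrite lerD2l lerXn2r ?nnegrE; lra.
Qed.

Lemma eS_polar q y s : q 0 2 = y * cos s -> q 0 3 = y * sin s -> eS q = y ^+ 2.
Proof.
by move=> e2 e3; rewrite /eS e2 e3 !exprMn -mulrDr cos2Dsin2 mulr1.
Qed.

Lemma edge_chartI j pq t0 P q y s : zbasis (mn e j) pq -> edge_dom D alpha j q ->
  window t0 (q 0 1) -> 0 <= y -> q 0 2 = y * cos s -> q 0 3 = y * sin s ->
  sval P = mclass e (q 0 0) y (lat (mn e j) s + lat pq (q 0 1)) ->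
  edge_chart (e := e) (alpha := alpha) j pq t0 P q.
Proof.
move=> zb dq w y0 e2 e3 E; split=> //; exists (q 0 0), y, s, (q 0 1); split=> //.
  by apply/edge_reg_closed => //; rewrite -(eS_polar e2 e3).
apply/rowP => i; rewrite mxE.
by case: i => [[|[|[|[|//]]]] p] /=; rewrite -?e2 -?e3; congr (q _ _); exact: val_inj.
Qed.

Lemma edge_chartE j pq t0 P q : edge_chart (e := e) (alpha := alpha) j pq t0 P q ->
  [/\ zbasis (mn e j) pq, edge_dom D alpha j q, window t0 (q 0 1) & exists y s,
   [/\ 0 <= y, q 0 2 = y * cos s, q 0 3 = y * sin s &
      sval P = mclass e (q 0 0) y (lat (mn e j) s + lat pq (q 0 1))]].
Proof.
move=> [zb [x [y [s [t [H w E ->]]]]]].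
have y0 : 0 <= y by case: H => -[].
have e2 : row4 x t (y * cos s) (y * sin s) 0 2 = y * cos s by rewrite row4E.
have e3 : row4 x t (y * cos s) (y * sin s) 0 3 = y * sin s by rewrite row4E.
split=> //; last by exists y, s; rewrite !row4E.
  by rewrite /edge_dom /= (eS_polar e2 e3) /eX row4E; exact/edge_reg_closed.
by rewrite row4E.
Qed.

Lemma cR_polar q r1 s1 r2 s2 : q = row4 (r1 * cos s1) (r1 * sin s1) (r2 * cos s2) (r2 * sin s2) ->
  cR1 q = r1 ^+ 2 /\ cR2 q = r2 ^+ 2.
Proof.
by move=> ->; rewrite /cR1 /cR2 !row4E /= !exprMn -!mulrDr !cos2Dsin2 !mulr1.
Qed.

Lemma corner_chartI j P q r1 s1 r2 s2 : corner_dom D j q -> 0 <= r1 -> 0 <= r2 ->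
  q = row4 (r1 * cos s1) (r1 * sin s1) (r2 * cos s2) (r2 * sin s2) ->
  sval P = mclass e (corner e j + cR2 q - cR1 q) (2 * r1 * r2)
    (lat (mn e j) s1 + lat (mn e j.+1) s2) ->
  corner_chart (e := e) (alpha := alpha) j P q.
Proof.
move=> dq p1 p2 qE E; have [e1 e2] := cR_polar qE.
exists (corner e j + cR2 q - cR1 q), (2 * r1 * r2), r1, r2, s1, s2; split=> //.
  apply/corner_reg_closed; first by rewrite !mulr_ge0.
  move: dq; rewrite /corner_dom /= (cornerE rD) e1 e2; congr (corner_reg _ _ _ _); ring.
by rewrite e1 e2; split=> //; ring.
Qed.

Lemma corner_chartE j P q : corner_chart (e := e) (alpha := alpha) j P q ->
  corner_dom D j q /\ exists r1 s1 r2 s2, [/\ 0 <= r1, 0 <= r2,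
   q = row4 (r1 * cos s1) (r1 * sin s1) (r2 * cos s2) (r2 * sin s2) &
  sval P = mclass e (corner e j + cR2 q - cR1 q) (2 * r1 * r2)
    (lat (mn e j) s1 + lat (mn e j.+1) s2)].
Proof.
move=> [x [y [r1 [r2 [s1 [s2 [H [p1 p2] [ex ey] E qE]]]]]]].
have [e1 e2] := cR_polar qE.
have xE : x = corner e j + cR2 q - cR1 q by rewrite e1 e2 -addrA -ex subrKC.
split; last by exists r1, s1, r2, s2; split=> //; rewrite -xE -ey.
have /corner_reg_closed : 0 <= y by case: H => -[].
move=> /(_ j x) [_ /(_ H)]; rewrite /corner_dom /= xE ey (cornerE rD) e1 e2.
congr (corner_reg _ _ _ _); ring.
Qed.

End ChartPoints.

(** * From an interior chart to an edge chart *)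

Section InteriorEdge.
Context {R : realType}.
Variables (e : nat -> int) (alpha : R) (D : cusp_data R).
Hypothesis rD : represents e alpha D.
Implicit Types (q v : 'rV[R]_4).

Definition atlas_metric (c : chart_index (M_alpha_atlas e alpha)) : 'rV[R]_4 -> 'M[R]_4 :=
  match c with
  | Interior _ => g_alpha e alpha
  | Edge j pq _ => edge_metric D alpha j pq
  | Corner j => corner_metric D j
  end.

Lemma eps2_shear (v w : int * int) : eps2 (shear alpha v) (shear alpha w) = (detz v w)%:~R.
Proof. by rewrite /eps2 /shear /detz /= intrB !intrM; ring. Qed.

Lemma shear_mn j : shear alpha (mn e j) = mnr D j.
Proof. by rewrite /shear /mnr; have [-> ->] := rD j; congr pair; ring. Qed.

Lemma wI_gI j x s : quadrant x s -> wI (Ffun D x s) (dx2 (Ffun D) x s) (gfun D x s) s = wv D j x s.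
Proof.
move=> H; have [x0 s0] := H; rewrite /wv fI_quadrant// fxI_quadrant// gIE//.
- exact: quadrant_corner_reg.
- exact: ltW.
- by rewrite ltr_wpDl ?sqr_ge0.
Qed.

(** The index j is free: over the interior the expansions at all corners agree, so the one that
    suits a given edge can be chosen. The shear acts on dz too and leaves eps unchanged. *)
Lemma qf_g_alpha j q v : alpha < q 0 0 -> 0 < q 0 1 ->
  let xi := q 0 0 - alpha in let s := q 0 1 ^+ 2 in
  let dz := (v 0 2, v 0 3 - alpha * v 0 2) in
  qf (g_alpha e alpha q) v = wv D j xi s / fI D j xi s ^+ 2 *
    (v 0 0 ^+ 2 + v 0 1 ^+ 2 + (wv D j xi s ^+ 2)^-1 *
      ((q 0 1 * eps2 (V1v D j xi s) dz) ^+ 2 + eps2 (v2v D j xi s) dz ^+ 2)).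
Proof.
move=> xa y0 xi s dz.
have Q : quadrant xi s by exact: quadrant_alpha.
have w0 : 0 < wv D j xi s.
  by apply: w_gt0; [exact: quadrant_corner_reg|rewrite sqr_ge0|rewrite ltr_wpDl ?sqr_ge0 ?exprn_gt0].
rewrite /g_alpha /v1_alpha /v2_alpha (w_alphaE rD)// -/xi -/s (wI_gI j Q) (gtr0_norm w0).
rewrite (f_alphaE rD)// (fx_alphaE rD)// (fy_alphaE rD)// -/xi -/s -(fI_quadrant D j Q) -(fxI_quadrant D j Q).
rewrite -(@gIE _ D j xi s) //; last 3 first.
- exact: quadrant_corner_reg.
- by rewrite sqr_ge0.
- by rewrite ltr_wpDl ?sqr_ge0 ?exprn_gt0.
rewrite qfZ !qfD qfZ qfD !qf_sq /form_dx /form_dy /eps_dz !pr_row4.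
congr (_ * (_ + _ * _)); first ring.
rewrite /V1v /v2v /eps2 /dz /xi /s /=.
by congr (_ ^+ 2 + _ ^+ 2); ring.
Qed.

Lemma edge_metric_polar j pq q y s : q 0 2 = y * cos s -> q 0 3 = y * sin s ->
  edge_metric D alpha j pq q =
  edge_form (wv D j (q 0 0 - alpha) (y ^+ 2)) (fI D j (q 0 0 - alpha) (y ^+ 2)) (y ^+ 2)
    (V1v D j (q 0 0 - alpha) (y ^+ 2)) (V2v D j (q 0 0 - alpha) (y ^+ 2))
    (mnr D j) (shear alpha pq) (y * cos s) (y * sin s).
Proof. by move=> e2 e3; rewrite /edge_metric (eS_polar e2 e3) e2 e3. Qed.

(** [ds] and [dt] are the coordinates of dz in the lattice basis, by Cramer's rule; the angle t
    itself does not enter the metric. *)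
Lemma interior_edge_law j pq q v (t s : R) : zbasis (mn e j) pq ->
  alpha < q 0 0 -> 0 < q 0 1 ->
  let del := (detz (mn e j) pq)%:~R in
  let ds := del * (v 0 2 * pq.2%:~R - v 0 3 * pq.1%:~R) in
  let dt := del * ((mn e j).1%:~R * v 0 3 - (mn e j).2%:~R * v 0 2) in
  qf (g_alpha e alpha q) v =
  qf (edge_metric D alpha j pq (row4 (q 0 0) t (q 0 1 * cos s) (q 0 1 * sin s)))
     (row4 (v 0 0) dt (cos s * v 0 1 - q 0 1 * sin s * ds) (sin s * v 0 1 + q 0 1 * cos s * ds)).
Proof.
move=> zb xa y0 del ds dt.
have d2 : del * del = 1 by rewrite -intrM (zbasis_det zb).
rewrite (qf_g_alpha j)//.
have Q := quadrant_alpha xa y0.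
have s0 : 0 < q 0 1 ^+ 2 by rewrite exprn_gt0.
have [r0 z0] : 0 < rm D j (q 0 0 - alpha) (q 0 1 ^+ 2) /\
    0 < rm D j (q 0 0 - alpha) (q 0 1 ^+ 2) + (q 0 0 - alpha) - cpos D j.
  have [? ?] : 0 < (q 0 0 - alpha - cpos D j) ^+ 2 + q 0 1 ^+ 2 /\
    0 < rm D j (q 0 0 - alpha) (q 0 1 ^+ 2) + (q 0 0 - alpha) - cpos D j.
    by apply: edge_reg_pos; split; [case: Q|left].
  by split=> //; rewrite sqrtr_gt0.
have v2E := v2vE (ltW s0) r0 z0.
have wE := eps2_V1v_v2v D j (q 0 0 - alpha) (q 0 1 ^+ 2).
rewrite (@edge_metric_polar j pq _ (q 0 1) s) ?row4E//=.
rewrite edge_form_interior ?cos2Dsin2 ?gt_eqF//; last 2 first.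
- by apply: w_gt0; [exact: quadrant_corner_reg|exact: ltW|rewrite ltr_wpDl ?sqr_ge0].
- by rewrite -v2E wE.
rewrite -v2E.
have E u : eps2 u (mnr D j) * ds + eps2 u (shear alpha pq) * dt =
    eps2 u (v 0 2, v 0 3 - alpha * v 0 2).
  rewrite -shear_mn /eps2 /shear /ds /dt /=.
  have dE : del = (mn e j).1%:~R * pq.2%:~R - (mn e j).2%:~R * pq.1%:~R.
    by rewrite /del /detz intrB !intrM.
  transitivity (del * del * (u.1 * (v 0 3 - alpha * v 0 2) - u.2 * v 0 2)).
    by rewrite [X in _ = X * _ * _]dE; ring.
  by rewrite d2 mul1r.
by rewrite !E.
Qed.

End InteriorEdge.

Section InteriorEdgeRelated.
Context {R : realType}.
Variables (e : nat -> int) (alpha : R) (D : cusp_data R).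
Hypothesis rD : represents e alpha D.
Hypothesis e_ge3 : forall j, (1 <= j)%N -> 3 <= e j.
Implicit Types (q v : 'rV[R]_4).
Local Notation A := (M_alpha_atlas e alpha).

Lemma has_diff_continuous q (f : 'rV[R]_4 -> R) df : has_diff q f df -> {for q, continuous f}.
Proof. by move=> [d _]; exact: differentiable_continuous. Qed.

Lemma interior_edge_related z0 j pq t0 P q q' :
  chart (a := A) (Interior z0) P q -> chart (a := A) (Edge j pq t0) P q' ->
  related (atlas_metric D) (Interior z0 : chart_index A) (Edge j pq t0) q q'.
Proof.
move=> cP dP; have [x [y [z1 [z2 [[xa y0] w1 w2 E qE]]]]] := cP.
have [zb dq w [y' [s [y'0 e2 e3 E']]]] := edge_chartE rD dP.
move: E'; rewrite E => E'; have [ex ey] := mclass_xy E'; rewrite -{}ey -{}ex {y' y'0} in e2 e3 E'.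
(* The two representatives of the torus point differ by 2 pi k; keeping this k near q makes Phi send
   q to q'. *)
have [k Hk] := (mclass_interior rD _ _ _ y0).1 E'.
set t := q' 0 1 in w E' Hk.
have d2 : (detz (mn e j) pq)%:~R * (detz (mn e j) pq)%:~R = 1 :> R.
  by rewrite -intrM (zbasis_det zb).
have detE : (detz (mn e j) pq)%:~R = (mn e j).1%:~R * pq.2%:~R - (mn e j).2%:~R * pq.1%:~R :> R.
  by rewrite /detz intrB !intrM.
pose del : R := (detz (mn e j) pq)%:~R.
pose sF (z : 'rV[R]_4) := s + del * ((z 0 2 - z1) * pq.2%:~R - (z 0 3 - z2) * pq.1%:~R).
pose tF (z : 'rV[R]_4) := t + del * ((mn e j).1%:~R * (z 0 3 - z2) - (mn e j).2%:~R * (z 0 2 - z1)).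
pose Phi (z : 'rV[R]_4) := row4 (z 0 0) (tF z) (z 0 1 * cos (sF z)) (z 0 1 * sin (sF z)).
have LF z : lat (mn e j) (sF z) + lat pq (tF z) = (z 0 2, z 0 3) + lat k (2 * pi).
  have -> : (z 0 2, z 0 3) + lat k (2 * pi) = (z1, z2) + lat k (2 * pi) + (z 0 2 - z1, z 0 3 - z2).
    by congr pair; rewrite /=; ring.
  rewrite -Hk /sF /tF /lat; congr pair; rewrite /=.
    transitivity (s * (mn e j).1%:~R + t * pq.1%:~R + del * del * (z 0 2 - z1)); last by rewrite d2; ring.
    by rewrite [X in _ = _ + X * _ * _]detE; ring.
  transitivity (s * (mn e j).2%:~R + t * pq.2%:~R + del * del * (z 0 3 - z2)); last by rewrite d2; ring.
  by rewrite [X in _ = _ + X * _ * _]detE; ring.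
have [q0 q1 q2 q3] : [/\ q 0 0 = x, q 0 1 = y, q 0 2 = z1 & q 0 3 = z2].
  by rewrite qE !row4E.
have sq : sF q = s by rewrite /sF q2 q3; ring.
have tq : tF q = t by rewrite /tF q2 q3; ring.
have cc := has_diff_coord q.
pose ds (v : 'rV[R]_4) := del * (v 0 2 * pq.2%:~R - v 0 3 * pq.1%:~R).
pose dt (v : 'rV[R]_4) := del * ((mn e j).1%:~R * v 0 3 - (mn e j).2%:~R * v 0 2).
have hs : has_diff q sF ds.
  by apply: has_diffE; [rewrite /sF; has_diff|move=> v; rewrite /ds /=; ring].
have ht : has_diff q tF dt.
  by apply: has_diffE; [rewrite /tF; has_diff|move=> v; rewrite /dt /=; ring].
have [dPhi PhiE] : differentiable Phi q /\ 'd Phi q =1 fun v => row4 (v 0 0) (dt v)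
    (q 0 1 * (ds v * - sin (sF q)) + cos (sF q) * v 0 1)
    (q 0 1 * (ds v * cos (sF q)) + sin (sF q) * v 0 1).
  by apply: diff_row4; has_diff.
(* In the other direction s is recovered by the branch of the argument centred at its value at
   q'. *)
pose ar (z : 'rV[R]_4) := arg_near s (z 0 2) (z 0 3).
pose Z1 (z : 'rV[R]_4) := z1 + ((ar z - s) * (mn e j).1%:~R + (z 0 1 - t) * pq.1%:~R).
pose Z2 (z : 'rV[R]_4) := z2 + ((ar z - s) * (mn e j).2%:~R + (z 0 1 - t) * pq.2%:~R).
pose Psi (z : 'rV[R]_4) := row4 (z 0 0) (Num.sqrt (z 0 2 ^+ 2 + z 0 3 ^+ 2)) (Z1 z) (Z2 z).
have a0 : 0 < q' 0 2 * cos s + q' 0 3 * sin s by rewrite e2 e3; exact: arg_near_base_gt0.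
have S0 : 0 < q' 0 2 ^+ 2 + q' 0 3 ^+ 2.
  by rewrite -/(eS q') (eS_polar e2 e3) exprn_gt0.
have arq : ar q' = s by rewrite /ar e2 e3 arg_near_base// gt_eqF.
have cc' := has_diff_coord q'.
have har := has_diff_arg a0 (cc' 2) (cc' 3).
have [dZ1 hZ1] : exists df, has_diff q' Z1 df by eexists; rewrite /Z1 /ar; has_diff.
have [dZ2 hZ2] : exists df, has_diff q' Z2 df by eexists; rewrite /Z2 /ar; has_diff.
have [dS hS] : exists df, has_diff q' (fun z => z 0 2 * z 0 2 + z 0 3 * z 0 3) df.
  by eexists; has_diff.
have dPsi : differentiable Psi q'.
  have h2 : 0 < (fun z : 'rV[R]_4 => z 0 2 * z 0 2 + z 0 3 * z 0 3) q' by rewrite -!expr2.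
  by have [] := diff_row4 (cc' 0) (has_diff_sqrt h2 hS) hZ1 hZ2.
apply: (@related_intro _ _ _ _ (atlas_chart_inj rD) (atlas_chart_fun rD e_ge3) _ _ _ _ P Phi Psi) => //.
- split=> //; near=> z.
  have za : alpha < z 0 0.
    by rewrite -subr_gt0; near: z; apply: (near_gt0 (h := fun z : 'rV[R]_4 => z 0 0 - alpha));
      [exact: has_diff_continuous (has_diffD (cc 0) (has_diffN (has_diff_cst q alpha)))|rewrite q0 subr_gt0].
  have zy : 0 < z 0 1.
    by near: z; apply: (near_gt0 (h := fun z : 'rV[R]_4 => z 0 1)); [exact: has_diff_continuous (cc 1)|rewrite q1].
  exists (point e (z 0 2, z 0 3) (conj za (ltW zy))); split.
    exists (z 0 0), (z 0 1), (z 0 2), (z 0 3); split=> //.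
    + by near: z; apply: (near_window (h := fun z : 'rV[R]_4 => z 0 2)); [exact: has_diff_continuous (cc 2)|rewrite q2].
    + by near: z; apply: (near_window (h := fun z : 'rV[R]_4 => z 0 3)); [exact: has_diff_continuous (cc 3)|rewrite q3].
    + apply/rowP => i; rewrite mxE.
      by case: i => [[|[|[|[|//]]]] p] /=; congr (z _ _); exact: val_inj.
  apply: (@edge_chartI _ _ _ _ rD _ _ _ _ _ (z 0 1) (sF z)); rewrite ?row4E//=.
  + rewrite /edge_dom /= (@eS_polar _ _ (z 0 1) (sF z)) ?row4E// /eX row4E /=.
    apply/(edge_reg_closed rD); first exact: ltW.
    split; first by split=> //; exact: ltW.
    by move=> yy; rewrite yy ltxx in zy.
  + by near: z; apply: (near_window (h := tF)); [exact: has_diff_continuous ht|rewrite tq].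
  + exact: ltW.
  + by apply/(mclass_interior rD _ _ _ zy); exists k; rewrite LF.
- split=> //; near=> z.
  have dz : edge_dom D alpha j z by near: z; apply: open_nbhs_nbhs; split=> //; exact: open_edge_dom.
  have za : 0 < z 0 2 * cos s + z 0 3 * sin s.
    near: z; apply: (near_gt0 (h := fun z : 'rV[R]_4 => z 0 2 * cos s + z 0 3 * sin s)) a0.
    exact: has_diff_continuous (has_diffD (has_diffM (cc' 2) (has_diff_cst q' _)) (has_diffM (cc' 3) (has_diff_cst q' _))).
  have [h2 h3] := arg_nearE za; rewrite -/(ar z) in h2 h3.
  set rr := Num.sqrt _ in h2 h3; have r0 : 0 <= rr by rewrite sqrtr_ge0.
  have rp : 0 < rr.
    rewrite lt_neqAle r0 andbT; apply: contraTneq za => rr0.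
    by rewrite h2 h3 -rr0 !mul0r addr0 ltxx.
  have xz : alpha < z 0 0 by case: dz => + _; rewrite /eX subr_gt0.
  exists (point e (Z1 z, Z2 z) (conj xz r0)); split.
    apply: (@edge_chartI _ _ _ _ rD _ _ _ _ _ rr (ar z)) => //.
      by near: z; apply: (near_window (h := fun z : 'rV[R]_4 => z 0 1)); [exact: has_diff_continuous (cc' 1)|].
    apply/(mclass_interior rD _ _ _ rp); exists k.
    have -> : lat (mn e j) (ar z) + lat pq (z 0 1) =
        lat (mn e j) s + lat pq t + (lat (mn e j) (ar z - s) + lat pq (z 0 1 - t)).
      by rewrite /lat; congr pair; rewrite /=; ring.
    by rewrite Hk /lat /Z1 /Z2; congr pair; rewrite /=; ring.
  exists (z 0 0), rr, (Z1 z), (Z2 z); split=> //.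
  + near: z; apply: (near_window (h := Z1)); first exact: has_diff_continuous hZ1.
    by rewrite /Z1 arq !subrr !mul0r !addr0.
  + near: z; apply: (near_window (h := Z2)); first exact: has_diff_continuous hZ2.
    by rewrite /Z2 arq !subrr !mul0r !addr0.
- move=> v; rewrite PhiE /Phi sq.
  have := @interior_edge_law _ _ _ _ rD j pq q v (tF q) s zb.
  rewrite q0 q1 => /(_ xa y0) H; apply: (etrans H).
  by congr (qf _ (row4 _ _ _ _)); rewrite /ds; ring.
Unshelve. all: by end_near. Qed.

End InteriorEdgeRelated.

(** * Between two charts of the same edge *)

Section EdgeRelated.
Context {R : realType}.
Variables (e : nat -> int) (alpha : R) (D : cusp_data R).
Hypothesis rD : represents e alpha D.
Hypothesis e_ge3 : forall j, (1 <= j)%N -> 3 <= e j.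
Implicit Types (q v : 'rV[R]_4).
Local Notation A := (M_alpha_atlas e alpha).

(** Where X = Y = 0 the form eta vanishes; the coefficient of dt^2 reduces to 1 / w^2 because the
    lattice determinant is 1 or - 1. *)
Lemma qf_edge_metric_axis j pq q v : q 0 2 = 0 -> q 0 3 = 0 -> zbasis (mn e j) pq ->
  let w := wv D j (q 0 0 - alpha) 0 in
  qf (edge_metric D alpha j pq q) v = w / fI D j (q 0 0 - alpha) 0 ^+ 2 *
    (v 0 0 ^+ 2 + v 0 2 ^+ 2 + v 0 3 ^+ 2 + (w ^+ 2)^-1 * v 0 1 ^+ 2).
Proof.
move=> e2 e3 zb w.
have d2 : (detz (mn e j) pq)%:~R * (detz (mn e j) pq)%:~R = 1 :> R.
  by rewrite -intrM (zbasis_det zb).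
rewrite (@edge_metric_polar _ alpha D j pq _ 0 0) ?mul0r// expr0n /= qf_edge_form /= -/w.
have -> : ((mnr D j).1 + 0 * (V2v D j (q 0 0 - alpha) 0).1,
    (mnr D j).2 + 0 * (V2v D j (q 0 0 - alpha) 0).2) = mnr D j.
  by rewrite !mul0r !addr0 -surjective_pairing.
rewrite !mul0r subrr expr0n /= !mulr0 !mul0r !add0r.
rewrite -(shear_mn rD) eps2_shear mulr0 add0r.
by rewrite [_%:~R ^+ 2]expr2 d2 mul1r.
Qed.

(** Change of the complementary vector: if pq = bt pq' + a (m_j, n_j), then t becomes bt t up to a
    constant and s becomes s + a t, a rotation of the disc by the angle a t. *)
Definition twist (bt c a : R) (z : 'rV[R]_4) : 'rV[R]_4 :=
  row4 (z 0 0) (bt * z 0 1 + c) (z 0 2 * cos (a * z 0 1) - z 0 3 * sin (a * z 0 1))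
    (z 0 2 * sin (a * z 0 1) + z 0 3 * cos (a * z 0 1)).

Lemma differentiable_twist bt c a q : differentiable (twist bt c a) q.
Proof.
have cc := has_diff_coord q.
have [d1 h1] : exists df, has_diff q (fun z => bt * z 0 1 + c) df by eexists; has_diff.
have [d2 h2] : exists df, has_diff q
    (fun z => z 0 2 * cos (a * z 0 1) - z 0 3 * sin (a * z 0 1)) df by eexists; has_diff.
have [d3 h3] : exists df, has_diff q
    (fun z => z 0 2 * sin (a * z 0 1) + z 0 3 * cos (a * z 0 1)) df by eexists; has_diff.
by have [] := diff_row4 (cc 0) h1 h2 h3.
Qed.

Lemma diff_twist_axis bt c a q v : q 0 2 = 0 -> q 0 3 = 0 ->
  'd (twist bt c a) q v = row4 (v 0 0) (bt * v 0 1)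
    (v 0 2 * cos (a * q 0 1) - v 0 3 * sin (a * q 0 1))
    (v 0 2 * sin (a * q 0 1) + v 0 3 * cos (a * q 0 1)).
Proof.
move=> e2 e3; have cc := has_diff_coord q.
have h1 : has_diff q (fun z => bt * z 0 1 + c) (fun v => bt * v 0 1).
  by apply: has_diffE; [has_diff|move=> u /=; ring].
have h2 : has_diff q (fun z => z 0 2 * cos (a * z 0 1) - z 0 3 * sin (a * z 0 1))
    (fun v => v 0 2 * cos (a * q 0 1) - v 0 3 * sin (a * q 0 1)).
  by apply: has_diffE; [has_diff|move=> u /=; rewrite e2 e3; ring].
have h3 : has_diff q (fun z => z 0 2 * sin (a * z 0 1) + z 0 3 * cos (a * z 0 1))
    (fun v => v 0 2 * sin (a * q 0 1) + v 0 3 * cos (a * q 0 1)).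
  by apply: has_diffE; [has_diff|move=> u /=; rewrite e2 e3; ring].
by have [_ ->] := diff_row4 (cc 0) h1 h2 h3.
Qed.

Lemma edge_edge_map j pq pq' (t0 t0' : R) (q : 'rV[R]_4) (bt a k : int) :
  zbasis (mn e j) pq -> zbasis (mn e j) pq' ->
  pq = (bt * pq'.1 + a * (mn e j).1, bt * pq'.2 + a * (mn e j).2) ->
  edge_dom D alpha j q -> window t0 (q 0 1) ->
  window t0' (bt%:~R * q 0 1 + k%:~R * (2 * pi)) ->
  chart_map (Edge j pq t0 : chart_index A) (Edge j pq' t0') q
    (twist bt%:~R (k%:~R * (2 * pi)) a%:~R).
Proof.
move=> zb zb' pE dq w w'; have cc := has_diff_coord q.
split; first exact: differentiable_twist.
near=> z.
have dz : edge_dom D alpha j z by near: z; apply: open_nbhs_nbhs; split=> //; exact: open_edge_dom.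
have [s [e2 e3]] := polar_exists (z 0 2) (z 0 3); set y := Num.sqrt _ in e2 e3.
have y0 : 0 <= y by rewrite sqrtr_ge0.
have H : Dplus_closed alpha (z 0 0) y /\ (y = 0 -> open_edge e j (z 0 0)).
  by apply/(edge_reg_closed rD) => //; rewrite -(eS_polar e2 e3).
have p2 : z 0 2 * cos (a%:~R * z 0 1) - z 0 3 * sin (a%:~R * z 0 1) = y * cos (s + a%:~R * z 0 1).
  by rewrite e2 e3 cosD; ring.
have p3 : z 0 2 * sin (a%:~R * z 0 1) + z 0 3 * cos (a%:~R * z 0 1) = y * sin (s + a%:~R * z 0 1).
  by rewrite e2 e3 sinD; ring.
exists (point e (lat (mn e j) s + lat pq (z 0 1)) H.1); split.
  apply: (edge_chartI rD zb dz _ y0 e2 e3) => //.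
  by near: z; apply: (near_window (h := fun z : 'rV[R]_4 => z 0 1)); [exact: has_diff_continuous (cc 1)|].
apply: (@edge_chartI _ _ _ _ rD _ _ _ _ _ y (s + a%:~R * z 0 1)) => //.
- by rewrite /edge_dom /= (eS_polar (y := y) (s := s + a%:~R * z 0 1)) ?row4E// /eX row4E /= -(eS_polar e2 e3).
- rewrite row4E /=; near: z.
  apply: (near_window (h := fun z : 'rV[R]_4 => bt%:~R * z 0 1 + k%:~R * (2 * pi))) => //.
  exact: has_diff_continuous (has_diffD (has_diffM (has_diff_cst q _) (cc 1)) (has_diff_cst q _)).
- by rewrite row4E.
- by rewrite row4E.
rewrite /= !row4E /=.
have E : lat (mn e j) (s + a%:~R * z 0 1) + lat pq' (bt%:~R * z 0 1 + k%:~R * (2 * pi)) =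
   lat (mn e j) s + lat pq (z 0 1) + lat (k * pq'.1, k * pq'.2) (2 * pi).
  by rewrite pE /lat; congr pair; rewrite /= !intrD !intrM; ring.
have [yp|yn] := ltP 0 y.
  by apply/(mclass_interior rD _ _ _ yp); eexists; exact: E.
have yz : y = 0 by apply/eqP; rewrite eq_le yn y0.
rewrite yz; apply/(mclass_edge rD _ _ (H.2 yz)); exists (k * pq'.1, k * pq'.2), 0.
by rewrite E [lat _ 0](_ : _ = 0) ?addr0// /lat !mul0r.
Unshelve. all: by end_near. Qed.

Lemma zbasis_change (v w w' : int * int) : detz v w * detz v w = 1 -> detz v w' * detz v w' = 1 ->
  let bt := detz v w * detz v w' in let a := detz v w' * detz w w' in
  w = (bt * w'.1 + a * v.1, bt * w'.2 + a * v.2).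
Proof.
move=> d d' bt a; rewrite /bt /a [LHS]surjective_pairing; congr pair.
  rewrite -[LHS]mul1r -d'.
  transitivity (detz v w' * (detz v w * w'.1 + detz w w' * v.1)); last ring.
  by rewrite -mulrA; congr (_ * _); rewrite /detz; ring.
rewrite -[LHS]mul1r -d'.
transitivity (detz v w' * (detz v w * w'.2 + detz w w' * v.2)); last ring.
by rewrite -mulrA; congr (_ * _); rewrite /detz; ring.
Qed.

(** Only the axis needs this comparison, as elsewhere both charts can be compared with an interior
    chart. On the axis the t-dependence of the rotation drops out of the differential, since the
    rotated vector is 0. *)
Lemma edge_edge_related j pq pq' t0 t0' P q q' :
  chart (a := A) (Edge j pq t0) P q -> chart (a := A) (Edge j pq' t0') P q' -> eS q = 0 ->
  related (atlas_metric D) (Edge j pq t0 : chart_index A) (Edge j pq' t0') q q'.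
Proof.
move=> cP dP S0.
have [zb dq w [y [s [y0 e2 e3 E]]]] := edge_chartE rD cP.
have [zb' dq' w' [y' [s' [y0' e2' e3' E']]]] := edge_chartE rD dP.
have yz : y = 0.
  by apply/eqP; rewrite -sqrf_eq0 -(eS_polar e2 e3) S0.
subst y; move: E'; rewrite E => E'; have [ex ey] := mclass_xy E'; subst y'.
rewrite !mul0r in e2 e3 e2' e3'; rewrite -ex in E'.
have o : open_edge e j (q 0 0).
  have z2 : (0 : R) ^+ 2 = eS q by rewrite S0 expr0n.
  have dq0 : edge_reg D j (q 0 0 - alpha) (0 ^+ 2) by rewrite z2; exact: dq.
  exact: ((edge_reg_closed rD j (q 0 0) (lexx 0)).1 dq0).2 erefl.
have [k [c Hk]] := (mclass_edge rD _ _ o).1 E'.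
have d := zbasis_det zb; have d' := zbasis_det zb'.
have pE := zbasis_change d d'; have pE' := zbasis_change d' d.
set bt := detz (mn e j) pq * _ in pE; set a := detz (mn e j) pq' * _ in pE.
set a' := detz (mn e j) pq * _ in pE'; rewrite [detz _ pq' * _]mulrC -/bt in pE'.
have bt2 : bt * bt = 1 by rewrite /bt mulrACA d d'.
rewrite /= in pE pE'; move: bt a a' bt2 pE pE' => bt a a' bt2 pE pE'.
have btR : bt%:~R * bt%:~R = 1 :> R by rewrite -intrM bt2.
(* On the axis s is undetermined, but the second angle is still [bt] t modulo 2 pi. *)
have [l tE] : exists l : int, q' 0 1 = bt%:~R * q 0 1 + l%:~R * (2 * pi).
  have H : lat (mn e j) s' + lat pq' (q' 0 1) =
     lat (mn e j) (s + c + a%:~R * q 0 1) + lat pq' (bt%:~R * q 0 1) + lat k (2 * pi).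
    rewrite Hk [in LHS]pE /lat; congr pair; rewrite /= !intrD !intrM; ring.
  by have [_ ->] := lat_solve d' H; eexists.
have w1 : window t0' (bt%:~R * q 0 1 + l%:~R * (2 * pi)) by rewrite -tE.
have m1 := edge_edge_map zb zb' pE dq w w1.
have m2 : chart_map (Edge j pq' t0' : chart_index A) (Edge j pq t0) q'
    (twist bt%:~R ((- bt * l)%:~R * (2 * pi)) a'%:~R).
  apply: edge_edge_map => //; rewrite tE.
  have -> : bt%:~R * (bt%:~R * q 0 1 + l%:~R * (2 * pi)) + (- bt * l)%:~R * (2 * pi) = q 0 1 :> R.
    rewrite intrM intrN; transitivity (bt%:~R * bt%:~R * q 0 1); last by rewrite btR mul1r.
    by ring.
  exact: w.
apply: (related_intro (atlas_chart_inj rD) (atlas_chart_fun rD e_ge3) cP dP m1 m2) => v.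
rewrite (@diff_twist_axis _ _ _ _ _ e2 e3) /= (qf_edge_metric_axis _ e2 e3 zb).
rewrite qf_edge_metric_axis// ?row4E /= ?e2 ?e3 ?mul0r ?addr0 ?subr0//.
congr (_ * _); congr (_ + _ * _); last by rewrite exprMn [bt%:~R ^+ 2]expr2 btR mul1r.
rewrite -!addrA; congr (_ + _).
move: (a%:~R * q 0 1) => th.
rewrite -[LHS]mul1r -(cos2Dsin2 th); ring.
Qed.

End EdgeRelated.

(** * From a corner chart to the charts of its two edges *)

Section CornerEdgeRelated.
Context {R : realType}.
Variables (e : nat -> int) (alpha : R) (D : cusp_data R).
Hypothesis rD : represents e alpha D.
Hypothesis e_ge3 : forall j, (1 <= j)%N -> 3 <= e j.
Implicit Types (q v z : 'rV[R]_4).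
Local Notation A := (M_alpha_atlas e alpha).

Lemma mclass_edge_eq j (x y : R) (z z' : R * R) : 0 <= y -> (y = 0 -> open_edge e j x) ->
  mclass e x y z = mclass e x y z' ->
  exists k c, z' = z + lat k (2 * pi) + lat (mn e j) c.
Proof.
rewrite le_eqVlt => /predU1P[<-|y0] o.
  by move=> /(mclass_edge rD _ _ (o erefl)).
move=> /(mclass_interior rD _ _ _ y0)[k ->]; exists k, 0.
by rewrite [lat _ 0](_ : _ = 0) ?addr0// /lat !mul0r.
Qed.

Lemma has_diff_sq q (f : 'rV[R]_4 -> R) df : has_diff q f df ->
  has_diff q (fun z => f z ^+ 2) (fun v => 2 * f q * df v).
Proof. by move=> H; apply: has_diffE (has_diffM H H) _ => v; ring. Qed.

(* The corner j and an adjacent edge je: the circle that collapses over the edge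
   rotates the coordinates i1, j1, and sg is the sign of x - a_j on the edge. *)
Variables (j je : nat) (pq : int * int) (sg : R) (i1 j1 i2 j2 : 'I_4).
Variable perm : R -> R -> R -> R -> 'rV[R]_4.
Hypotheses (sg2 : sg * sg = 1) (zb : zbasis (mn e je) pq).
Hypothesis permE : forall a b c d,
  [/\ perm a b c d 0 i1 = a, perm a b c d 0 j1 = b, perm a b c d 0 i2 = c & perm a b c d 0 j2 = d].
Hypothesis diff_perm : forall q (a b c d : 'rV[R]_4 -> R) da db dc dd,
  has_diff q a da -> has_diff q b db -> has_diff q c dc -> has_diff q d dd ->
  differentiable (fun z => perm (a z) (b z) (c z) (d z)) q.
Hypothesis cornerI : forall P z r1 s1 r2 s2, 0 <= r1 -> 0 <= r2 ->
  z 0 i1 = r1 * cos s1 -> z 0 j1 = r1 * sin s1 -> z 0 i2 = r2 * cos s2 -> z 0 j2 = r2 * sin s2 ->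
  let x := corner e j + sg * (r2 ^+ 2 - r1 ^+ 2) in
  edge_reg D je (x - alpha) ((2 * r1 * r2) ^+ 2) ->
  sval P = mclass e x (2 * r1 * r2) (lat (mn e je) s1 + lat pq s2) ->
  corner_chart (e := e) (alpha := alpha) j P z.
Hypothesis cornerD : forall P z, corner_chart (e := e) (alpha := alpha) j P z ->
  exists r1 s1 r2 s2, [/\ 0 <= r1 /\ 0 <= r2,
  z 0 i1 = r1 * cos s1 /\ z 0 j1 = r1 * sin s1, z 0 i2 = r2 * cos s2 /\ z 0 j2 = r2 * sin s2 &
  sval P = mclass e (corner e j + sg * (r2 ^+ 2 - r1 ^+ 2)) (2 * r1 * r2)
    (lat (mn e je) s1 + lat pq s2)].

(** Since y = 2 r1 r2, the disc coordinate of the edge chart is 2 r2 times the complex coordinate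
    that vanishes on the edge, hence smooth there as long as r2 > 0. *)
Definition unfold_corner (t : R) z : 'rV[R]_4 :=
  row4 (corner e j + sg * ((z 0 i2 ^+ 2 + z 0 j2 ^+ 2) - (z 0 i1 ^+ 2 + z 0 j1 ^+ 2)))
    (arg_near t (z 0 i2) (z 0 j2))
    (2 * Num.sqrt (z 0 i2 ^+ 2 + z 0 j2 ^+ 2) * z 0 i1)
    (2 * Num.sqrt (z 0 i2 ^+ 2 + z 0 j2 ^+ 2) * z 0 j1).

Lemma diff_unfold_corner t q : 0 < q 0 i2 * cos t + q 0 j2 * sin t ->
  0 < q 0 i2 ^+ 2 + q 0 j2 ^+ 2 ->
  let r2 := Num.sqrt (q 0 i2 ^+ 2 + q 0 j2 ^+ 2) in
  differentiable (unfold_corner t) q /\ 'd (unfold_corner t) q =1 fun v =>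
    let s1 := q 0 i1 * v 0 i1 + q 0 j1 * v 0 j1 in
    let s2 := q 0 i2 * v 0 i2 + q 0 j2 * v 0 j2 in
    row4 (sg * (2 * (s2 - s1))) ((q 0 i2 * v 0 j2 - q 0 j2 * v 0 i2) / (q 0 i2 ^+ 2 + q 0 j2 ^+ 2))
      (2 * r2 * v 0 i1 + 2 * q 0 i1 * s2 / r2) (2 * r2 * v 0 j1 + 2 * q 0 j1 * s2 / r2).
Proof.
move=> a0 R0 r2; have cc := has_diff_coord q.
have rn : r2 != 0 by rewrite gt_eqF// sqrtr_gt0.
have h2 := has_diffD (has_diff_sq (cc i2)) (has_diff_sq (cc j2)).
have h1 := has_diffD (has_diff_sq (cc i1)) (has_diff_sq (cc j1)).
have hr := has_diff_sqrt (f := fun z => z 0 i2 ^+ 2 + z 0 j2 ^+ 2) R0 h2.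
have H0 := has_diffD (has_diff_cst q (corner e j)) (has_diffM (has_diff_cst q sg) (has_diffD h2 (has_diffN h1))).
have H1 := has_diff_arg a0 (cc i2) (cc j2).
have H2 := has_diffM (has_diffM (has_diff_cst q 2) hr) (cc i1).
have H3 := has_diffM (has_diffM (has_diff_cst q 2) hr) (cc j1).
have [d E] := diff_row4 H0 H1 H2 H3; split=> // v; rewrite E /= -/r2.
by congr row4; [ring| |]; field.
Qed.

(** Only the coordinate changes are constructed here, for both edges at once; the equality of the
    two forms is a hypothesis, because its proof differs for the two edges. *)
Lemma related_corner_edge t0 P q q' :
  chart (a := A) (Corner j) P q -> chart (a := A) (Edge je pq t0) P q' ->
  0 < q 0 i2 ^+ 2 + q 0 j2 ^+ 2 ->
  (forall t v, 0 < q 0 i2 * cos t + q 0 j2 * sin t -> edge_reg D je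
      (corner e j + sg * ((q 0 i2 ^+ 2 + q 0 j2 ^+ 2) - (q 0 i1 ^+ 2 + q 0 j1 ^+ 2)) - alpha)
      (4 * (q 0 i1 ^+ 2 + q 0 j1 ^+ 2) * (q 0 i2 ^+ 2 + q 0 j2 ^+ 2)) ->
     qf (corner_metric D j q) v =
     qf (edge_metric D alpha je pq (unfold_corner t q)) ('d (unfold_corner t) q v)) ->
  related (atlas_metric D) (Corner j : chart_index A) (Edge je pq t0) q q'.
Proof.
move=> cP dP R20 law.
have [r1 [s1 [r2 [s2 [[r10 r2p] [c1 c1'] [c2 c2'] E]]]]] := cornerD cP.
have [_ dq' w' [y [s [y0 e2 e3 E']]]] := edge_chartE rD dP.
move: E'; rewrite E => E'; have [ex ey] := mclass_xy E'.
have N1 : q 0 i1 ^+ 2 + q 0 j1 ^+ 2 = r1 ^+ 2.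
  by rewrite c1 c1' !exprMn -mulrDr cos2Dsin2 mulr1.
have N2 : q 0 i2 ^+ 2 + q 0 j2 ^+ 2 = r2 ^+ 2.
  by rewrite c2 c2' !exprMn -mulrDr cos2Dsin2 mulr1.
have r20 : 0 < r2.
  by rewrite lt_neqAle r2p andbT; apply: contraTneq R20 => r20; rewrite N2 -r20 expr0n ltxx.
have er : edge_reg D je (corner e j + sg * (r2 ^+ 2 - r1 ^+ 2) - alpha) ((2 * r1 * r2) ^+ 2).
  by rewrite ex ey; move: dq'; rewrite /edge_dom /= (eS_polar e2 e3).
have cl := (edge_reg_closed rD je (q' 0 0) y0).1.
have [_ oe] : Dplus_closed alpha (q' 0 0) y /\ (y = 0 -> open_edge e je (q' 0 0)).
  by apply: cl; move: er; rewrite ex ey.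
set t := q' 0 1 in w' E'.
have [l tE] : exists l : int, t = s2 + l%:~R * (2 * pi).
  rewrite ex ey in E'; have [k [c Hk]] := mclass_edge_eq y0 oe E'.
  have H : lat (mn e je) s + lat pq t = lat (mn e je) (s1 + c) + lat pq s2 + lat k (2 * pi).
    by rewrite Hk latD /lat; congr pair; rewrite /=; ring.
  by have [_ ->] := lat_solve (zbasis_det zb) H; eexists.
have {}c2 : q 0 i2 = r2 * cos t by rewrite c2 tE (cos_sin_period _ _).1.
have {}c2' : q 0 j2 = r2 * sin t by rewrite c2' tE (cos_sin_period _ _).2.
have a0 : 0 < q 0 i2 * cos t + q 0 j2 * sin t by rewrite c2 c2'; exact: arg_near_base_gt0.
have arq : arg_near t (q 0 i2) (q 0 j2) = t by rewrite c2 c2' arg_near_base// gt_eqF.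
have cc := has_diff_coord q; have cc' := has_diff_coord q'.
have [dPhi _] := diff_unfold_corner a0 R20.
pose a := corner e j : R.
(* [rh] is the modulus r1^2 + r2^2 of x - a_j + iy; with sg (x - a_j) = r2^2 - r1^2 it yields r2,
   and then r1 = y / (2 r2). *)
pose rh (z : 'rV[R]_4) := Num.sqrt ((z 0 0 - a) ^+ 2 + (z 0 2 ^+ 2 + z 0 3 ^+ 2)).
pose r2f (z : 'rV[R]_4) := Num.sqrt (2^-1 * (rh z + sg * (z 0 0 - a))).
pose Psi z := perm (z 0 2 * (2 * r2f z)^-1) (z 0 3 * (2 * r2f z)^-1)
   (r2f z * cos (z 0 1)) (r2f z * sin (z 0 1)).
have xq : q' 0 0 - a = sg * (r2 ^+ 2 - r1 ^+ 2) by rewrite -ex /a; ring.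
have S1 : q' 0 2 ^+ 2 + q' 0 3 ^+ 2 = (2 * r1 * r2) ^+ 2 by rewrite -/(eS q') (eS_polar e2 e3) -ey.
have Sq : (q' 0 0 - a) ^+ 2 + (q' 0 2 ^+ 2 + q' 0 3 ^+ 2) = (r1 ^+ 2 + r2 ^+ 2) ^+ 2.
  rewrite S1 xq exprMn [sg ^+ 2]expr2 sg2; ring.
have rp : 0 < r1 ^+ 2 + r2 ^+ 2 by rewrite ltr_wpDl ?sqr_ge0// exprn_gt0.
have rhq : rh q' = r1 ^+ 2 + r2 ^+ 2 by rewrite /rh Sq sqrtr_sqr gtr0_norm.
have r2q : 2^-1 * (rh q' + sg * (q' 0 0 - a)) = r2 ^+ 2.
  by rewrite rhq xq mulrA sg2 mul1r; field.
have p1 : 0 < (q' 0 0 - a) ^+ 2 + (q' 0 2 ^+ 2 + q' 0 3 ^+ 2) by rewrite Sq exprn_gt0.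
have p2 : 0 < 2^-1 * (rh q' + sg * (q' 0 0 - a)) by rewrite r2q exprn_gt0.
have hx := has_diffD (cc' 0) (has_diffN (has_diff_cst q' a)).
have hin := has_diffD (has_diff_sq hx) (has_diffD (has_diff_sq (cc' 2)) (has_diff_sq (cc' 3))).
have hrh := has_diff_sqrt (f := fun z : 'rV[R]_4 => (z 0 0 - a) ^+ 2 + (z 0 2 ^+ 2 + z 0 3 ^+ 2)) p1 hin.
have hr2 := has_diffM (has_diff_cst q' 2^-1) (has_diffD hrh (has_diffM (has_diff_cst q' sg) hx)).
have hr := has_diff_sqrt (f := fun z : 'rV[R]_4 => 2^-1 * (rh z + sg * (z 0 0 - a))) p2 hr2.
have rfn : 2 * r2f q' != 0 by rewrite mulf_neq0// gt_eqF// sqrtr_gt0.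
have hV := has_diffV (f := fun z => 2 * r2f z) rfn (has_diffM (has_diff_cst q' 2) hr).
have dPsi : differentiable Psi q'.
  exact: (diff_perm (has_diffM (cc' 2) hV) (has_diffM (cc' 3) hV)
    (has_diffM hr (has_diff_cos (cc' 1))) (has_diffM hr (has_diff_sin (cc' 1)))).
have eP z : eS (unfold_corner t z) = 4 * (z 0 i1 ^+ 2 + z 0 j1 ^+ 2) * (z 0 i2 ^+ 2 + z 0 j2 ^+ 2).
  rewrite /eS !row4E /=.
  have := sqr_sqrtr (addr_ge0 (sqr_ge0 (z 0 i2)) (sqr_ge0 (z 0 j2))).
  by move: (Num.sqrt _) => r <-; ring.
have dq : edge_dom D alpha je (unfold_corner t q).
  rewrite /edge_dom /= eP /eX row4E /= N1 N2; move: er; congr (edge_reg _ _ _ _); ring.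
apply: (related_intro (atlas_chart_inj rD) (atlas_chart_fun rD e_ge3) cP dP (Phi := unfold_corner t) (Psi := Psi)).
- split=> //; near=> z.
  have za : 0 < z 0 i2 * cos t + z 0 j2 * sin t.
    near: z; apply: (near_gt0 (h := fun z : 'rV[R]_4 => z 0 i2 * cos t + z 0 j2 * sin t)) a0.
    exact: has_diff_continuous (has_diffD (has_diffM (cc i2) (has_diff_cst q _)) (has_diffM (cc j2) (has_diff_cst q _))).
  have dz : edge_dom D alpha je (unfold_corner t z).
    near: z; apply: (differentiable_continuous dPhi).
    by apply: open_nbhs_nbhs; split=> //; exact: open_edge_dom.
  have [h2 h3] := arg_nearE za; have [u [h0 h1]] := polar_exists (z 0 i1) (z 0 j1).
  set rz2 := Num.sqrt (z 0 i2 ^+ 2 + z 0 j2 ^+ 2) in h2 h3.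
  set rz1 := Num.sqrt (z 0 i1 ^+ 2 + z 0 j1 ^+ 2) in h0 h1.
  set tz := arg_near t (z 0 i2) (z 0 j2) in h2 h3.
  have rz20 : 0 <= rz2 by rewrite sqrtr_ge0.
  have rz10 : 0 <= rz1 by rewrite sqrtr_ge0.
  have rz2E : z 0 i2 ^+ 2 + z 0 j2 ^+ 2 = rz2 ^+ 2 by rewrite sqr_sqrtr// addr_ge0 ?sqr_ge0.
  have rz1E : z 0 i1 ^+ 2 + z 0 j1 ^+ 2 = rz1 ^+ 2 by rewrite sqr_sqrtr// addr_ge0 ?sqr_ge0.
  have erz : edge_reg D je (corner e j + sg * (rz2 ^+ 2 - rz1 ^+ 2) - alpha) ((2 * rz1 * rz2) ^+ 2).
    by move: dz; rewrite /edge_dom /= eP /eX row4E /= rz1E rz2E; congr (edge_reg _ _ _ _); ring.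
  have yz0 : 0 <= 2 * rz1 * rz2 by rewrite !mulr_ge0.
  have [Dz _] := (edge_reg_closed rD je _ yz0).1 erz.
  exists (point e (lat (mn e je) u + lat pq tz) Dz); split.
    exact: (cornerI rz10 rz20 h0 h1 h2 h3 erz).
  have q2 : unfold_corner t z 0 2 = 2 * rz1 * rz2 * cos u by rewrite row4E /= -/rz2 h0; ring.
  have q3 : unfold_corner t z 0 3 = 2 * rz1 * rz2 * sin u by rewrite row4E /= -/rz2 h1; ring.
  apply: (edge_chartI rD zb dz _ yz0 q2 q3); last by rewrite /= !row4E /= rz2E rz1E.
  rewrite row4E /=; near: z.
  apply: (near_window (h := fun z : 'rV[R]_4 => arg_near t (z 0 i2) (z 0 j2))); last by rewrite arq.
  exact: has_diff_continuous (has_diff_arg a0 (cc i2) (cc j2)).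
- split=> //; near=> z.
  have dz : edge_dom D alpha je z by near: z; apply: open_nbhs_nbhs; split=> //; exact: open_edge_dom.
  have zp : 0 < 2^-1 * (rh z + sg * (z 0 0 - a)).
    near: z; apply: (near_gt0 (h := fun z : 'rV[R]_4 => 2^-1 * (rh z + sg * (z 0 0 - a)))) p2.
    exact: has_diff_continuous hr2.
  have [u [h2 h3]] := polar_exists (z 0 2) (z 0 3); set yz := Num.sqrt _ in h2 h3.
  have yz0 : 0 <= yz by rewrite sqrtr_ge0.
  have rz : 0 < r2f z by rewrite sqrtr_gt0.
  have rzE : r2f z ^+ 2 = 2^-1 * (rh z + sg * (z 0 0 - a)) by rewrite sqr_sqrtr// ltW.
  have rhE : rh z ^+ 2 = (z 0 0 - a) ^+ 2 + yz ^+ 2.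
    rewrite sqr_sqrtr; last by rewrite !addr_ge0 ?sqr_ge0.
    by congr (_ + _); rewrite -/(eS z) (eS_polar h2 h3).
  pose r1z := yz * (2 * r2f z)^-1.
  have r1z0 : 0 <= r1z by rewrite mulr_ge0// invr_ge0 mulr_ge0// ltW.
  have yE : 2 * r1z * r2f z = yz by rewrite /r1z; field; rewrite gt_eqF.
  have r1E : r1z ^+ 2 = 2^-1 * (rh z - sg * (z 0 0 - a)).
    have n0 : 4 * r2f z ^+ 2 != 0 by rewrite mulf_neq0// ?expf_neq0// gt_eqF.
    apply: (mulIf n0); transitivity (yz ^+ 2); first by rewrite -yE; ring.
    rewrite rzE; transitivity (rh z ^+ 2 - sg * sg * (z 0 0 - a) ^+ 2); last by field.
    by rewrite rhE sg2; ring.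
  have xE : corner e j + sg * (r2f z ^+ 2 - r1z ^+ 2) = z 0 0.
    rewrite rzE r1E -/a; transitivity (a + sg * sg * (z 0 0 - a)); first by field.
    by rewrite sg2; ring.
  have dz2 : edge_reg D je (z 0 0 - alpha) (yz ^+ 2).
    by rewrite -(eS_polar h2 h3); exact: dz.
  have [Dz _] := (edge_reg_closed rD je _ yz0).1 dz2.
  exists (point e (lat (mn e je) u + lat pq (z 0 1)) Dz); split.
    apply: (edge_chartI rD zb dz _ yz0 h2 h3) => //.
    by near: z; apply: (near_window (h := fun z : 'rV[R]_4 => z 0 1)); [exact: has_diff_continuous (cc' 1)|].
  have [k1 k2 k3 k4] := permE (z 0 2 * (2 * r2f z)^-1) (z 0 3 * (2 * r2f z)^-1)
    (r2f z * cos (z 0 1)) (r2f z * sin (z 0 1)).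
  apply: (cornerI r1z0 (ltW rz) _ _ k3 k4); rewrite ?xE ?yE//.
    by rewrite k1 /r1z {1}h2; ring.
  by rewrite k2 /r1z {1}h3; ring.
- move=> v; apply: law a0 _; move: er; rewrite N1 N2; congr (edge_reg _ _ _ _); ring.
Unshelve. all: by end_near. Qed.

End CornerEdgeRelated.

Section CornerEdges.
Context {R : realType}.
Variables (e : nat -> int) (alpha : R) (D : cusp_data R).
Hypothesis rD : represents e alpha D.
Hypothesis e_ge3 : forall j, (1 <= j)%N -> 3 <= e j.
Implicit Types (q v z : 'rV[R]_4).
Local Notation A := (M_alpha_atlas e alpha).
Local Notation b := (cpos D).

Lemma detz_zbasis (v w : int * int) : detz v w * detz v w = 1 -> zbasis v w.
Proof.
move=> d u; exists (detz v w * detz u w, detz v w * detz v u); split.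
  rewrite /= [LHS]surjective_pairing; congr pair.
    by rewrite -[LHS]mul1r -d /detz; ring.
  by rewrite -[LHS]mul1r -d /detz; ring.
move=> [c1 c2] /= ->; congr pair.
  by rewrite -[RHS]mul1r -d /detz /=; ring.
by rewrite -[RHS]mul1r -d /detz /=; ring.
Qed.

Lemma row4_eta q : q = row4 (q 0 0) (q 0 1) (q 0 2) (q 0 3).
Proof.
apply/rowP => i; rewrite mxE.
by case: i => [[|[|[|[|//]]]] p] /=; congr (q _ _); exact: val_inj.
Qed.

(** Both forms are built from the expansion at the same corner j, so [corner_edge_form] applies
    wherever R2 > 0, the interior included. *)
Lemma corner_first_edge_law j q v t : let R1 := cR1 q in let R2 := cR2 q in
  0 < R2 -> 0 < q 0 2 * cos t + q 0 3 * sin t -> edge_reg D j (b j + R2 - R1) (4 * R1 * R2) ->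
  qf (corner_metric D j q) v =
  qf (edge_metric D alpha j (mn e j.+1) (unfold_corner e j 1 0 1 2 3 t q))
    ('d (unfold_corner e j 1 0 1 2 3 t) q v).
Proof.
move=> R1 R2 R20 a0 er.
move: (mn e j.+1) (shear_mn rD j.+1) => m' sh.
have R10 : 0 <= R1 := cR1_ge0 q.
have rho0 : 0 < R1 + R2 by rewrite ltr_wpDl.
have s0 : 0 <= 4 * R1 * R2 by rewrite !mulr_ge0// ltW.
have [dr dz] := edge_reg_pos er.
have rm0 : 0 < rm D j (b j + R2 - R1) (4 * R1 * R2) by rewrite sqrtr_gt0.
have [_ ->] := @diff_unfold_corner _ e j 1 0 1 2 3 t q a0 R20.
rewrite /edge_metric.
have -> : eX alpha (unfold_corner e j 1 0 1 2 3 t q) = b j + R2 - R1.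
  by rewrite /eX row4E /= (cornerE rD) -/(cR2 q) -/(cR1 q) -/R1 -/R2; ring.
have r2E : Num.sqrt R2 ^+ 2 = R2 by rewrite sqr_sqrtr// ltW.
have -> : eS (unfold_corner e j 1 0 1 2 3 t q) = 4 * R1 * R2.
  by rewrite /eS !row4E /= -/(cR2 q) -/R2 -{3}r2E /R1 /cR1; ring.
rewrite !row4E /= -/(cR2 q) -/R2 mul1r.
have v2E := v2vE s0 rm0 dz.
have wE := eps2_V1v_v2v D j (b j + R2 - R1) (4 * R1 * R2).
have [PE _] := Pc_vectors D j R10 (ltW R20) rho0.
have w0 : wv D j (b j + R2 - R1) (4 * R1 * R2) != 0.
  by rewrite gt_eqF// w_gt0//; exact: edge_corner_reg.
rewrite /corner_metric -/R1 -/R2 (WcE D j R10 (ltW R20) rho0) (fcE D j R10 (ltW R20)) (P2c_vector D j R10 (ltW R20) R20).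
rewrite sh.
apply: corner_edge_form => //; last by rewrite sqrtr_gt0.
- by rewrite -v2E wE.
- rewrite -v2E; case: PE => E1 E2; rewrite -E1 -E2 /mnr /=; split; ring.
Qed.

(** On the open edge between two corners f and f_x are the affine piece of the envelope and its
    slope in both expansions, and g is in both the series [gfun]. *)
Lemma edge_next_corner j x : b j.+1 < x -> x < b j ->
  fI D j x 0 = fI D j.+1 x 0 /\ wv D j x 0 = wv D j.+1 x 0.
Proof.
move=> h1 h2.
have x0 : 0 < x by apply: lt_trans h1; exact: cpos_gt0.
have er : edge_reg D j.+1 x 0.
  split=> //; right; split=> //; first by rewrite add0r exprn_gt0 ?subr_gt0.
  by split=> //; rewrite add0r exprn_gt0 ?subr_gt0.
have f1 := fI_axis_lt (ltW h2); have f2 := fI_axis_gt (ltW h1).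
have g1 := fxI_axis_lt h2; have g2 := fxI_axis_gt h1.
have k1 : gI D j x 0 = gfun D x 0.
  apply: gIE => //; first exact: edge_reg_corner_reg.
  by rewrite addr0 lt_neqAle sqr_ge0 andbT eq_sym sqrf_eq0 subr_eq0 lt_eqF.
have k2 : gI D j.+1 x 0 = gfun D x 0.
  apply: gIE => //; first exact: edge_corner_reg.
  by rewrite addr0 exprn_gt0// subr_gt0.
by rewrite /wv f1 f2 g1 g2 k1 k2.
Qed.

(** The edge j + 1 is described by the expansion at the corner j + 1, not j, so the comparison is
    made only where it is still required, on the edge R2 = 0 itself; there the edge form is
    diagonal. *)
Lemma corner_second_edge_law j q v t : let R1 := cR1 q in
  0 < R1 -> q 0 2 = 0 -> q 0 3 = 0 ->
  0 < q 0 0 * cos t + q 0 1 * sin t -> edge_reg D j.+1 (b j - R1) 0 ->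
  qf (corner_metric D j q) v =
  qf (edge_metric D alpha j.+1 (mn e j) (unfold_corner e j (-1) 2 3 0 1 t q))
    ('d (unfold_corner e j (-1) 2 3 0 1 t) q v).
Proof.
move=> R1 R10 e2 e3 a0 er.
have R20 : cR2 q = 0 by rewrite /cR2 e2 e3 expr0n addr0.
have rho0 : 0 < R1 + 0 by rewrite addr0.
have x1 : b j.+1 < b j - R1.
  by case: er => _ []; [rewrite ltxx|case].
have x2 : b j - R1 < b j by rewrite gtrBl.
have [fE wE] := edge_next_corner x1 x2.
have w0 : wv D j.+1 (b j - R1) 0 != 0.
  have [? _] := edge_reg_pos er.
  by rewrite gt_eqF// w_gt0//; exact: edge_corner_reg.
have f0 : fI D j.+1 (b j - R1) 0 != 0 by rewrite gt_eqF// fI_gt0//; exact: edge_corner_reg.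
have [_ ->] := @diff_unfold_corner _ e j (-1) 2 3 0 1 t q a0 R10.
have zb : zbasis (mn e j.+1) (mn e j).
  apply: detz_zbasis; have := mn_detz e_ge3 j; rewrite /detz => H.
  by rewrite -[RHS]mul1r -H; ring.
rewrite (qf_edge_metric_axis rD _ _ _ zb) ?row4E /= ?e2 ?e3 ?mulr0//.
rewrite ?mul0r ?expr0n /= ?addr0 ?mulr0 ?mul0r ?add0r ?subr0 -/(cR1 q) -/R1.
have -> : corner e j + -1 * R1 - alpha = b j - R1 by rewrite (cornerE rD); ring.
have r2E : Num.sqrt R1 ^+ 2 = R1 by rewrite sqr_sqrtr// ltW.
have W1 := WcE D j (ltW R10) (lexx 0) rho0.
rewrite [b j + 0 - R1]addrAC !addr0 !mulr0 wE in W1.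
have F1 := fcE D j (ltW R10) (lexx 0).
rewrite [b j + 0 - R1]addrAC !addr0 !mulr0 fE in F1.
rewrite /corner_metric -/R1 R20 F1 qf_corner_form /= e2 e3 !mul0r subr0.
set P1 := (_ + 0, _); set P2 := P2c _ _ _ _.
set X := eps2 P1 P2.
have AE : eps2 P1 (mnr D j) = 1.
  by rewrite /P1 /eps2 /mnr /= -(cm_cd_det D j); ring.
(* At R2 = 0 the definition of [Wc] unfolds to this relation, which is solved for X since R1 > 0. *)
have XE : 2 * Wc D j R1 0 = eps2 P1 (mnr D j) + R1 * X.
  by rewrite /Wc /X /P1 /P2 /eps2 /=; field.
rewrite AE W1 in XE; rewrite AE W1.
set Z1 := _ * (2 * _ * 0); set Z2 := (- _ + _) * 0 ^+ 2.
have -> : Z1 = 0 by rewrite /Z1 !mulr0.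
have -> : Z2 = 0 by rewrite /Z2 expr0n mulr0.
move: (wv D j.+1 _ _) w0 (fI D j.+1 _ _) f0 XE => w w0 f f0 XE.
have R1n : R1 != 0 by rewrite gt_eqF.
have {}XE : X = (2 * (R1 * w) - 1) / R1.
  by apply: (canRL (mulfK R1n)); rewrite XE; ring.
rewrite XE.
have N1 : R1 * (v 0 0 ^+ 2 + v 0 1 ^+ 2) =
    (q 0 0 * v 0 0 + q 0 1 * v 0 1) ^+ 2 + (q 0 0 * v 0 1 - q 0 1 * v 0 0) ^+ 2.
  by rewrite /R1 /cR1; ring.
move: N1; set eta := q 0 0 * v 0 1 - q 0 1 * v 0 0; set sg := q 0 0 * v 0 0 + q 0 1 * v 0 1 => N1.
have -> : (-1 * (2 * sg)) ^+ 2 = 4 * R1 * (v 0 0 ^+ 2 + v 0 1 ^+ 2) - 4 * eta ^+ 2.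
  by rewrite -[4 * R1 * _]mulrA N1; ring.
have -> : (2 * Num.sqrt R1 * v 0 2) ^+ 2 = 4 * R1 * v 0 2 ^+ 2 by rewrite !exprMn r2E; ring.
have -> : (2 * Num.sqrt R1 * v 0 3) ^+ 2 = 4 * R1 * v 0 3 ^+ 2 by rewrite !exprMn r2E; ring.
by field; rewrite R1n w0 f0.
Qed.

Lemma corner_first_edge_related j t0 P q q' :
  chart (a := A) (Corner j) P q -> chart (a := A) (Edge j (mn e j.+1) t0) P q' ->
  0 < cR2 q ->
  related (atlas_metric D) (Corner j : chart_index A) (Edge j (mn e j.+1) t0) q q'.
Proof.
move=> cP dP R20.
apply: (@related_corner_edge _ e alpha D rD e_ge3 j j (mn e j.+1) 1 0 1 2 3 (@row4 R)) cP dP (R20) _.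
- by rewrite mulr1.
- by apply: detz_zbasis; rewrite mn_detz.
- by move=> a b' c d; rewrite !row4E.
- by move=> z a b' c d da db dc dd ha hb hc hd; have [] := diff_row4 ha hb hc hd.
- move=> P' z r1 s1 r2 s2 r10 r20 h0 h1 h2 h3 x er E.
  have zE : z = row4 (r1 * cos s1) (r1 * sin s1) (r2 * cos s2) (r2 * sin s2).
    by rewrite [LHS]row4_eta h0 h1 h2 h3.
  have [k1 k2] := cR_polar zE.
  have xE : x = corner e j + cR2 z - cR1 z by rewrite /x k1 k2; ring.
  apply: (corner_chartI rD _ r10 r20 zE); last by rewrite -xE.
  have := edge_corner_reg er; rewrite /corner_dom /= xE (cornerE rD) k1 k2.
  by congr (corner_reg _ _ _ _); ring.
- move=> P' z /(corner_chartE rD)[_ [r1 [s1 [r2 [s2 [r10 r20 zE E]]]]]].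
  have [k1 k2] := cR_polar zE.
  exists r1, s1, r2, s2; split=> //; rewrite ?zE ?row4E//.
  by rewrite E k1 k2; congr (mclass e _ _ _); ring.
- move=> t v a0 er; apply: corner_first_edge_law => //.
  move: er; rewrite -/(cR1 q) -/(cR2 q) (cornerE rD); congr (edge_reg _ _ _ _); ring.
Qed.

Lemma corner_second_edge_related j t0 P q q' :
  chart (a := A) (Corner j) P q -> chart (a := A) (Edge j.+1 (mn e j) t0) P q' ->
  0 < cR1 q -> q 0 2 = 0 -> q 0 3 = 0 ->
  related (atlas_metric D) (Corner j : chart_index A) (Edge j.+1 (mn e j) t0) q q'.
Proof.
move=> cP dP R10 e2 e3.
apply: (@related_corner_edge _ e alpha D rD e_ge3 j j.+1 (mn e j) (-1) 2 3 0 1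
  (fun a b c d => row4 c d a b)) cP dP (R10) _.
- by rewrite mulrNN mulr1.
- apply: detz_zbasis; have := mn_detz e_ge3 j; rewrite /detz => H.
  by rewrite -[RHS]mul1r -H; ring.
- by move=> a b' c d; rewrite !row4E.
- by move=> z a b' c d da db dc dd ha hb hc hd; have [] := diff_row4 hc hd ha hb.
- move=> P' z r1 s1 r2 s2 r10 r20 h0 h1 h2 h3 x er E.
  have zE : z = row4 (r2 * cos s2) (r2 * sin s2) (r1 * cos s1) (r1 * sin s1).
    by rewrite [LHS]row4_eta h0 h1 h2 h3.
  have [k1 k2] := cR_polar zE.
  have xE : x = corner e j + cR2 z - cR1 z by rewrite /x k1 k2; ring.
  apply: (corner_chartI rD _ r20 r10 zE); last by rewrite -xE [lat _ s2 + _]addrC mulrAC.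
  have := edge_reg_corner_reg er; rewrite /corner_dom /= xE (cornerE rD) k1 k2.
  by congr (corner_reg _ _ _ _); ring.
- move=> P' z /(corner_chartE rD)[_ [r1 [s1 [r2 [s2 [r10 r20 zE E]]]]]].
  have [k1 k2] := cR_polar zE.
  exists r2, s2, r1, s1; split=> //; rewrite ?zE ?row4E//.
  by rewrite E k1 k2 [lat _ s1 + _]addrC mulrAC; congr (mclass e _ _ _); ring.
- move=> t v a0 er; apply: corner_second_edge_law => //.
  move: er; rewrite e2 e3 -/(cR1 q) (cornerE rD) expr0n /= addr0 mulr0 mul0r.
  by congr (edge_reg _ _ _ _); ring.
Qed.

End CornerEdges.

(** * The metric on the atlas *)

Section AtlasMetric.
Context {R : realType}.
Variables (e : nat -> int) (alpha : R) (D : cusp_data R).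
Hypothesis rD : represents e alpha D.
Hypothesis e_ge3 : forall j, (1 <= j)%N -> 3 <= e j.
Implicit Types (q v : 'rV[R]_4) (P : M_alpha e alpha).
Local Notation A := (M_alpha_atlas e alpha).
Local Notation G := (@atlas_metric _ e alpha D).

Let inj : forall (c : chart_index A) P P' q, chart c P q -> chart c P' q -> P = P' :=
  @atlas_chart_inj _ _ _ _ rD.
Let func : forall (c : chart_index A) P q q', chart c P q -> chart c P q' -> q = q' :=
  @atlas_chart_fun _ _ _ _ rD e_ge3.

Lemma g_alpha_sym q : (g_alpha e alpha q)^T = g_alpha e alpha q.
Proof.
rewrite /g_alpha /=; apply: trmxZ_sym.
by do ?[exact: sq_form_sym | apply: trmxZ_sym | apply: trmxD_sym].
Qed.

Lemma atlas_metric_sym c q : (G c q)^T = G c q.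
Proof.
by case: c => [z0|j pq t0|j]; [exact: g_alpha_sym|exact: edge_form_sym|exact: corner_form_sym].
Qed.

Let trans := @related_trans _ _ A G inj.
Let symm := @related_sym _ _ A G inj func.

Lemma window_refl (t : R) : window t t.
Proof. by rewrite /window subrr normr0 pi_gt0. Qed.

Lemma edge_chart_center j pq (x y s t : R) P : zbasis (mn e j) pq ->
  Dplus_closed alpha x y -> (y = 0 -> open_edge e j x) ->
  sval P = mclass e x y (lat (mn e j) s + lat pq t) ->
  chart (a := A) (Edge j pq t) P (row4 x t (y * cos s) (y * sin s)).
Proof. by move=> zb Dxy o E; split=> //; exists x, y, s, t; split=> //; exact: window_refl. Qed.

Lemma interior_chart_center (x y z1 z2 : R) P : Dplus alpha x y -> sval P = mclass e x y (z1, z2) ->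
  chart (a := A) (Interior (z1, z2)) P (row4 x y z1 z2).
Proof. by move=> Dxy E; exists x, y, z1, z2; split=> //; exact: window_refl. Qed.

Lemma edge_chart_interior j pq t0 P q : chart (a := A) (Edge j pq t0) P q -> eS q != 0 ->
  exists z0 q', chart (a := A) (Interior z0) P q'.
Proof.
move=> cP S0; have [_ dq _ [y [s [y0 e2 e3 E]]]] := edge_chartE rD cP.
have yn : y != 0 by rewrite -sqrf_eq0 -(eS_polar e2 e3).
have [xa _] := dq; rewrite /eX subr_gt0 in xa.
eexists; eexists; apply: interior_chart_center; last by rewrite E /lat; reflexivity.
by split=> //; rewrite lt_neqAle eq_sym yn.
Qed.

(** The first edge serves wherever r2 > 0; only the open edge r2 = 0 requires the second one. *)
Lemma corner_chart_edge_chart j P q : chart (a := A) (Corner j) P q -> 0 < cR1 q + cR2 q ->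
  exists j' pq t0 q', chart (a := A) (Edge j' pq t0) P q' /\
    related G (Corner j : chart_index A) (Edge j' pq t0) q q'.
Proof.
move=> cP r0; have [x [y [r1 [r2 [s1 [s2 [[Dxy o] [r10 r20] [ex ey] E qE]]]]]]] := cP.
have [k1 k2] := cR_polar qE; rewrite k1 k2 in r0.
have d1 := mn_detz e_ge3 j.
have zb : zbasis (mn e j) (mn e j.+1) by apply: detz_zbasis; rewrite d1.
have first_edge : (y = 0 -> open_edge e j x) -> 0 < r2 ->
    exists j' pq t0 q', chart (a := A) (Edge j' pq t0) P q' /\
      related G (Corner j : chart_index A) (Edge j' pq t0) q q'.
  move=> o' p2; have cE := edge_chart_center zb Dxy o' E.
  exists j, (mn e j.+1), s2, (row4 x s2 (y * cos s1) (y * sin s1)); split=> //.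
  by apply: (corner_first_edge_related rD e_ge3 cP cE); rewrite k2 exprn_gt0.
case: (corner_chart_edge rD r10 r20 o ex ey) => [[y0 [_ p2]]|[y0 _ p2 o']|[y0 p1 p2 o']|[y0 p1 p2 _]].
- by apply: first_edge => // yy; rewrite yy ltxx in y0.
- exact: first_edge.
- have zb' : zbasis (mn e j.+1) (mn e j).
    by apply: detz_zbasis; rewrite -[RHS]mul1r -d1 /detz; ring.
  have E' : sval P = mclass e x y (lat (mn e j.+1) s2 + lat (mn e j) s1) by rewrite E addrC.
  have cE := edge_chart_center zb' Dxy (fun=> o') E'.
  exists j.+1, (mn e j), s1, (row4 x s1 (y * cos s2) (y * sin s2)); split=> //.
  apply: (corner_second_edge_related rD e_ge3 cP cE); first by rewrite k1 exprn_gt0.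
    by rewrite qE row4E /= p2 mul0r.
  by rewrite qE row4E /= p2 mul0r.
- by move: r0; rewrite p1 p2 expr0n addr0 ltxx.
Qed.

(** Off the axis both charts are compared with an interior chart; on the axis they belong to the
    same edge. *)
Lemma edge_edge_any j pq t0 j' pq' t0' P q q' :
  chart (a := A) (Edge j pq t0) P q -> chart (a := A) (Edge j' pq' t0') P q' ->
  related G (Edge j pq t0 : chart_index A) (Edge j' pq' t0') q q'.
Proof.
move=> cP dP; have [S0|Sn] := eqVneq (eS q) 0; last first.
  have [z0 [qi iP]] := edge_chart_interior cP Sn.
  exact: trans (symm (interior_edge_related rD e_ge3 iP cP)) (interior_edge_related rD e_ge3 iP dP).
have [_ [x [y [s [t [[_ o] _ E qE]]]]]] := cP; have [_ [x' [y' [s' [t' [[_ o'] _ E' _]]]]]] := dP.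
have y0 : y = 0.
  by apply/eqP; rewrite -sqrf_eq0 -(@eS_polar _ q y s) ?S0 ?qE ?row4E.
move: E'; rewrite E => /mclass_xy[xx yy]; rewrite -xx -yy in o'.
have jj := open_edge_inj rD (o y0) (o' y0); subst j'.
exact: edge_edge_related cP dP S0.
Qed.

Lemma related_to_edge j pq t0 P q (c : chart_index A) q' :
  chart (a := A) (Edge j pq t0) P q -> chart c P q' -> related G c (Edge j pq t0) q' q.
Proof.
move=> eP; case: c => [z0|j' pq' t0'|j'] cP.
- exact: interior_edge_related cP eP.
- exact: edge_edge_any cP eP.
have [r0|r0] := ltP 0 (cR1 q' + cR2 q').
  have [i [pq' [t0' [q2 [dP rl]]]]] := corner_chart_edge_chart cP r0.
  exact: trans rl (edge_edge_any dP eP).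
exfalso; have [x [y [r1 [r2 [s1 [s2 [_ [r10 r20] [ex ey] E qE]]]]]]] := cP.
have [k1 k2] := cR_polar qE; rewrite k1 k2 in r0.
have [_ [x' [y' [s' [t' [[_ o'] _ E' _]]]]]] := eP.
have /andP[/eqP z1 /eqP z2] : (r1 == 0) && (r2 == 0).
  by rewrite -(sqrf_eq0 r1) -(sqrf_eq0 r2) -paddr_eq0 ?sqr_ge0// eq_le r0 addr_ge0 ?sqr_ge0.
move: E'; rewrite E => /mclass_xy[xx yy]; rewrite -xx -yy in o'.
have y0 : y = 0 by rewrite ey z2 mulr0.
have := o' y0; rewrite (_ : x = corner e j'); first exact: open_edge_corner.
by apply/subr0_eq; rewrite ex z1 z2 expr0n subrr.
Qed.

(** A point that lies in no edge chart is a corner, and the only chart around it is the one of that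
    corner, so that reflexivity is enough. *)
Lemma atlas_related (c d : chart_index A) P q q' : chart c P q -> chart d P q' ->
  related G c d q q'.
Proof.
move=> cP dP.
have [[j [pq [t0 [q0 eP]]]]|noE] :=
    pselect (exists j pq t0 q0, chart (a := A) (Edge j pq t0) P q0).
  exact: trans (related_to_edge eP cP) (symm (related_to_edge eP dP)).
have corner_center (c' : chart_index A) q1 : chart c' P q1 ->
    exists j, c' = Corner j /\ sval P = mclass e (corner e j) 0 (0, 0).
  case: c' => [z0|j pq t0|j] c'P.
  - exfalso; apply: noE; have [x [y [z1 [z2 [[xa y0] _ _ E _]]]]] := c'P.
    have zb : zbasis (mn e 0) (mn e 1) by apply: detz_zbasis; rewrite (mn_detz e_ge3).
    exists 0, (mn e 1), z1; eexists; apply: (edge_chart_center (x := x) (y := y) (s := - z2) zb).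
    + by split=> //; exact: ltW.
    + by move=> yy; rewrite yy ltxx in y0.
    + by rewrite E /lat /=; congr (mclass e _ _ (_, _)); rewrite /=; ring.
  - by case: noE; exists j, pq, t0, q1.
  have [r0|r0] := ltP 0 (cR1 q1 + cR2 q1).
    by have [i [pq' [t0' [q2 [d'P _]]]]] := corner_chart_edge_chart c'P r0; case: noE; exists i, pq', t0', q2.
  exists j; split=> //.
  have [x [y [r1 [r2 [s1 [s2 [_ [r10 r20] [ex ey] E qE]]]]]]] := c'P.
  have [k1 k2] := cR_polar qE; rewrite k1 k2 in r0.
  have /andP[/eqP z1 /eqP z2] : (r1 == 0) && (r2 == 0).
    by rewrite -(sqrf_eq0 r1) -(sqrf_eq0 r2) -paddr_eq0 ?sqr_ge0// eq_le r0 addr_ge0 ?sqr_ge0.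
  have y0 : y = 0 by rewrite ey z2 mulr0.
  have xE : x = corner e j by apply/subr0_eq; rewrite ex z1 z2 expr0n subrr.
  by rewrite E y0 xE; exact: mclass_corner.
have [j [cE E]] := corner_center _ _ cP; have [j' [dE E']] := corner_center _ _ dP.
move: E'; rewrite E => /mclass_xy[jj _].
have {}jj : j = j'.
  move: jj; rewrite !(cornerE rD) => /addrI bb.
  by case: (ltngtP j j') => // /(cpos_ltn D); rewrite bb ltxx.
subst c d j'; have -> : q' = q by exact: func dP cP.
apply: related_refl.
have [dq _] := corner_chartE rD cP.
have : \forall z \near q, corner_dom D j z by apply: open_nbhs_nbhs; split=> //; exact: open_corner_dom.
apply: filterS => z dz.
have [s1 [h0 h1]] := polar_exists (z 0 0) (z 0 1); have [s2 [h2 h3]] := polar_exists (z 0 2) (z 0 3).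
have [r10 r20] : 0 <= Num.sqrt (z 0 0 ^+ 2 + z 0 1 ^+ 2) /\ 0 <= Num.sqrt (z 0 2 ^+ 2 + z 0 3 ^+ 2).
  by split; exact: sqrtr_ge0.
move: (Num.sqrt _) (Num.sqrt _) h0 h1 h2 h3 r10 r20 => r2 r1 h0 h1 h2 h3 r10 r20.
have zE : z = row4 (r1 * cos s1) (r1 * sin s1) (r2 * cos s2) (r2 * sin s2).
  by rewrite [LHS]row4_eta h0 h1 h2 h3.
have [k1 k2] := cR_polar zE.
have yz0 : 0 <= 2 * r1 * r2 by rewrite !mulr_ge0.
have H : corner_reg D j (corner e j + cR2 z - cR1 z - alpha) ((2 * r1 * r2) ^+ 2).
  move: dz; rewrite /corner_dom /= (cornerE rD) k1 k2; congr (corner_reg _ _ _ _); ring.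
have [Dz _] := (corner_reg_closed rD j _ yz0).1 H.
exists (point e (lat (mn e j) s1 + lat (mn e j.+1) s2) Dz).
exact: (corner_chartI rD dz r10 r20 zE).
Qed.

End AtlasMetric.

(** * Smoothness and positivity over the whole atlas *)

Section AtlasMetricTensor.
Context {R : realType}.
Variables (e : nat -> int) (alpha : R) (D : cusp_data R).
Hypothesis rD : represents e alpha D.
Hypothesis e_ge3 : forall j, (1 <= j)%N -> 3 <= e j.
Implicit Types (q v : 'rV[R]_4).
Local Notation A := (M_alpha_atlas e alpha).
Local Notation G := (@atlas_metric _ e alpha D).

(** Phrased with [quadrant] so that functions of (xi, s) can be pulled back to it. *)
Definition interior_dom : set 'rV[R]_4 := [set q | quadrant (q 0 0 - alpha) (q 0 1 ^+ 2) /\ 0 < q 0 1].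

Lemma interior_domP q : interior_dom q <-> alpha < q 0 0 /\ 0 < q 0 1.
Proof.
split=> [[[x0 _] y0]|[xa y0]]; first by rewrite -subr_gt0.
by split=> //; exact: quadrant_alpha.
Qed.

Let cX : Cinfty setT (fun q => q 0 0 - alpha).
Proof. by have oT : open [set: 'rV[R]_4] by [exact: openT]; cinfty. Qed.

Let cS : Cinfty setT (fun q => q 0 1 ^+ 2).
Proof. by have oT : open [set: 'rV[R]_4] by [exact: openT]; cinfty. Qed.

Lemma open_interior_dom : open interior_dom.
Proof.
apply: openI; first exact: (open_pull cX cS open_quadrant).
apply: (@open_pos _ _ (fun q : 'rV[R]_4 => q 0 1)).
have oT : open [set: 'rV[R]_4] by exact: openT.
by apply: continuous_Cinfty; cinfty.
Qed.

(** The expansion at the corner 0 represents f, f_x and f_y / y on the whole interior, so everything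
    follows from the smoothness of H_0 and r_0. *)
Lemma Cmx_g_alpha : Cmx interior_dom (g_alpha e alpha).
Proof.
have oU := open_interior_dom.
have pull (h : R -> R -> R) : Cinfty (set2 (corner_reg D 0)) (lift2 h) ->
    Cinfty interior_dom (fun q => h (q 0 0 - alpha) (q 0 1 ^+ 2)).
  move=> H.
  have S : interior_dom `<=` [set q : 'rV[R]_4 | quadrant (q 0 0 - alpha) (q 0 1 ^+ 2)] by move=> q [].
  apply: (Cinfty_sub S); apply: (Cinfty_pull cX cS open_quadrant).
  by apply: Cinfty_sub H => q; exact: quadrant_corner_reg.
have oC := @open_corner_reg _ D 0.
have cH : Cinfty (set2 (corner_reg D 0)) (lift2 (Hfun D 0)) by exact: Cinfty_Hfun.
have U1 := pull _ cH; have U2 := pull _ (Cinfty_dx2 oC cH); have U3 := pull _ (Cinfty_ds2 oC cH).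
have UX : Cinfty interior_dom (fun q => q 0 0 - alpha) by cinfty.
have US : Cinfty interior_dom (fun q => q 0 1 ^+ 2) by cinfty.
have rp q : interior_dom q -> 0 < (q 0 0 - alpha - cpos D 0) ^+ 2 + q 0 1 ^+ 2.
  by move=> [[_ s0] _]; rewrite ltr_wpDl ?sqr_ge0.
have U4 : Cinfty interior_dom (fun q => rm D 0 (q 0 0 - alpha) (q 0 1 ^+ 2)).
  by apply: Cinfty_sqrt => //; cinfty.
have UV : Cinfty interior_dom (fun q => (2 * rm D 0 (q 0 0 - alpha) (q 0 1 ^+ 2))^-1).
  by apply: CinftyV => //; [move=> q /rp ?; rewrite mulr_gt0// sqrtr_gt0|cinfty].
have cf : Cinfty interior_dom (fun q => fI D 0 (q 0 0 - alpha) (q 0 1 ^+ 2)) by rewrite /fI; cinfty.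
have cfx : Cinfty interior_dom (fun q => fxI D 0 (q 0 0 - alpha) (q 0 1 ^+ 2)) by rewrite /fxI; cinfty.
have cg : Cinfty interior_dom (fun q => gI D 0 (q 0 0 - alpha) (q 0 1 ^+ 2)) by rewrite /gI; cinfty.
have cw : Cinfty interior_dom (fun q => wv D 0 (q 0 0 - alpha) (q 0 1 ^+ 2)).
  by rewrite /wv /wI; cinfty.
have dom q : interior_dom q -> [/\ alpha < q 0 0, 0 < q 0 1 & quadrant (q 0 0 - alpha) (q 0 1 ^+ 2)].
  by move=> Uq; have [? ?] := (interior_domP q).1 Uq; split=> //; case: Uq.
have wp q : interior_dom q -> 0 < wv D 0 (q 0 0 - alpha) (q 0 1 ^+ 2).
  by move=> Uq; have [? ? Q] := dom q Uq; apply: w_gt0; [exact: quadrant_corner_reg|rewrite sqr_ge0|exact: rp].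
have fp q : interior_dom q -> 0 < fI D 0 (q 0 0 - alpha) (q 0 1 ^+ 2).
  by move=> Uq; have [? ? Q] := dom q Uq; apply: fI_gt0; [exact: quadrant_corner_reg|rewrite sqr_ge0].
have fE q : interior_dom q -> f_alpha e alpha (q 0 0) (q 0 1) = fI D 0 (q 0 0 - alpha) (q 0 1 ^+ 2).
  by move=> /dom[? ? Q]; rewrite (f_alphaE rD)// (fI_quadrant D 0 Q).
have fxE q : interior_dom q -> fx_alpha e alpha (q 0 0) (q 0 1) = fxI D 0 (q 0 0 - alpha) (q 0 1 ^+ 2).
  by move=> /dom[? ? Q]; rewrite (fx_alphaE rD)// (fxI_quadrant D 0 Q).
have gE q : interior_dom q -> fy_alpha e alpha (q 0 0) (q 0 1) =
    q 0 1 * gI D 0 (q 0 0 - alpha) (q 0 1 ^+ 2).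
  move=> Uq; have [? ? Q] := dom q Uq; rewrite (fy_alphaE rD)// gIE//.
  - exact: quadrant_corner_reg.
  - by rewrite sqr_ge0.
  - exact: rp.
have wE q : interior_dom q -> `|w_alpha e alpha (q 0 0) (q 0 1)| = wv D 0 (q 0 0 - alpha) (q 0 1 ^+ 2).
  by move=> Uq; have [? ? Q] := dom q Uq; rewrite (w_alphaE rD)// (wI_gI D 0 Q) gtr0_norm// wp.
have eq1 (h h' : 'rV[R]_4 -> R) : (forall q, interior_dom q -> h q = h' q) ->
    Cinfty interior_dom h' -> Cinfty interior_dom h.
  by move=> E H; apply: (Cinfty_eq oU _ H) => q Uq; rewrite E.
have cfa : Cinfty interior_dom (fun q => f_alpha e alpha (q 0 0) (q 0 1)) by exact: eq1 fE cf.
have cfxa : Cinfty interior_dom (fun q => fx_alpha e alpha (q 0 0) (q 0 1)) by exact: eq1 fxE cfx.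
have cfya : Cinfty interior_dom (fun q => fy_alpha e alpha (q 0 0) (q 0 1)).
  by apply: (eq1 _ _ gE); cinfty.
have cwa : Cinfty interior_dom (fun q => `|w_alpha e alpha (q 0 0) (q 0 1)|) by exact: eq1 wE cw.
have cf2 : Cinfty interior_dom (fun q => (f_alpha e alpha (q 0 0) (q 0 1) ^+ 2)^-1).
  apply: CinftyV => //; last by cinfty.
  by move=> q Uq; rewrite (fE q Uq) exprn_gt0// fp.
have cw2 : Cinfty interior_dom (fun q => (w_alpha e alpha (q 0 0) (q 0 1) ^+ 2)^-1).
  apply: (eq1 _ (fun q => (wv D 0 (q 0 0 - alpha) (q 0 1 ^+ 2) ^+ 2)^-1)).
    by move=> q Uq; rewrite -real_normK ?num_real// (wE q Uq).
  by apply: CinftyV => //; [move=> q /wp ?; rewrite exprn_gt0|cinfty].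
have cy : Cinfty interior_dom (fun q => q 0 1) by cinfty.
have cx : Cinfty interior_dom (fun q => q 0 0) by cinfty.
rewrite /g_alpha /v1_alpha /v2_alpha; cbv zeta; move: cfa cfxa cfya cwa cf2 cw2.
move: (f_alpha e alpha) (fx_alpha e alpha) (fy_alpha e alpha) (w_alpha e alpha).
move=> F FX FY W {fE fxE gE wE} cfa cfxa cfya cwa cf2 cw2.
apply: (Cmx_Z oU); first by cinfty.
apply: (Cmx_D oU); first by apply: (Cmx_D oU); apply: (Cmx_sq oU) => k; exact: Cinfty_cst.
apply: (Cmx_Z oU) => //; apply: (Cmx_D oU); apply: (Cmx_sq oU) => k.
  by rewrite /eps_dz; cbn [fst snd]; apply: Cinfty_row4; cinfty.
by rewrite /eps_dz; cbn [fst snd]; apply: Cinfty_row4; cinfty.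
Qed.

(** As eps(v_1, v_2) = y w is nonzero, the two forms eps(v_i, dz) determine dz, by Cramer's rule. *)
Lemma g_alpha_pos q v : interior_dom q -> v != 0 -> 0 < qf (g_alpha e alpha q) v.
Proof.
move=> Uq v0; have [xa y0] := (interior_domP q).1 Uq.
rewrite (qf_g_alpha rD 0)//.
have Q := quadrant_alpha xa y0.
move: (q 0 0 - alpha) Q => xi Q; set s := q 0 1 ^+ 2.
have w0 : 0 < wv D 0 xi s.
  by apply: w_gt0; [exact: quadrant_corner_reg|rewrite sqr_ge0|rewrite ltr_wpDl ?sqr_ge0 ?exprn_gt0].
have f0 : 0 < fI D 0 xi s by apply: fI_gt0; [exact: quadrant_corner_reg|rewrite sqr_ge0].
apply: mulr_gt0; first by rewrite divr_gt0// exprn_gt0.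
have W0 : 0 < (wv D 0 xi s ^+ 2)^-1 by rewrite invr_gt0 exprn_gt0.
set dz := (v 0 2, _); set c1 := eps2 _ dz; set c2 := eps2 _ dz.
have E : wv D 0 xi s * dz.1 = c1 * (v2v D 0 xi s).1 - c2 * (V1v D 0 xi s).1.
  by rewrite -eps2_V1v_v2v /c1 /c2 /eps2; ring.
have E' : wv D 0 xi s * dz.2 = c1 * (v2v D 0 xi s).2 - c2 * (V1v D 0 xi s).2.
  by rewrite -eps2_V1v_v2v /c1 /c2 /eps2; ring.
have wn : wv D 0 xi s != 0 by rewrite gt_eqF.
rewrite lt_neqAle; apply/andP; split; last first.
  by rewrite !addr_ge0 ?sqr_ge0// mulr_ge0 ?addr_ge0 ?sqr_ge0// ltW.
apply: contraNneq v0 => /esym/eqP.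
rewrite paddr_eq0 ?addr_ge0 ?sqr_ge0//; last by rewrite mulr_ge0 ?addr_ge0 ?sqr_ge0// ltW.
rewrite paddr_eq0 ?sqr_ge0// !sqrf_eq0 mulf_eq0 (gt_eqF W0) /= paddr_eq0 ?sqr_ge0// !sqrf_eq0.
rewrite mulf_eq0 (gt_eqF y0) /= => /andP[/andP[/eqP z0 /eqP z1] /andP[/eqP k1 /eqP k2]].
rewrite k1 k2 !mul0r subrr in E E'.
have z2 : v 0 2 = 0 by apply: (mulfI wn); rewrite mulr0 -[RHS]E.
have z3 : v 0 3 = 0.
  have : dz.2 = 0 by apply: (mulfI wn); rewrite mulr0.
  by rewrite /dz /= z2 mulr0 subr0.
by rewrite (row4_eta v) z0 z1 z2 z3; apply/eqP/rowP => i; rewrite !mxE; case: i => [[|[|[|[|//]]]] p].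
Qed.

Lemma interior_chart_dom z0 P q : chart (a := A) (Interior z0) P q -> interior_dom q.
Proof.
by move=> [x [y [z1 [z2 [[xa y0] _ _ _ ->]]]]]; apply/interior_domP; rewrite !row4E.
Qed.

(** Away from the diagonal cases positivity is transported between related charts, whose coordinate
    changes have injective differentials. *)
Lemma atlas_metric_pos (c : chart_index A) P q v : chart c P q -> v != 0 -> 0 < qf (G c q) v.
Proof.
have edge_pos j pq t0 q' v' : chart (a := A) (Edge j pq t0) P q' -> v' != 0 ->
    0 < qf (G (Edge j pq t0 : chart_index A) q') v'.
  move=> cP; have [S0|Sn] := eqVneq (eS q') 0; last first.
    have [z0 [qi iP]] := edge_chart_interior rD cP Sn.
    have rl := related_sym (atlas_chart_inj rD) (atlas_chart_fun rD e_ge3)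
      (interior_edge_related rD e_ge3 iP cP).
    apply: (related_pos (atlas_chart_inj rD) (atlas_chart_fun rD e_ge3) rl) => u u0.
    exact: g_alpha_pos (interior_chart_dom iP) u0.
  move=> v0; have [zb dq _ _] := edge_chartE rD cP.
  have [e2 e3] : q' 0 2 = 0 /\ q' 0 3 = 0.
    by move/eqP: S0; rewrite paddr_eq0 ?sqr_ge0// !sqrf_eq0 => /andP[/eqP ? /eqP ?].
  rewrite (qf_edge_metric_axis rD _ e2 e3 zb).
  rewrite /edge_dom /= S0 /eX in dq; have [r0 _] := edge_reg_pos dq.
  have w0 : 0 < wv D j (q' 0 0 - alpha) 0 by apply: w_gt0 => //; exact: edge_corner_reg.
  have f0 : 0 < fI D j (q' 0 0 - alpha) 0 by apply: fI_gt0 => //; exact: edge_corner_reg.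
  apply: mulr_gt0; first by rewrite divr_gt0// exprn_gt0.
  have W0 : 0 < (wv D j (q' 0 0 - alpha) 0 ^+ 2)^-1 by rewrite invr_gt0 exprn_gt0.
  rewrite lt_neqAle; apply/andP; split; last first.
    by rewrite !addr_ge0 ?sqr_ge0// mulr_ge0 ?sqr_ge0// ltW.
  apply: contraNneq v0 => /esym/eqP.
  rewrite paddr_eq0 ?addr_ge0 ?sqr_ge0//; last by rewrite mulr_ge0 ?sqr_ge0// ltW.
  rewrite !paddr_eq0 ?addr_ge0 ?sqr_ge0// !sqrf_eq0 mulf_eq0 (gt_eqF W0) /= sqrf_eq0.
  move=> /andP[/andP[/andP[/eqP z0 /eqP z2] /eqP z3] /eqP z1].
  by rewrite (row4_eta v') z0 z1 z2 z3; apply/eqP/rowP => i; rewrite !mxE; case: i => [[|[|[|[|//]]]] p].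
case: c => [z0|j pq t0|j] cP v0.
- exact: g_alpha_pos (interior_chart_dom cP) v0.
- exact: edge_pos cP v0.
have [r0|r0] := ltP 0 (cR1 q + cR2 q).
  have [j' [pq [t0 [q' [dP rl]]]]] := corner_chart_edge_chart rD e_ge3 cP r0.
  apply: (related_pos (atlas_chart_inj rD) (atlas_chart_fun rD e_ge3) rl) v0 => u u0.
  exact: edge_pos dP u0.
have [dq _] := corner_chartE rD cP.
have /andP[/eqP r1 /eqP r2] : (cR1 q == 0) && (cR2 q == 0).
  by rewrite -paddr_eq0 ?cR1_ge0 ?cR2_ge0// eq_le r0 addr_ge0 ?cR1_ge0 ?cR2_ge0.
have f0 : 0 < fc D j (cR1 q) (cR2 q) by apply: fc_gt0; rewrite ?cR1_ge0 ?cR2_ge0.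
have w0 : 0 < Wc D j (cR1 q) (cR2 q) by apply: Wc_gt0; rewrite ?cR1_ge0 ?cR2_ge0.
have /andP[/eqP e0 /eqP e1] : (q 0 0 == 0) && (q 0 1 == 0).
  by rewrite -(sqrf_eq0 (q 0 0)) -(sqrf_eq0 (q 0 1)) -paddr_eq0 ?sqr_ge0// -/(cR1 q) r1.
have /andP[/eqP e2 /eqP e3] : (q 0 2 == 0) && (q 0 3 == 0).
  by rewrite -(sqrf_eq0 (q 0 2)) -(sqrf_eq0 (q 0 3)) -paddr_eq0 ?sqr_ge0// -/(cR2 q) r2.
rewrite /atlas_metric /corner_metric qf_corner_form e0 e1 e2 e3 /= !mul0r !subrr.
rewrite !expr0n /= !mulr0 !addr0 mulr0 addr0.
apply: mulr_gt0; first by rewrite divr_gt0// exprn_gt0.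
rewrite pmulr_rgt0// lt_neqAle; apply/andP; split; last by rewrite !addr_ge0 ?sqr_ge0.
apply: contraNneq v0 => /esym/eqP.
rewrite !paddr_eq0 ?addr_ge0 ?sqr_ge0// !sqrf_eq0.
move=> /andP[/andP[/andP[/eqP z0 /eqP z1] /eqP z2] /eqP z3].
by rewrite (row4_eta v) z0 z1 z2 z3; apply/eqP/rowP => i; rewrite !mxE; case: i => [[|[|[|[|//]]]] p].
Qed.

Lemma atlas_metric_riemannian : riemannian_metric G.
Proof.
split.
- case=> [z0|j pq t0|j] i i'.
  + by apply: (smooth_on_sub open_interior_dom) (Cmx_g_alpha i i') => q [P /interior_chart_dom].
  + apply: (smooth_on_sub (@open_edge_dom _ D alpha j)) (Cmx_edge_metric D alpha j pq i i').
    by move=> q [P /(edge_chartE rD)[]].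
  + apply: (smooth_on_sub (@open_corner_dom _ D j)) (Cmx_corner_metric D j i i').
    by move=> q [P /(corner_chartE rD)[]].
- by move=> c q _; exact: atlas_metric_sym.
- by move=> c q /set_mem[P cP] v v0; exact: atlas_metric_pos cP v0.
- move=> c d q /set_mem[P [cP [q' dP]]].
  exact: (related_law (atlas_chart_inj rD) (atlas_chart_fun rD e_ge3)
    (@atlas_metric_sym _ e alpha D) (atlas_related rD e_ge3 cP dP)).
Qed.

Lemma Dplus_torus_chart (P : M_alpha e alpha) z0 q : interior_chart z0 P q ->
  exists P' : Dplus_torus e alpha, sval P' = P.
Proof.
move=> [x [y [z1 [z2 [Dxy _ _ E _]]]]].
have H : exists x y z, Dplus alpha x y /\ sval P = mclass e x y z by exists x, y, (z1, z2).
by exists (exist _ P H).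
Qed.

(** The charts of the open part are the interior charts of [M_alpha], with the same images, overlaps
    and transitions, so the four properties restrict. *)
Lemma Dplus_torus_riemannian :
  riemannian_metric (A := Dplus_torus_atlas e alpha) (fun _ => g_alpha e alpha).
Proof.
have [sm sy po la] := atlas_metric_riemannian.
have imE (z0 : R * R) : chart_image (A := Dplus_torus_atlas e alpha) z0 =
    chart_image (A := A) (Interior z0).
  apply/seteqP; split=> q [P cP]; first by exists (sval P).
  by have [P' E] := Dplus_torus_chart cP; exists P'; rewrite /= E.
have ovE (c d : R * R) : overlap (A := Dplus_torus_atlas e alpha) c d =
    overlap (A := A) (Interior c) (Interior d).
  apply/seteqP; split=> q [P [cP dP]]; first by exists (sval P).
  by have [P' E] := Dplus_torus_chart cP; exists P'; rewrite /= E.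
have trE (c d : R * R) : transition (A := Dplus_torus_atlas e alpha) c d =
    transition (A := A) (Interior c) (Interior d).
  apply/funext => q; rewrite /transition; congr xget.
  apply/seteqP; split=> q' [P [cP dP]]; first by exists (sval P).
  by have [P' E] := Dplus_torus_chart cP; exists P'; rewrite /= E.
split.
- by move=> c i j; rewrite imE; exact: (sm (Interior c)).
- by move=> c; rewrite imE; exact: (sy (Interior c)).
- by move=> c; rewrite imE; exact: (po (Interior c)).
- by move=> c d; rewrite ovE trE; exact: (la (Interior c) (Interior d)).
Qed.

End AtlasMetricTensor.

Theorem theorem4p4 (R : realType) (e : nat -> int) (alpha : R)
  (alpha01 : 0 < alpha < 1)
  (alpha_irr : irrational alpha)
  (alpha_cfrac : (fun k => ratr (cfrac e k) : R) @ \oo --> alpha)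
  (e_bounds : exists N : int, forall j, (1 <= j)%N -> 3 <= e j <= N) :
  (forall x y : R, Dplus alpha x y ->
     f_alpha e alpha x y != 0 /\ w_alpha e alpha x y != 0) /\
  riemannian_metric (A := Dplus_torus_atlas e alpha)
    (fun _ => g_alpha e alpha) /\
  exists G : chart_index (M_alpha_atlas e alpha) -> 'rV[R]_4 -> 'M[R]_4,
    riemannian_metric G /\
    forall z0 : R * R,
      {in chart_image (A := M_alpha_atlas e alpha) (Interior z0),
        G (Interior z0) =1 g_alpha e alpha}.
Proof.
have e_ge3 j : (1 <= j)%N -> 3 <= e j.
  by case: e_bounds => N H /H /andP[].
have [D rD] := cusp_data_exists e_ge3 alpha_cfrac.
split.
  move=> x y [xa y0]; have Q := quadrant_alpha xa y0; have [x0 s0] := Q.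
  rewrite (f_alphaE rD)// (w_alphaE rD)// gt_eqF ?gt_eqF//; first last.
  - exact: Ffun_gt0 x0 (ltW s0).
  - apply: wI_gt0; [exact: ltW|exact: Ffun_gt0 x0 (ltW s0)|].
    apply: (gfun_lt0 (quadrant_corner_reg D 0 Q) (ltW s0)).
    by rewrite ltr_wpDl ?sqr_ge0.
split; first exact: Dplus_torus_riemannian rD e_ge3.
exists (@atlas_metric _ e alpha D); split; first exact: atlas_metric_riemannian rD e_ge3.
by move=> z0 q _.
Qed.
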